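(* Let $V\in C^2(\mathbb{T}^d)$ with $\max_{\mathbb{T}^d}V=0$, let $u:\mathbb{T}^d\to\mathbb{R}$ be a semiconcave viscosity solution of $\frac12|Du(x)|^2+V(x)=0$ on $\mathbb{T}^d$, and let $x\in\mathbb{T}^d$. If $\int_{\mathbb{T}^d}V(y)\,d\mu(y)<0$ for some measure $\mu\in\mathcal{X}_u(x)$, then there exists $t_0\in[0,\infty)$ such that $\mathbf{x}_u(t,x)\in\mathrm{Sing}(u)$ for all $t\ge t_0$.
   Context: $\mathbb{T}^d=\mathbb{R}^d/\mathbb{Z}^d$ is the flat torus; functions on $\mathbb{T}^d$ are identified with their $\mathbb{Z}^d$-periodic extensions to $\mathbb{R}^d$. A continuous $u:\mathbb{T}^d\to\mathbb{R}$ is semiconcave if there is $C>0$ with $\lambda u(x)+(1-\lambda)u(y)-u(\lambda x+(1-\lambda)y)\le \frac C2\lambda(1-\lambda)|x-y|^2$ for all $x,y$ and $\lambda\in[0,1]$. The superdifferential is $D^+u(x)=\{p\in\mathbb{R}^d:\limsup_{y\to x}\frac{u(y)-u(x)-\langle p,y-x\rangle}{|y-x|}\le0\}$ and the subdifferential is $D^-u(x)=\{p\in\mathbb{R}^d:\liminf_{y\to x}\frac{u(y)-u(x)-\langle p,y-x\rangle}{|y-x|}\ge0\}$. $u$ is a viscosity solution of $\frac12|Du|^2+V=0$ if $\frac12|p|^2+V(x)\le0$ for all $x$ and $p\in D^+u(x)$, and $\frac12|p|^2+V(x)\ge0$ for all $x$ and $p\in D^-u(x)$. $\mathrm{Sing}(u)$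 is the set of points where $u$ is not differentiable. The generalized gradient flow $\mathbf{x}_u(\cdot,x):[0,\infty)\to\mathbb{T}^d$ is the unique locally Lipschitz solution of $\dot{\mathbf{x}}(t)\in D^+u(\mathbf{x}(t))$ for a.e. $t\ge0$, $\mathbf{x}(0)=x$. For $T>0$, $\mu^T_x$ is the probability measure on $\mathbb{T}^d$ with $\int f\,d\mu^T_x=\frac1T\int_0^Tf(\mathbf{x}_u(t,x))\,dt$ for all $f\in C(\mathbb{T}^d)$. $\mathcal{X}_u(x)$ is the set of occupational measures from $x$: all probability measures $\mu$ on $\mathbb{T}^d$ for which there is a sequence $T_k\uparrow\infty$ with $\mu^{T_k}_x\rightharpoonup\mu$ (i.e. $\int f\,d\mu_x^{T_k}\to\int f\,d\mu$ for all $f\in C(\mathbb{T}^d)$). *)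

(* Defs.v *)
From HB Require Import structures.
From mathcomp Require Import all_boot all_order all_algebra.
From mathcomp Require Import generic_quotient.
From mathcomp Require Import all_classical all_reals all_analysis.

Set Implicit Arguments.
Unset Strict Implicit.
Unset Printing Implicit Defensive.

Import Order.TTheory GRing.Theory Num.Theory.
Import numFieldNormedType.Exports.

Local Open Scope classical_set_scope.
Local Open Scope ring_scope.
Local Open Scope quotient_scope.

Section Torus.
Context (R : realType) (d : nat).

Definition lattice_eq (x y : 'rV[R]_d) : bool :=
  [forall i, (x 0 i - y 0 i) \is a Num.int].

Lemma lattice_eq_equiv : equiv_class_of lattice_eq.
Proof.
split=> [x|x y|y x z].
- by apply/forallP => i; rewrite subrr rpred0.
- by apply/eq_forallb => i; rewrite -opprB rpredN.
- move=> /forallP xy /forallP yz; apply/forallP => i.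
  by rewrite -(subrK (y 0 i) (x 0 i)) -addrA rpredD.
Qed.

Canonical lattice_eq_rel := EquivRelPack lattice_eq_equiv.

Definition torus : Type := quotient_topology {eq_quot lattice_eq_rel}.

HB.instance Definition _ := Quotient.on torus.
HB.instance Definition _ := PointedTopological.on torus.

Definition borel_torus : Type := g_sigma_algebraType (@open torus).

HB.instance Definition _ := Measurable.on borel_torus.

(* The Z^d-periodic extension of f to R^d. *)
Definition plift (f : torus -> R) : 'rV[R]_d -> R := f \o \pi_torus.

End Torus.

Section Euclidean.
Context (R : realType) (d : nat).

(* The library norm `|x| on row vectors is the sup norm, hence enorm. *)
Definition dotp (x y : 'rV[R]_d) : R := \sum_i x 0 i * y 0 i.
Definition enorm (x : 'rV[R]_d) : R := Num.sqrt (dotp x x).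

End Euclidean.

Section FunctionsOnTorus.
Context (R : realType) (d : nat).
Implicit Types (u V : torus R d -> R) (x : torus R d).

Definition C2 V : Prop :=
  [/\ forall y, differentiable (plift V) y,
      forall v y, differentiable ('D_v (plift V)) y &
      forall v w, continuous ('D_w ('D_v (plift V)))].

Definition is_max V (m : R) : Prop :=
  (forall x, V x <= m) /\ exists x, V x = m.

Definition semiconcave u : Prop :=
  continuous u /\
  exists2 C : R, 0 < C &
    forall (y z : 'rV[R]_d) (l : R), 0 <= l <= 1 ->
      l * plift u y + (1 - l) * plift u z - plift u (l *: y + (1 - l) *: z)
      <= C / 2 * l * (1 - l) * enorm (y - z) ^+ 2.

Definition slope_defect (w : 'rV[R]_d -> R) (p y z : 'rV[R]_d) : \bar R :=
  ((w z - w y - dotp p (z - y)) / enorm (z - y))%:E.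

(* In the next three definitions the choice of the representative repr x is
   immaterial, because plift u is periodic. *)
Definition superdiff u x : set 'rV[R]_d :=
  [set p | (limf_esup (slope_defect (plift u) p (repr x)) (repr x)^' <= 0)%E].

Definition subdiff u x : set 'rV[R]_d :=
  [set p | (0 <= limf_einf (slope_defect (plift u) p (repr x)) (repr x)^')%E].

Definition Sing u : set (torus R d) :=
  [set x | ~ differentiable (plift u) (repr x)].

Definition viscosity_solution V u : Prop :=
  (forall x p, superdiff u x p -> 2^-1 * enorm p ^+ 2 + V x <= 0) /\
  (forall x p, subdiff u x p -> 0 <= 2^-1 * enorm p ^+ 2 + V x).

(* A locally Lipschitz curve in the torus, with its velocity, is given by a
   locally Lipschitz lift X to R^d.  Only the values xi t with 0 <= t matter;
   t = 0, where 'D_1 X is a two-sided derivative, is a null set.  Solutions from x are unique (for u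
   semiconcave), so this predicate characterizes the flow line of u from x. *)
Definition gradient_flow_from u x (xi : R -> torus R d) : Prop :=
  xi 0 = x /\
  exists X : R -> 'rV[R]_d,
    [/\ forall t : R, 0 <= t -> xi t = \pi_(torus R d) (X t),
        forall t : R, 0 <= t -> exists2 U, nbhs t U &
          [lipschitz X s | s in U `&` [set s | 0 <= s]] &
        {ae @lebesgue_measure R, forall t : R, 0 <= t ->
          derivable X t 1 /\ superdiff u (xi t) ('D_1 X t)}].

End FunctionsOnTorus.

Section Occupation.
Context (R : realType) (d : nat).
Implicit Types (xi : R -> torus R d) (mu : probability (borel_torus R d) R).

Definition time_average_measure xi (T : R) mu : Prop :=
  forall f : torus R d -> R, continuous f ->
    \int[mu]_y f y =
    T^-1 * \int[@lebesgue_measure R]_(t in `[0, T]) f (xi t).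

Definition weak_cvg (m : nat -> probability (borel_torus R d) R) mu : Prop :=
  forall f : torus R d -> R, continuous f ->
    \int[m k]_y f y @[k --> \oo] --> \int[mu]_y f y.

Definition occupational_measure xi : set (probability (borel_torus R d) R) :=
  [set mu | exists T : nat -> R,
    exists m : nat -> probability (borel_torus R d) R,
    [/\ forall k, 0 < T k,
        {homo T : j k / (j <= k)%N >-> j <= k},
        T k @[k --> \oo] --> +oo,
        forall k, time_average_measure xi (T k) (m k) &
        weak_cvg m mu]].

End Occupation.

(* Main.v *)
Require Import Defs.
From HB Require Import structures.
From mathcomp Require Import all_boot all_order all_algebra.
From mathcomp Require Import all_classical all_reals all_analysis.
From mathcomp Require Import measurable_realfun.
From mathcomp Require Import ring lra.

(** Lift everything to R^d. For p in D^+u(x) write alpha = |p|^2/2 + V(x), the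
    energy of p; it is nonpositive, and vanishes when u is differentiable at
    x. The proof rests on one fact (regular_past): if u is differentiable at
    X(T), where X is a flow line, then the energy of every p in D^+u(X(s))
    vanishes for all s < T. In other words, a singular point whose energy is
    negative stays singular. Suppose then that the flow line from x is not
    eventually singular. Its regular times are unbounded, so its velocity
    satisfies |X'|^2 = -2 V(X) almost everywhere, and d/dt u(X) = |X'|^2 gives
    u(X(T)) - u(X(0)) >= -2 times the integral of V(X) over [0, T]
    (energy_bound). As u is bounded, so are these integrals, and every
    occupational measure gives V the mean 0, a contradiction.

    Formally, where u is a minimum of smooth solutions u_i of the equation and
    the velocity is p = sum of l_i Du_i, with weights l_i and all <Du_i, p>
    equal, differentiating the energy along the flow gives alpha' = sum of l_i
    <D^2u_i (Du_i - p), Du_i - p> <= C sum of l_i |Du_i - p|^2 = -2 C alpha,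
    where C is the semiconcavity constant: a negative energy stays negative.
    The velocity of a flow line is not regular enough for this computation, so
    it is carried out on an implicit Euler scheme. One step from x goes to a
    maximizer z of U z - (action of a short arc from x to z), and its slope q
    lies in D^+U(z).

    The discrete inequality, alpha_z (1 + C h)^2 <= alpha_x + o(h)
    (energy_decay), has two ingredients. First, the derivative of the maximum
    with respect to the length of the step is the energy of the maximizer
    (fwd_rate), so that the energy is compared with its mean over shorter
    steps. Second, fwd_gain bounds this mean from below: a minimizer y of U +
    (action to a point near z) has a gradient P, transported to z, with <P, q>
    >= |q|^2 up to o(h), which is what remains here of the fact that D^+U(z)
    is the convex hull of the limits of gradients (fwd_direction);
    semiconcavity at y then controls U x up to |x - y|^2, which is at most -2
    h^2 alpha_z. The minimum over y agrees with U up to an error that cancels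
    (bwd_value); this replaces the theory of calibrated curves.

    Finally the scheme converges to the flow line (fwd_step_curve_dist), and
    its slopes converge to Du at a point of differentiability (slope_close),
    whose energy is 0. *)

Set Implicit Arguments.
Unset Strict Implicit.
Unset Printing Implicit Defensive.

Import Order.TTheory GRing.Theory Num.Theory.
Import numFieldNormedType.Exports.

Local Open Scope classical_set_scope.
Local Open Scope ring_scope.

(** * Euclidean structure on row vectors *)

Section EuclideanLemmas.
Context (R : realType) (d : nat).
Implicit Types (x y z : 'rV[R]_d) (a b : R).

Lemma dotpC x y : dotp x y = dotp y x.
Proof. by apply: eq_bigr => i _; rewrite mulrC. Qed.

Lemma dotpDl x y z : dotp (x + y) z = dotp x z + dotp y z.
Proof. by rewrite -big_split; apply: eq_bigr => i _; rewrite mxE mulrDl. Qed.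

Lemma dotpZl a x y : dotp (a *: x) y = a * dotp x y.
Proof. by rewrite mulr_sumr; apply: eq_bigr => i _; rewrite mxE mulrA. Qed.

Lemma dotpNl x y : dotp (- x) y = - dotp x y.
Proof. by rewrite -scaleN1r dotpZl mulN1r. Qed.

Lemma dotpDr x y z : dotp z (x + y) = dotp z x + dotp z y.
Proof. by rewrite dotpC dotpDl !(dotpC z). Qed.

Lemma dotpZr a x y : dotp x (a *: y) = a * dotp x y.
Proof. by rewrite dotpC dotpZl dotpC. Qed.

Lemma dotpNr x y : dotp x (- y) = - dotp x y.
Proof. by rewrite dotpC dotpNl dotpC. Qed.

Lemma dotp0l x : dotp 0 x = 0.
Proof. by rewrite -(scale0r x) dotpZl mul0r. Qed.

Lemma dotp0r x : dotp x 0 = 0.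
Proof. by rewrite dotpC dotp0l. Qed.

Definition dotpE := (dotpDl, dotpDr, dotpNl, dotpNr, dotpZl, dotpZr, dotp0l, dotp0r).

Lemma dotp_ge0 x : 0 <= dotp x x.
Proof. by apply: sumr_ge0 => i _; rewrite -expr2 sqr_ge0. Qed.

Lemma enorm_ge0 x : 0 <= enorm x. Proof. exact: sqrtr_ge0. Qed.

Lemma enorm_sqr x : enorm x ^+ 2 = dotp x x.
Proof. by rewrite sqr_sqrtr// dotp_ge0. Qed.

Lemma dotpxx x : dotp x x = enorm x * enorm x.
Proof. by rewrite -expr2 enorm_sqr. Qed.

Lemma dotp_eq0 x : dotp x x = 0 -> x = 0.
Proof.
move=> /eqP; rewrite psumr_eq0; last by move=> i _; rewrite -expr2 sqr_ge0.
move=> /allP h; apply/rowP => i; rewrite mxE.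
have /implyP/(_ isT) := h i (mem_index_enum i).
by rewrite mulf_eq0 orbb => /eqP.
Qed.

Lemma CauchySchwarz_dotp x y : dotp x y ^+ 2 <= dotp x x * dotp y y.
Proof.
have [/dotp_eq0 -> | yn] := eqVneq (dotp y y) 0.
  by rewrite !dotpE expr0n mulr0.
have yp : 0 < dotp y y by rewrite lt_neqAle eq_sym yn dotp_ge0.
have := dotp_ge0 (dotp y y *: x - dotp x y *: y).
rewrite !dotpE (dotpC y x) => h.
have {}h : 0 <= dotp y y * (dotp x x * dotp y y - dotp x y ^+ 2).
  by move: h; congr (_ <= _); ring.
by move: h; rewrite pmulr_rge0// subr_ge0.
Qed.

Lemma norm_dotp_le x y : `|dotp x y| <= enorm x * enorm y.
Proof.
rewrite -(@ler_pXn2r _ 2)// ?nnegrE ?mulr_ge0 ?enorm_ge0//.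
by rewrite exprMn !enorm_sqr -normrX ger0_norm ?sqr_ge0// CauchySchwarz_dotp.
Qed.

Lemma dotp_le x y : dotp x y <= enorm x * enorm y.
Proof. exact: le_trans (ler_norm _) (norm_dotp_le x y). Qed.

Lemma dotp_bound x y a b : enorm x <= a -> enorm y <= b -> `|dotp x y| <= a * b.
Proof.
by move=> xa yb; rewrite (le_trans (norm_dotp_le _ _))// ler_pM ?enorm_ge0.
Qed.

Lemma enorm_le a x : 0 <= a -> dotp x x <= a ^+ 2 -> enorm x <= a.
Proof.
by move=> a0 h; rewrite -(@ler_pXn2r _ 2)// ?nnegrE ?enorm_ge0// enorm_sqr.
Qed.

Lemma enormZ a x : enorm (a *: x) = `|a| * enorm x.
Proof.
by rewrite /enorm !dotpE mulrA -expr2 sqrtrM ?sqr_ge0// sqrtr_sqr.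
Qed.

Lemma enormN x : enorm (- x) = enorm x.
Proof. by rewrite /enorm !dotpE opprK. Qed.

Lemma enormD x y : enorm (x + y) <= enorm x + enorm y.
Proof.
apply: enorm_le; first by rewrite addr_ge0 ?enorm_ge0.
rewrite !dotpE (dotpC y x) (dotpxx x) (dotpxx y).
by have := dotp_le x y; lra.
Qed.

Lemma enormB x y : enorm (x - y) <= enorm x + enorm y.
Proof. by rewrite -(enormN y) enormD. Qed.

Lemma enorm_distC x y : enorm (x - y) = enorm (y - x).
Proof. by rewrite -enormN opprB. Qed.

Lemma enorm0 : enorm (0 : 'rV[R]_d) = 0.
Proof. by rewrite /enorm dotp0l sqrtr0. Qed.

Lemma enorm0_eq0 x : enorm x = 0 -> x = 0.
Proof. by move=> h; apply: dotp_eq0; rewrite dotpxx h mul0r. Qed.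

Lemma coord_le_enorm x i : `|x 0 i| <= enorm x.
Proof.
rewrite -(@ler_pXn2r _ 2)// ?nnegrE ?enorm_ge0// enorm_sqr.
rewrite -normrX ger0_norm ?sqr_ge0// /dotp (bigD1 i)//= expr2 lerDl.
by apply: sumr_ge0 => j _; rewrite -expr2 sqr_ge0.
Qed.

Lemma norm_le_enorm x : `|x| <= enorm x.
Proof.
rewrite /Num.norm/= mx_normrE bigmax_le ?enorm_ge0// => -[i j] _ /=.
by rewrite (ord1 i) coord_le_enorm.
Qed.

Lemma coord_le_norm x i : `|x 0 i| <= `|x|.
Proof.
by rewrite [leRHS]/Num.norm/= mx_normrE; apply: (le_bigmax _ _ (ord0, i)).
Qed.

Lemma enorm_le_norm x : enorm x <= (d.+1)%:R * `|x|.
Proof.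
apply: enorm_le; first by rewrite mulr_ge0.
apply: (@le_trans _ _ (d%:R * `|x| ^+ 2)).
  rewrite /dotp -[d in d%:R](card_ord d) mulr_natl -sumr_const.
  apply: ler_sum => i _; rewrite -expr2 -(ger0_norm (sqr_ge0 _)) normrX.
  by rewrite ler_pXn2r ?nnegrE// coord_le_norm.
rewrite exprMn ler_wpM2r ?sqr_ge0// -natrX ler_nat.
by rewrite (leq_trans (leqnSn d))// -mulnn leq_pmulr.
Qed.

Lemma nbhs_enormP (A : set 'rV[R]_d) x :
  nbhs x A <-> exists2 r, 0 < r & forall y, enorm (y - x) <= r -> A y.
Proof.
split=> [/nbhs_ballP[r /= r0 h]|[r r0 h]].
  exists (r / 2); first by rewrite divr_gt0.
  move=> y yr; apply: h; rewrite -ball_normE/= distrC.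
  by have := norm_le_enorm (y - x); lra.
apply/nbhs_ballP; exists (r / (d.+1)%:R); first by rewrite /= divr_gt0.
move=> y; rewrite -ball_normE/= => yr; apply: h.
rewrite (le_trans (enorm_le_norm _))// -ler_pdivlMl// mulrC distrC.
exact: ltW.
Qed.

Lemma cvg_enormP (f : 'rV[R]_d -> R) x :
  {for x, continuous f} <-> forall e, 0 < e -> exists2 r, 0 < r &
    forall y, enorm (y - x) <= r -> `|f y - f x| <= e.
Proof.
split=> [fx e e0|h A /nbhs_ballP[e /= e0 eA]].
  have /fx/nbhs_enormP[r r0 h] : nbhs (f x) (ball (f x) e) by exact: nbhsx_ballx.
  exists r => // y /h; rewrite -ball_normE/= distrC; exact: ltW.
have [r r0 hr] := h (e / 2) ltac:(by rewrite divr_gt0).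
apply/nbhs_enormP; exists r => // y /hr yr; apply: eA.
by rewrite -ball_normE/= distrC; lra.
Qed.

End EuclideanLemmas.

(** * Monotonicity criteria in one variable *)

Section MonotonicityCriteria.
Context (R : realType).
Implicit Types (f : R -> R) (a b c M : R).

(** Errors quadratic in the increment vanish when summed over a fine
    subdivision. This replaces the mean value inequality for value functions
    (minima or maxima of smooth functions), for which only one-sided
    expansions are at hand. *)
Lemma increment_le f a b c M : a <= b ->
  (forall s r, a <= s -> s < r -> r <= b ->
    f r - f s <= c * (r - s) + M * (r - s) ^+ 2) ->
  f b - f a <= c * (b - a).
Proof.
move=> ab h; have [<-|anb] := eqVneq a b; first by rewrite !subrr mulr0.
have {}ab : a < b by rewrite lt_neqAle anb.
apply/ler_addgt0Pr => e e0.
pose A := `|M| * (b - a) ^+ 2.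
have A0 : 0 <= A by rewrite mulr_ge0// sqr_ge0.
have [n An] : exists n : nat, A / e < n%:R.
  by exists (Num.bound (A / e)); apply: archi_boundP; rewrite divr_ge0// ltW.
have n0 : 0 < n%:R :> R by rewrite (le_lt_trans _ An)// divr_ge0// ltW.
pose del := (b - a) / n%:R.
have del0 : 0 < del by rewrite divr_gt0// subr_gt0.
have ndel : n%:R * del = b - a by rewrite mulrC divfK// gt_eqF.
have key k : (k <= n)%N ->
    f (a + k%:R * del) - f a <= k%:R * (c * del + `|M| * del ^+ 2).
  elim: k => [|k IH] kn; first by rewrite !mul0r addr0 subrr.
  have := IH (ltnW kn).
  have : (k.+1%:R : R) <= n%:R by rewrite ler_nat.
  rewrite -natr1 => kn' IHk.
  have ks : a <= a + k%:R * del by rewrite lerDl mulr_ge0// ltW.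
  have kb : a + (k%:R + 1) * del <= b.
    have : (k%:R + 1) * del <= n%:R * del by rewrite ler_pM2r.
    by rewrite ndel; lra.
  have sr : a + k%:R * del < a + (k%:R + 1) * del.
    by rewrite ltrD2l ltr_pM2r// ltrDl.
  have := h _ _ ks sr kb.
  have -> : a + (k%:R + 1) * del - (a + k%:R * del) = del by ring.
  have : M * del ^+ 2 <= `|M| * del ^+ 2.
    by rewrite ler_wpM2r ?sqr_ge0// ler_norm.
  by lra.
have := key n (leqnn n); rewrite ndel subrKC => /le_trans; apply.
have -> : n%:R * (c * del + `|M| * del ^+ 2) =
    c * (n%:R * del) + `|M| * (n%:R * del) ^+ 2 / n%:R.
  by field; rewrite gt_eqF.
rewrite ndel lerD2l -/A ler_pdivrMr//.
by move: An; rewrite ltr_pdivrMr// mulrC => /ltW.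
Qed.

(** By the first hypothesis the set of t with f t <= f b has a least element;
    by the second one this element is a. *)
Lemma left_nondecreasing_le f a b : a <= b ->
  (forall t, a <= t -> t < b -> forall e, 0 < e -> exists2 del, 0 < del &
    forall s, t < s -> s < t + del -> s <= b -> f t <= f s + e) ->
  (forall t, a < t -> t <= b -> exists2 del, 0 < del &
    forall s, t - del < s -> s < t -> a <= s -> f s <= f t) ->
  f a <= f b.
Proof.
move=> ab lsc loc.
pose S := [set t | a <= t <= b /\ f t <= f b].
have Sb : S b by split=> //; rewrite ab lexx.
have infS : has_inf S.
  by split; [exists b | exists a => t [/andP[]]].
pose t := inf S.
have at_ : a <= t by apply: lb_le_inf; [exists b | move=> s [/andP[]]].
have tb : t <= b by apply: ge_inf => //; case: infS.
have ft : f t <= f b.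
  have [->//|tnb] := eqVneq t b.
  have {}tnb : t < b by rewrite lt_neqAle tnb.
  apply/ler_addgt0Pr => e e0; have [del del0 hd] := lsc t at_ tnb e e0.
  have [s Ss sd] := inf_adherent del0 infS.
  have ts : t <= s by apply: ge_inf => //; case: infS.
  case: (Ss) => /andP[_ sb] fs.
  have [<-|tns] := eqVneq s t; first by rewrite (le_trans fs)// lerDl ltW.
  by rewrite (le_trans (hd s _ sd sb))// ?lerD2r// lt_neqAle eq_sym tns.
have [<-//|tna] := eqVneq t a.
have {}tna : a < t by rewrite lt_neqAle eq_sym tna.
have [del del0 hd] := loc t tna tb.
pose s := Num.max a (t - del / 2).
have sa : a <= s by rewrite le_max lexx.
have st : s < t by rewrite gt_max tna/=; lra.
have sd : t - del < s by rewrite lt_max; apply/orP; right; lra.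
have : t <= s.
  apply: ge_inf; first by case: infS.
  split; first by rewrite sa (le_trans (ltW st)).
  by rewrite (le_trans (hd s sd st sa)).
by rewrite leNgt st.
Qed.

Let mu : measure _ _ := @lebesgue_measure R.

(** Cover the exceptional null set by an open set O of small measure. The
    function f t + M |O `&` ]a, t]| + e t has nonnegative left increments near
    every t, because its second term makes up for the slope -M that f may have
    on O. *)
Lemma ae_left_nondecreasing_le_lip f a b M : a <= b -> 0 <= M ->
  (forall s r, a <= s <= b -> a <= r <= b -> `|f s - f r| <= M * `|s - r|) ->
  {ae mu, forall t, a < t -> t <= b -> forall e, 0 < e -> exists2 del, 0 < del &
    forall s, t - del < s -> s < t -> a <= s -> f s <= f t + e * (t - s)} ->
  f a <= f b.
Proof.
move=> ab M0 lip [N [mN N0 sub]].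
apply/ler_addgt0Pr => e e0.
have C0 : 0 < 2 * (b - a + 1) by rewrite mulr_gt0// ltr_wpDl// subr_ge0.
pose e1 := e / (2 * (M + 1)); pose e2 := e / (2 * (b - a + 1)).
have e10 : 0 < e1 by rewrite divr_gt0// mulr_gt0// ltr_wpDl.
have e20 : 0 < e2 by rewrite divr_gt0.
have {}N0 : mu N = 0%E.
  exact: N0.
have Noo : (mu N < +oo)%E by rewrite N0 ltry.
have [ O [oO NO mO]] := lebesgue_regularity_outer mN Noo e10.
have mOm : measurable O by exact: open_measurable.
have mOe : (mu O <= e1%:E)%E.
  have mD : measurable (O `\` N) by exact: measurableD.
  have mON : measurable (O `&` N) by exact: measurableI.
  have ON0 : (mu (O `&` N) <= 0)%E.
    by rewrite -N0; apply: le_measure; rewrite ?inE.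
  have := measureU2 mu mON mD; rewrite setUIDK => /le_trans; apply.
  by rewrite -[leRHS]add0e; apply: leeD => //; exact: ltW.
have mI r r' : measurable (O `&` `]r, r']) by exact: measurableI.
have mIe r r' : (mu (O `&` `]r, r']) <= e1%:E)%E.
  apply: le_trans mOe; apply: le_measure; [| |exact: subIsetl].
    by apply/mem_set; exact: mI.
  by apply/mem_set.
have Ifin r r' : mu (O `&` `]r, r']) \is a fin_num.
  by rewrite ge0_fin_numE//; exact: le_lt_trans (mIe r r') (ltry e1).
pose G t := fine (mu (O `&` `]a, t])).
have GB t : 0 <= G t <= e1.
  apply/andP; split; first by apply: fine_ge0; exact: measure_ge0.
  by rewrite -lee_fin fineK ?Ifin ?mIe.
have GD s t : a <= s -> s <= t -> (fine (mu (O `&` `]s, t])) = G t - G s).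
  move=> as_ st.
  have Gst : mu (O `&` `]a, t]) = (mu (O `&` `]a, s]) + mu (O `&` `]s, t]))%E.
    have dis : (O `&` `]a, s]) `&` (O `&` `]s, t]) = set0.
      rewrite -setIIr; apply/seteqP; split=> // r /= [_]; rewrite !in_itv/=.
      by move=> [/andP[_ rs] /andP[sr _]]; move: (lt_le_trans sr rs); rewrite ltxx.
    by rewrite -(measureU mu (mI a s) (mI s t) dis) -setIUr -itv_bndbnd_setU.
  by rewrite /G Gst fineD// addrAC subrr add0r.
have Gle s t : a <= s -> s <= t -> G s <= G t.
  by move=> as_ st; rewrite -subr_ge0 -GD// fine_ge0.
pose F t := f t + (M * G t + e2 * (t - a)).
have FF : F a <= F b.
  apply: left_nondecreasing_le => // [t at_ tb e' e'0|t at_ tb].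
    exists (e' / (M + 1)); first by rewrite divr_gt0// ltr_wpDl.
    move=> s ts; rewrite -ltrBlDl ltr_pdivlMr ?ltr_wpDl// => sd sb.
    have := lip t s; rewrite at_ (ltW tb) sb (le_trans at_ (ltW ts)).
    move=> /(_ isT isT)/(le_trans (ler_norm _)); rewrite ltr0_norm ?subr_lt0//.
    have : M * G t <= M * G s by rewrite ler_wpM2l// Gle// ltW.
    have : e2 * (t - a) <= e2 * (s - a) by rewrite ler_pM2l//; lra.
    by rewrite /F; nra.
  have [ Ot|nOt] := pselect (O t).
    have /nbhs_ballP[del /= del0 hd] : nbhs t O by exact: open_nbhs_nbhs.
    exists del => // s sd st as_.
    have GG : G t - G s = t - s.
      rewrite -GD//; last exact: ltW.
      rewrite (_ : O `&` `]s, t] = `]s, t]%classic).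
        have := lebesgue_measure_itv `]s, t]; rewrite /= lte_fin st => h.
        exact: congr1 h.
      apply: setIidr => r /=; rewrite in_itv/= => /andP[sr rt]; apply: hd.
      by rewrite -ball_normE/= ger0_norm ?subr_ge0//; lra.
    have := lip s t; rewrite as_ tb (ltW at_) (le_trans (ltW st) tb).
    move=> /(_ isT isT)/(le_trans (ler_norm _)); rewrite ltr0_norm ?subr_lt0//.
    have : e2 * (s - a) <= e2 * (t - a) by rewrite ler_pM2l//; lra.
    rewrite /F; have -> : G t = G s + (t - s) by lra.
    by lra.
  have nNt : ~ N t by move=> /NO.
  have /contrapT/(_ at_ tb e2 e20)[del del0 hd] := contra_not (sub t) nNt.
  exists del => // s sd st as_; have := hd s sd st as_.
  have : M * G s <= M * G t by rewrite ler_wpM2l// Gle// ltW.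
  by rewrite /F; lra.
have Ga : G a = 0 by rewrite /G set_itvoc0 setI0 measure0.
have MG : M * G b <= e / 2.
  rewrite (@le_trans _ _ (M * e1))//; first by rewrite ler_wpM2l//; case/andP: (GB b).
  rewrite /e1 mulrA ler_pdivrMr ?mulr_gt0 ?ltr_wpDl//; nra.
have E2 : e2 * (b - a) <= e / 2.
  by rewrite /e2 mulrAC ler_pdivrMr//; nra.
by move: FF; rewrite /F Ga subrr !mulr0 !addr0; lra.
Qed.

(** Monotonicity is a local property, so local Lipschitz bounds suffice. *)
Lemma ae_left_nondecreasing_le f a b : a <= b ->
  (forall t, a <= t <= b -> exists M del, [/\ 0 <= M, 0 < del &
    forall s r, a <= s <= b -> a <= r <= b ->
      `|s - t| < del -> `|r - t| < del -> `|f s - f r| <= M * `|s - r|]) ->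
  {ae mu, forall t, a < t -> t <= b -> forall e, 0 < e -> exists2 del, 0 < del &
    forall s, t - del < s -> s < t -> a <= s -> f s <= f t + e * (t - s)} ->
  f a <= f b.
Proof.
move=> ab lip dini; apply: left_nondecreasing_le => //.
  move=> t at_ tb e e0.
  have [|M [del [M0 del0 h]]] := lip t; first by rewrite at_ ltW.
  exists (Num.min del (e / (M + 1))).
    by rewrite lt_min del0 divr_gt0// ltr_wpDl.
  move=> s ts; rewrite -ltrBlDl lt_min ltr_pdivlMr ?ltr_wpDl// => /andP[sd se] sb.
  have ets : `|t - s| = s - t by rewrite ltr0_norm ?subr_lt0// opprB.
  have : `|f t - f s| <= M * `|t - s|.
    apply: h; rewrite ?at_ ?(ltW tb) ?sb ?(le_trans at_ (ltW ts))//.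
      by rewrite subrr normr0.
    by rewrite distrC ets.
  rewrite ets => /(le_trans (ler_norm _)) => hM.
  by nra.
move=> t at_ tb.
have [|M [del [M0 del0 h]]] := lip t; first by rewrite (ltW at_).
exists del => // s sd st as_.
apply: (@ae_left_nondecreasing_le_lip _ _ _ M) => //; first exact: ltW.
  move=> r r' /andP[sr rt] /andP[sr' r't]; apply: h.
  - by rewrite (le_trans as_)//= (le_trans rt).
  - by rewrite (le_trans as_)//= (le_trans r't).
  - by rewrite ler0_norm ?subr_le0//; lra.
  - by rewrite ler0_norm ?subr_le0//; lra.
apply: (@filterS _ _ (ae_filter_ringOfSetsType mu) _ _ _ dini).
move=> r hr sr rt e e0.
have [|//|e' e'0 he] := hr _ _ e e0; [exact: le_lt_trans sr|exact: le_trans tb|].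
exists e' => // r' r'r rr' sr'; apply: he => //; exact: le_trans sr'.
Qed.

End MonotonicityCriteria.

(** * Superjets of semiconcave functions *)

Section Semiconcave.
Context (R : realType) (d : nat).
Local Notation E := 'rV[R]_d.
Implicit Types (U : E -> R) (p q x y z w : E).

(** Far from a the penalization exceeds the oscillation of F, so that the
    maximum may be sought on a ball. *)
Lemma exists_max_penalized (F : E -> R) (B r : R) (a : E) :
  continuous F -> (forall z, `|F z| <= B) -> 0 < r ->
  exists z, forall z', F z' - dotp (z' - a) (z' - a) / (2 * r) <=
                       F z - dotp (z - a) (z - a) / (2 * r).
Proof.
move=> Fc FB r0.
have B0 : 0 <= B by rewrite (le_trans _ (FB 0)).
pose rho := 4 * r * (B + 1) + 1.
have rho1 : 1 <= rho by rewrite lerDr !mulr_ge0// ?addr_ge0// ltW.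
have rho0 : 0 <= rho by rewrite (le_trans _ rho1).
pose G z := F z - dotp (z - a) (z - a) / (2 * r).
pose A := [set z : E | enorm (z - a) <= rho].
have subc : continuous (fun z : E => enorm (z - a)).
  move=> z; apply/cvg_enormP => e e0; exists e => // y; apply: le_trans.
  rewrite ler_norml; apply/andP; split.
    by have := enormD (z - y) (y - a); rewrite addrA subrK (enorm_distC z y); lra.
  by have := enormD (y - z) (z - a); rewrite addrA subrK; lra.
have Gc : continuous G.
  suff h (z : E) : (fun z => F z - enorm (z - a) * enorm (z - a) / (2 * r)) @ z -->
      F z - enorm (z - a) * enorm (z - a) / (2 * r).
    rewrite (_ : G = fun z => F z - enorm (z - a) * enorm (z - a) / (2 * r)).
      by move=> z; exact: h.
    by apply/funext => z; rewrite /G dotpxx.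
  apply: (@cvgB _ _ _ _ (nbhs_filter z)); first exact: Fc.
  apply: (@cvgM _ _ _ (nbhs_filter z)); last exact: cvg_cst.
  by apply: (@cvgM _ _ _ (nbhs_filter z)); exact: subc.
have Ac : compact A.
  apply: bounded_closed_compact.
    exists (enorm a + rho); split; first exact: num_real.
    move=> M hM z Az /=; apply: (le_trans (norm_le_enorm _)).
    by have := enormD (z - a) a; rewrite subrK; move: Az; rewrite /A/=; lra.
  rewrite (_ : A = (fun z : E => enorm (z - a)) @^-1` [set t | t <= rho])//.
  apply: closed_comp; first by move=> z _; exact: subc.
  exact: closed_le.
have A0 : A !=set0 by exists a; rewrite /A/= subrr enorm0.
have [z Az hz] := EVT_max_rV A0 Ac (continuous_subspaceT Gc).
exists z => z'; have [Az'|nAz'] := leP (enorm (z' - a)) rho.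
  by apply: hz; rewrite inE.
have := hz a; rewrite inE /A/= subrr enorm0 => /(_ rho0); apply: le_trans.
rewrite /G subrr dotp0l mul0r subr0.
have := FB z'; have := FB a; rewrite !ler_norml => /andP[Fa _] /andP[_ Fz'].
suff : 2 * B <= dotp (z' - a) (z' - a) / (2 * r) by lra.
rewrite ler_pdivlMr ?mulr_gt0// dotpxx.
have : rho * 1 <= enorm (z' - a) * enorm (z' - a).
  by rewrite ler_pM// ltW// (le_lt_trans rho1).
by apply: le_trans; rewrite /rho mulr1; nra.
Qed.

(** For a semiconcave U this is membership of p in D^+U(y), freed from the
    limit: see upper_slope_superjet. *)
Definition superjet (C : R) U p y := forall z,
  U z <= U y + dotp p (z - y) + C / 2 * dotp (z - y) (z - y).

Definition semiconcave_with (C : R) U := forall y z (l : R), 0 <= l <= 1 ->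
  l * U y + (1 - l) * U z - U (l *: y + (1 - l) *: z)
  <= C / 2 * l * (1 - l) * dotp (y - z) (y - z).

(** The two one-sided expansions say that p belongs to D^+U(y), respectively
    D^-U(y). *)
Definition upper_slope U p y := forall e : R, 0 < e -> exists2 r, 0 < r &
  forall w, enorm w <= r -> U (y + w) <= U y + dotp p w + e * enorm w.

Definition lower_slope U p y := forall e : R, 0 < e -> exists2 r, 0 < r &
  forall w, enorm w <= r -> U y + dotp p w - e * enorm w <= U (y + w).

Lemma small_scale w (r : R) : 0 < r ->
  exists2 l : R, 0 < l <= 1 & enorm (l *: w) <= r.
Proof.
move=> r0; have w1 : 0 < enorm w + 1 by rewrite ltr_wpDl// enorm_ge0.
exists (Num.min 1 (r / (enorm w + 1))).
  by rewrite lt_min ltr01 divr_gt0//= ge_min lexx.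
set l := Num.min _ _.
have l0 : 0 <= l by rewrite le_min ler01 divr_ge0// ltW.
have l1 : l <= r / (enorm w + 1) by rewrite ge_min lexx orbT.
rewrite enormZ ger0_norm//; move: l1; rewrite ler_pdivlMr// => l1.
by have := enorm_ge0 w; nra.
Qed.

(** By semiconcavity the difference quotients of U along a segment are
    monotone up to a quadratic error, so a bound on small scales extends to
    all scales. *)
Lemma upper_slope_superjet C U p y : 0 <= C -> semiconcave_with C U ->
  upper_slope U p y -> superjet C U p y.
Proof.
move=> C0 sc up z; apply/ler_addgt0Pr => e e0.
set w := z - y.
have w1 : 0 < enorm w + 1 by rewrite ltr_wpDl// enorm_ge0.
have [r r0 hr] := up (e / (enorm w + 1)) ltac:(by rewrite divr_gt0).
have [l /andP[l0 l1] /hr] := small_scale w r0.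
rewrite dotpZr enormZ (gtr0_norm l0) => h.
have := sc z y l; rewrite (ltW l0) l1 => /(_ isT).
have -> : l *: z + (1 - l) *: y = y + l *: w.
  by apply/rowP => i; rewrite /w !mxE; ring.
rewrite -/w => h'.
have he : e / (enorm w + 1) * (l * enorm w) <= l * e.
  rewrite mulrAC ler_pdivrMr// -mulrA; have := enorm_ge0 w; nra.
have D0 := dotp_ge0 w.
suff : l * U z <= l * (U y + dotp p w + C / 2 * dotp w w + e).
  by rewrite ler_pM2l.
have : 0 <= C / 2 * (l * l * dotp w w) by rewrite !mulr_ge0// ?divr_ge0// ltW.
by lra.
Qed.

(** A semiconcave function with a subgradient is differentiable: semiconcavity
    between y + w and y - m w, with m tending to 0, turns the lower bound at y
    - m w into an upper bound at y + w. *)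
Lemma lower_slope_superjet C U p y : 0 <= C -> semiconcave_with C U ->
  lower_slope U p y -> superjet C U p y.
Proof.
move=> C0 sc lo z; apply/ler_addgt0Pr => e e0.
set w := z - y.
have w1 : 0 < enorm w + 1 by rewrite ltr_wpDl// enorm_ge0.
have D0 := dotp_ge0 w.
have CD0 : 0 < C * dotp w w + 1 by rewrite ltr_wpDl// mulr_ge0.
have e20 : 0 < e / (enorm w + 1) / 2 by rewrite !divr_gt0.
have [r r0 hr] := lo _ e20.
have [l /andP[l0 l1] lr] := small_scale w r0.
pose m := Num.min l (e / (C * dotp w w + 1)).
have m0 : 0 < m by rewrite lt_min l0 divr_gt0.
have ml : m <= l by rewrite ge_min lexx.
have me : m * (C * dotp w w) <= e.
  have : m <= e / (C * dotp w w + 1) by rewrite ge_min lexx orbT.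
  rewrite ler_pdivlMr//; lra.
have := hr (- m *: w); rewrite dotpZr enormZ normrN (gtr0_norm m0).
have -> : m * enorm w <= r.
  by rewrite (le_trans _ lr)// enormZ (gtr0_norm l0) ler_wpM2r// enorm_ge0.
move=> /(_ isT) hm.
have he : e / (enorm w + 1) / 2 * (m * enorm w) <= m * (e / 2).
  rewrite [leLHS]mulrAC ler_pdivrMr// mulrAC ler_pdivrMr//; have := enorm_ge0 w; nra.
have m1 : 0 < 1 + m by rewrite ltr_wpDl.
have := sc z (y + - m *: w) (m / (1 + m)).
have -> : 0 <= m / (1 + m) <= 1.
  by rewrite divr_ge0 ?(ltW m0) ?(ltW m1)//= ler_pdivrMr// mul1r lerDr.
have -> : (m / (1 + m)) *: z + (1 - m / (1 + m)) *: (y + - m *: w) = y.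
  by apply/rowP => i; rewrite /w !mxE; field; rewrite gt_eqF.
have -> : z - (y + - m *: w) = (1 + m) *: w.
  by apply/rowP => i; rewrite /w !mxE; ring.
move=> /(_ isT); rewrite dotpZl dotpZr => h.
have {}h : (1 + m) * (m / (1 + m) * U z + (1 - m / (1 + m)) * U (y + - m *: w) - U y)
  <= (1 + m) * (C / 2 * (m / (1 + m)) * (1 - m / (1 + m)) *
    ((1 + m) * ((1 + m) * dotp w w))) by rewrite ler_pM2l.
have E1 : (1 + m) * (m / (1 + m) * U z + (1 - m / (1 + m)) * U (y + - m *: w) - U y)
  = m * U z + U (y + - m *: w) - (1 + m) * U y by field; rewrite gt_eqF.
have E2 : (1 + m) * (C / 2 * (m / (1 + m)) * (1 - m / (1 + m)) *
    ((1 + m) * ((1 + m) * dotp w w))) = m * (C / 2 * dotp w w) +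
    m * (m * (C * dotp w w)) / 2 by field; rewrite gt_eqF.
rewrite E1 E2 in h.
have : m * (m * (C * dotp w w)) <= m * e by rewrite ler_pM2l.
move=> h2; suff : m * U z <= m * (U y + dotp p w + C / 2 * dotp w w + e).
  by rewrite ler_pM2l.
by lra.
Qed.

(** Add the two superjet inequalities. This one-sided Lipschitz bound is what
    makes the flow of D^+U contracting up to an exponential factor. *)
Lemma superjet_monotone C U p q y z : superjet C U p y -> superjet C U q z ->
  dotp (p - q) (y - z) <= C * dotp (y - z) (y - z).
Proof.
move=> /(_ z); rewrite -(opprB y z) => hp /(_ y) hq.
by move: hp hq; rewrite !dotpE !opprK; lra.
Qed.

Lemma lipschitz_of_quadratic U (K A : R) :
  (forall y z, U z <= U y + K * enorm (z - y) + A * enorm (z - y) ^+ 2) ->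
  forall y z, `|U z - U y| <= K * enorm (z - y).
Proof.
move=> hU y z; suff h u v : U v - U u <= K * enorm (v - u).
  rewrite ler_norml h andbT; have := h z y; rewrite enorm_distC; lra.
pose w := v - u; pose f t := U (u + t *: w).
have -> : U v - U u = f 1 - f 0.
  by rewrite /f scale1r scale0r addr0 /w subrKC.
have -> : K * enorm (v - u) = K * enorm w * (1 - 0) by rewrite subr0 mulr1.
apply: (@increment_le _ _ _ _ _ (A * enorm w ^+ 2)) => // s r s0 sr r1.
have := hU (u + s *: w) (u + r *: w).
have -> : u + r *: w - (u + s *: w) = (r - s) *: w.
  by apply/rowP => i; rewrite !mxE; ring.
rewrite enormZ gtr0_norm ?subr_gt0// /f; lra.
Qed.

End Semiconcave.

(** * Discrete Lax-Oleinik steps *)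

(** The data lifted to R^d, with the constants on which all estimates depend:
    C is the semiconcavity constant, and K dominates C, the slopes of U, the
    gradient g of V and the Lipschitz constant of g. The last field expresses,
    uniformly, that V is of class C^2: it is the second-order consistency of
    the action bwd_cost with the Hamilton-Jacobi equation. *)
Record eikonal_solution (R : realType) (d : nat) (U V : 'rV[R]_d -> R)
    (g : 'rV[R]_d -> 'rV[R]_d) (C K B : R) : Prop := EikonalSolution {
  es_K1 : 1 <= K;
  es_C0 : 0 < C;
  es_CK : C <= K;
  es_Uc : continuous U;
  es_UB : forall y, `|U y| <= B;
  es_sc : semiconcave_with C U;
  es_sub : forall p y, superjet C U p y -> 2^-1 * dotp p p + V y <= 0;
  es_super : forall p y, lower_slope U p y -> 0 <= 2^-1 * dotp p p + V y;
  es_Vc : continuous V;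
  es_V0 : forall y, V y <= 0;
  es_VK : forall y, - (K ^+ 2 / 2) <= V y;
  es_gK : forall y, enorm (g y) <= K;
  es_glip : forall y z, enorm (g y - g z) <= K * enorm (y - z);
  es_Vtaylor : forall y z,
    `|V z - V y - dotp (g y) (z - y)| <= K * dotp (z - y) (z - y);
  es_quad : forall eta : R, 0 < eta -> exists2 rho, 0 < rho &
    forall y e, enorm e <= rho ->
      `|V y - 3 / 4 * V (y + 3^-1 *: e) - 4^-1 * V (y + e)
        + 2^-1 * dotp (g (y + 3^-1 *: e)) e| <= eta * dotp e e }.

Section OneStep.
Context (R : realType) (d : nat) (U V : 'rV[R]_d -> R).
Context (g : 'rV[R]_d -> 'rV[R]_d) (C K B : R).
Context (es : eikonal_solution U V g C K B).
Local Notation E := 'rV[R]_d.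
Implicit Types (p q x y z w : E) (h r s : R).

Let K1 := es_K1 es.
Let C0 := es_C0 es.
Let CK := es_CK es.

Lemma K_gt0 : 0 < K. Proof. by rewrite (lt_le_trans _ K1). Qed.
Let K0 := K_gt0.

Lemma enorm_slope p y : 2^-1 * dotp p p + V y <= 0 -> enorm p <= K.
Proof.
move=> h; apply: enorm_le; first exact: ltW.
by have := es_VK es y; lra.
Qed.

Lemma enorm_superjet p y : superjet C U p y -> enorm p <= K.
Proof. by move=> /(es_sub es)/enorm_slope. Qed.

(** U is differentiable where it has a subgradient, so both viscosity
    inequalities apply. *)
Lemma superjet_eikonal p y : lower_slope U p y ->
  superjet C U p y /\ 2^-1 * dotp p p + V y = 0.
Proof.
move=> lo; have up := lower_slope_superjet (ltW C0) (es_sc es) lo.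
by split=> //; apply/eqP; rewrite eq_le (es_super es lo) (es_sub es up).
Qed.

Lemma quadratic_upper_slope (A : R) p y : 0 <= A ->
  (forall w, U (y + w) <= U y + dotp p w + A * dotp w w) -> superjet C U p y.
Proof.
move=> A0 h; apply: upper_slope_superjet (ltW C0) (es_sc es) _ => e e0.
have A1 : 0 < A + 1 by rewrite ltr_wpDl.
exists (e / (A + 1)); first by rewrite divr_gt0.
move=> w; rewrite ler_pdivlMr// => hw; rewrite (le_trans (h w))// lerD2l dotpxx.
by rewrite mulrA ler_wpM2r ?enorm_ge0//; have := enorm_ge0 w; lra.
Qed.

Lemma quadratic_lower_slope (A : R) p y : 0 <= A ->
  (forall w, U y + dotp p w - A * dotp w w <= U (y + w)) -> lower_slope U p y.
Proof.
move=> A0 h e e0.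
have A1 : 0 < A + 1 by rewrite ltr_wpDl.
exists (e / (A + 1)); first by rewrite divr_gt0.
move=> w; rewrite ler_pdivlMr// => hw; apply: le_trans (h w).
rewrite lerD2l lerN2 dotpxx mulrA ler_wpM2r ?enorm_ge0//.
by have := enorm_ge0 w; lra.
Qed.

(** The paraboloid used as penalization touches U from above at the maximizer. *)
Lemma penalized_superjet r (a : E) z : 0 < r ->
  (forall z', U z' - dotp (z' - a) (z' - a) / (2 * r) <=
              U z - dotp (z - a) (z - a) / (2 * r)) ->
  superjet C U (r^-1 *: (z - a)) z.
Proof.
move=> r0 h; apply: (@quadratic_upper_slope (2 * r)^-1).
  by rewrite invr_ge0 mulr_ge0// ltW.
move=> w; have := h (z + w); rewrite (_ : z + w - a = (z - a) + w); last first.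
  by rewrite addrAC.
move: (z - a) => v; rewrite dotpZl (dotpDl v w) !(dotpDr _ _ v) !(dotpDr _ _ w).
rewrite (dotpC w v) => h'.
have -> : r^-1 * dotp v w = (dotp v w + dotp v w) / (2 * r).
  by field; rewrite gt_eqF.
by move: h'; rewrite !mulrDl; lra.
Qed.

(** Near y there are points carrying a superjet, namely the maximizers of U
    minus a steep paraboloid centred at y; their slopes are bounded by K. *)
Lemma U_increment_quadratic y z :
  U z <= U y + K * enorm (z - y) + C / 2 * enorm (z - y) ^+ 2.
Proof.
apply/ler_addgt0Pr => e e0.
set a := enorm (z - y); have a0 : 0 <= a by exact: enorm_ge0.
have e20 : 0 < e / 2 by rewrite divr_gt0.
have [rho rho0 hrho] := (cvg_enormP U y).1 (es_Uc es (x := y)) _ e20.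
pose A := K ^+ 2 + C / 2 * (2 * a * K + K ^+ 2).
have A0 : 0 < A.
  rewrite ltr_pwDl ?exprn_gt0// mulr_ge0//; first by rewrite divr_ge0// ltW.
  by rewrite addr_ge0 ?sqr_ge0// !mulr_ge0// ltW.
pose r := Num.min 1 (Num.min (rho / K) (e / 2 / A)).
have r0 : 0 < r by rewrite !lt_min ltr01 !divr_gt0.
have r1 : r <= 1 by rewrite ge_min lexx.
have rK : K * r <= rho.
  by rewrite mulrC -ler_pdivlMr// ge_min; apply/orP; right; rewrite ge_min lexx.
have rA : r * A <= e / 2.
  by rewrite -ler_pdivlMr// !ge_min lexx !orbT.
have [y' hy'] := exists_max_penalized y (es_Uc es) (es_UB es) r0.
have jet := penalized_superjet r0 hy'.
have := enorm_superjet jet; rewrite enormZ gtr0_norm ?invr_gt0//.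
rewrite ler_pdivrMl// => yy'.
have := jet z; set p := r^-1 *: _ => hz.
have pK : enorm p <= K by exact: enorm_superjet jet.
have b0 := enorm_ge0 (z - y').
have ba : enorm (z - y') <= a + r * K.
  by have := enormB (z - y) (y' - y); rewrite opprB addrA subrK -/a; lra.
have /hrho : enorm (y' - y) <= rho by lra.
rewrite ler_norml => /andP[_ Uy].
have h1 : dotp p (z - y') <= K * (a + r * K).
  apply: (le_trans (dotp_le _ _)); apply: ler_pM; rewrite ?enorm_ge0//.
have h2 : dotp (z - y') (z - y') <= (a + r * K) ^+ 2.
  by rewrite dotpxx expr2; apply: ler_pM.
have h3 : C / 2 * dotp (z - y') (z - y') <= C / 2 * (a + r * K) ^+ 2.
  by rewrite ler_pM2l// divr_gt0.
have h4 : C / 2 * (r * r * K ^+ 2) <= C / 2 * (r * K ^+ 2).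
  rewrite ler_pM2l ?divr_gt0// ler_pM2r ?exprn_gt0//.
  by rewrite -[leRHS]mulr1 ler_pM2l.
by move: rA hz Uy h1 h3 h4; rewrite /A; lra.
Qed.

Lemma U_lipschitz y z : `|U z - U y| <= K * enorm (z - y).
Proof. exact: lipschitz_of_quadratic U_increment_quadratic y z. Qed.

Lemma V_lip y z : `|V z - V y| <= K * enorm (z - y).
Proof.
apply: (@lipschitz_of_quadratic _ _ V K K) => {}y {}z.
have := es_Vtaylor es y z; rewrite ler_norml => /andP[_].
have := dotp_bound (es_gK es y) (lexx (enorm (z - y))).
by rewrite ler_norml dotpxx => /andP[_]; lra.
Qed.

(** Action of a short arc from x to z in time r, the potential being replaced
    by its first-order expansion at x. *)
Definition fwd_cost r x z :=
  dotp (z - x) (z - x) / (2 * r) - r * (V x + 2^-1 * dotp (g x) (z - x)).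

(** One step of the positive Lax-Oleinik operator. Since fwd_slope is a
    superjet at z, it is also a step of the implicit Euler scheme for the flow
    of D^+U. *)
Definition fwd_step r x z := forall z', U z' - fwd_cost r x z' <= U z - fwd_cost r x z.

(** The derivative of fwd_cost in z. *)
Definition fwd_slope r x z := r^-1 *: (z - x) - (r / 2) *: g x.

(** Completing the square turns a forward step into a maximization as in
    exists_max_penalized. *)
Lemma fwd_cost_square r x z : 0 < r ->
  let a := x + (r ^+ 2 / 2) *: g x in
  fwd_cost r x z =
    dotp (z - a) (z - a) / (2 * r) - r ^+ 3 * dotp (g x) (g x) / 8 - r * V x.
Proof.
move=> r0 a; rewrite /fwd_cost /a opprD addrA; move: (z - x) => v.
rewrite !dotpE (dotpC v); field; lra.
Qed.

Lemma fwd_step_exists r x : 0 < r -> exists z, fwd_step r x z.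
Proof.
move=> r0.
have [z hz] := exists_max_penalized (x + (r ^+ 2 / 2) *: g x) (es_Uc es) (es_UB es) r0.
by exists z => z'; rewrite !fwd_cost_square//; have := hz z'; lra.
Qed.

Lemma fwd_step_superjet r x z : 0 < r -> fwd_step r x z ->
  superjet C U (fwd_slope r x z) z.
Proof.
move=> r0 hz; set a := x + (r ^+ 2 / 2) *: g x.
have -> : fwd_slope r x z = r^-1 *: (z - a).
  by apply/rowP => i; rewrite /fwd_slope /a !mxE; field; rewrite gt_eqF.
apply: penalized_superjet => // z'.
by have := hz z'; rewrite !fwd_cost_square// -/a; lra.
Qed.

(** Node of the Radau rule on [0, 1] with nodes 1/3 and 1 and weights 3/4 and
    1/4, which is exact in degree 2. *)
Definition radau_node y (zeta : E) := y + 3^-1 *: (zeta - y).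

(** Action from y to zeta along a segment. The mean of V over the segment is
    evaluated by the Radau rule: with a first-order rule the error of
    bwd_value would depend on zeta at the order h^3, which is too much for
    fwd_direction. *)
Definition bwd_cost h y (zeta : E) :=
  dotp (zeta - y) (zeta - y) / (2 * h) -
  h * (3 / 4 * V (radau_node y zeta) + 4^-1 * V zeta).

Definition bwd_step h (zeta y : E) :=
  forall y', U y + bwd_cost h y zeta <= U y' + bwd_cost h y' zeta.

(** Minus the derivative of bwd_cost in y. *)
Definition bwd_slope h (zeta y : E) :=
  h^-1 *: (zeta - y) + (h / 2) *: g (radau_node y zeta).

Lemma bwd_step_exists h (zeta : E) : 0 < h -> exists y, bwd_step h zeta y.
Proof.
move=> h0; pose F y := h * (3 / 4) * V (radau_node y zeta) - U y.
have Fc : continuous F.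
  suff : forall y : E, (fun y => h * (3 / 4) * V (radau_node y zeta) - U y) @ y -->
     h * (3 / 4) * V (radau_node y zeta) - U y by [].
  move=> y; apply: (@cvgB _ _ _ _ (nbhs_filter y)); last exact: (es_Uc es).
  apply: (@cvgM _ _ _ (nbhs_filter y)); first exact: cvg_cst.
  suff : {for y, continuous (fun y => V (radau_node y zeta))} by [].
  apply/cvg_enormP => e e0.
  have [rho rho0 hrho] := (cvg_enormP V _).1 (es_Vc es (x := radau_node y zeta)) _ e0.
  exists rho => // y' yy'; apply: hrho.
  have -> : radau_node y' zeta - radau_node y zeta = (2 / 3) *: (y' - y).
    by apply/rowP => i; rewrite !mxE; lra.
  rewrite enormZ gtr0_norm ?divr_gt0//.
  by have := enorm_ge0 (y' - y); lra.
have FB y : `|F y| <= h * (3 / 4) * (K ^+ 2 / 2) + B.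
  rewrite (le_trans (ler_normB _ _))// lerD ?(es_UB es)//.
  rewrite normrM (ger0_norm (_ : 0 <= h * (3 / 4))).
    rewrite ler_wpM2l//; first by rewrite mulr_ge0// ?ltW// divr_gt0.
    by rewrite ler0_norm ?(es_V0 es)//; have := es_VK es (radau_node y zeta); lra.
  by rewrite mulr_ge0// ltW.
have [y hy] := exists_max_penalized zeta Fc FB h0.
exists y => y'; have := hy y'; rewrite /F /bwd_cost.
rewrite -(opprB y zeta) -(opprB y' zeta) !dotpNl !dotpNr !opprK; lra.
Qed.

(** The cost being bounded above by paraboloids in y, it touches U from below
    at the minimizer. *)
Lemma bwd_step_lower_slope h (zeta : E) y : 0 < h -> bwd_step h zeta y ->
  lower_slope U (bwd_slope h zeta y) y.
Proof.
move=> h0 hy; apply: (@quadratic_lower_slope ((2 * h)^-1 + h * K)).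
  by rewrite addr_ge0 ?invr_ge0 ?mulr_ge0// ltW.
move=> w; have := hy (y + w); rewrite /bwd_cost.
have ew : zeta - (y + w) = (zeta - y) - w by rewrite opprD addrA.
have := es_Vtaylor es (radau_node y zeta) (radau_node (y + w) zeta).
have -> : radau_node (y + w) zeta - radau_node y zeta = (2 / 3) *: w.
  by apply/rowP => i; rewrite !mxE; lra.
rewrite ew ler_norml dotpZl !dotpZr => /andP[hV _].
move: hV; set Vw := V (radau_node _ _); set Vn := V (radau_node _ _).
rewrite /bwd_slope; move: (g _) => G; move: (zeta - y) => v hV.
rewrite !dotpE (dotpC w v) => h'.
have D0 := dotp_ge0 w.
have hV' : h * (- (K * (2 / 3 * (2 / 3 * dotp w w)))) <=
    h * (Vw - Vn - 2 / 3 * dotp G w).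
  by rewrite ler_pM2l//; move: hV; lra.
have KD : 0 <= h * (K * dotp w w) by rewrite !mulr_ge0// ltW.
have E1 : h^-1 * dotp v w = (2 * h)^-1 * (2 * dotp v w) by field; rewrite gt_eqF.
rewrite E1; move: h' hV' KD; rewrite !(mulrC _ (2 * h)^-1).
by move: (2 * h)^-1 => ih; lra.
Qed.

Lemma bwd_step_superjet h (zeta : E) y : 0 < h -> bwd_step h zeta y ->
  superjet C U (bwd_slope h zeta y) y /\
  2^-1 * dotp (bwd_slope h zeta y) (bwd_slope h zeta y) + V y = 0.
Proof. by move=> h0 hy; apply: superjet_eikonal; exact: bwd_step_lower_slope. Qed.

Lemma fwd_step_dist r x z : 0 < r <= 1 -> fwd_step r x z -> enorm (z - x) <= 2 * K * r.
Proof.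
move=> /andP[r0 r1] hz; have := enorm_superjet (fwd_step_superjet r0 hz) => qK.
have -> : z - x = r *: fwd_slope r x z + (r ^+ 2 / 2) *: g x.
  by apply/rowP => i; rewrite !mxE; field; rewrite gt_eqF.
rewrite (le_trans (enormD _ _))// !enormZ (gtr0_norm r0) ger0_norm; last first.
  by rewrite divr_ge0// sqr_ge0.
have gK := es_gK es x.
have : r * enorm (fwd_slope r x z) <= r * K by rewrite ler_pM2l.
have : r ^+ 2 / 2 * enorm (g x) <= r * K; last by lra.
by rewrite ler_pM ?enorm_ge0 ?divr_ge0 ?sqr_ge0//; nra.
Qed.

Lemma bwd_step_dist h (zeta : E) y : 0 < h <= 1 -> bwd_step h zeta y ->
  enorm (zeta - y) <= 2 * K * h.
Proof.
move=> /andP[h0 h1] hy; have [jet _] := bwd_step_superjet h0 hy.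
have pK := enorm_superjet jet.
have -> : zeta - y = h *: bwd_slope h zeta y - (h ^+ 2 / 2) *: g (radau_node y zeta).
  by apply/rowP => i; rewrite !mxE; field; rewrite gt_eqF.
rewrite (le_trans (enormB _ _))// !enormZ (gtr0_norm h0) ger0_norm; last first.
  by rewrite divr_ge0// sqr_ge0.
have gK := es_gK es (radau_node y zeta).
have : h * enorm (bwd_slope h zeta y) <= h * K by rewrite ler_pM2l.
have : h ^+ 2 / 2 * enorm (g (radau_node y zeta)) <= h * K; last by lra.
by rewrite ler_pM ?enorm_ge0 ?divr_ge0 ?sqr_ge0//; nra.
Qed.

End OneStep.

(** * Value of a backward step *)

Section BackwardValue.
Context (R : realType) (d : nat) (U V : 'rV[R]_d -> R).
Context (g : 'rV[R]_d -> 'rV[R]_d) (C K B : R).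
Context (es : eikonal_solution U V g C K B).
Local Notation E := 'rV[R]_d.
Implicit Types (p q x y z w : E) (h r s : R).

Let K1 := es_K1 es.
Let C0 := es_C0 es.
Let CK := es_CK es.
Let K0 : 0 < K := K_gt0 es.

Definition bwd_potential y (zeta : E) := 3 / 4 * V (radau_node y zeta) + 4^-1 * V zeta.

(** The left-hand side is, up to sign, the derivative in r of the minimum of U
    y + bwd_cost r y zeta. The eikonal equation at the minimizer reduces it to
    the quadrature error and to |g|^2, whose variation over distances of order
    h is of order h. *)
Lemma bwd_rate (eta rho : R) x (zeta : E) y h r :
  (forall y e, enorm e <= rho ->
      `|V y - 3 / 4 * V (y + 3^-1 *: e) - 4^-1 * V (y + e)
        + 2^-1 * dotp (g (y + 3^-1 *: e)) e| <= eta * dotp e e) ->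
  0 <= eta -> 0 < r -> r <= h -> h <= 1 -> 2 * K * r <= rho ->
  enorm (zeta - x) <= 4 * K * h -> bwd_step U V r zeta y ->
  `|dotp (zeta - y) (zeta - y) / (2 * r ^+ 2) + bwd_potential y zeta
    + r ^+ 2 / 8 * dotp (g x) (g x)| <= r ^+ 2 * (4 * K ^+ 2 * eta + 2 * K ^+ 3 * h).
Proof.
move=> hq eta0 r0 rh h1 Kr zx hy.
have r1 : 0 < r <= 1 by rewrite r0 (le_trans rh).
have eK := bwd_step_dist es r1 hy.
have [_] := bwd_step_superjet es r0 hy.
have := hq y (zeta - y) (le_trans eK Kr).
rewrite /bwd_potential /bwd_slope -/(radau_node y zeta).
rewrite (_ : y + (zeta - y) = zeta); last first.
  by rewrite subrKC.
set c := radau_node y zeta; set e := zeta - y in eK *.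
have cx : enorm (c - x) <= 6 * K * h.
  have -> : c - x = (zeta - x) - (2 / 3) *: e.
    by apply/rowP => i; rewrite !mxE; lra.
  rewrite (le_trans (enormB _ _))// enormZ gtr0_norm ?divr_gt0//.
  have : K * r <= K * h by rewrite ler_pM2l.
  have : 0 < K * r by rewrite mulr_gt0.
  by lra.
have gcx : enorm (g c - g x) <= K * (6 * K * h).
  by rewrite (le_trans (es_glip es _ _))// ler_pM2l.
have gg : `|dotp (g c) (g c) - dotp (g x) (g x)| <= K * (6 * K * h) * (2 * K).
  have -> : dotp (g c) (g c) - dotp (g x) (g x) = dotp (g c - g x) (g c + g x).
    by rewrite !dotpE (dotpC (g x) (g c)); ring.
  apply: dotp_bound => //; rewrite (le_trans (enormD _ _))//.
  by have := es_gK es c; have := es_gK es x; lra.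
have ee : dotp e e <= (2 * K * r) ^+ 2.
  by rewrite dotpxx expr2 ler_pM ?enorm_ge0.
clearbody c e.
have {}ee : eta * dotp e e <= eta * (2 * K * r) ^+ 2 by rewrite ler_wpM2l.
move: gg; rewrite !ler_norml; move: (g c) => G => /andP[g1 g2] /andP[q1 q2].
rewrite dotpDl !dotpDr !dotpZl !dotpZr (dotpC e G) => eik.
have eik' : dotp e e / (2 * r ^+ 2) =
    - V y - 2^-1 * dotp G e - r ^+ 2 / 8 * dotp G G.
  have -> : V y = - (2^-1 * (r^-1 * (r^-1 * dotp e e) + r^-1 * (r / 2 * dotp G e) +
      (r / 2 * (r^-1 * dotp G e) + r / 2 * (r / 2 * dotp G G)))) by lra.
  by field; rewrite gt_eqF.
have r20 : 0 < r ^+ 2 / 8 by rewrite divr_gt0// exprn_gt0.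
have m1 : r ^+ 2 / 8 * - (K * (6 * K * h) * (2 * K)) <=
  r ^+ 2 / 8 * (dotp G G - dotp (g x) (g x)) by rewrite ler_pM2l.
have m2 : r ^+ 2 / 8 * (dotp G G - dotp (g x) (g x)) <=
  r ^+ 2 / 8 * (K * (6 * K * h) * (2 * K)) by rewrite ler_pM2l.
have pos : 0 <= r ^+ 2 * (K ^+ 3 * h).
  by rewrite !mulr_ge0 ?exprn_ge0// ?(ltW K0) ?(le_trans (ltW r0)).
by rewrite eik'; apply/andP; split; lra.
Qed.

Lemma bwd_cost_increment y (zeta : E) r s : 0 < r -> 0 < s ->
  bwd_cost V r y zeta - bwd_cost V s y zeta =
  - ((r - s) * (dotp (zeta - y) (zeta - y) / (2 * s ^+ 2) + bwd_potential y zeta)) +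
    dotp (zeta - y) (zeta - y) / (2 * s ^+ 2) * (r - s) ^+ 2 / r.
Proof. by move=> r0 s0; rewrite /bwd_cost /bwd_potential; field; rewrite !gt_eqF. Qed.

(** Dynamic programming over one step, by integration of bwd_rate from 0 to h.
    The leading error h^3 |g x|^2 / 24 is the same for all zeta near x and
    cancels when two of them are compared. *)
Lemma bwd_value (eta : R) : 0 < eta -> exists2 h0, 0 < h0 <= 1 &
  forall x (zeta y : E) h, 0 < h <= h0 -> enorm (zeta - x) <= 4 * K * h ->
  bwd_step U V h zeta y ->
  `|U y + bwd_cost V h y zeta - h ^+ 3 * (dotp (g x) (g x) / 24) - U zeta|
    <= eta * h ^+ 3.
Proof.
move=> eta0.
have K20 : 0 < K ^+ 2 by rewrite exprn_gt0.
have K30 : 0 < K ^+ 3 by rewrite exprn_gt0.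
pose eta' := eta / (8 * K ^+ 2).
have eta'0 : 0 < eta' by rewrite divr_gt0// mulr_gt0.
have [rho rho0 hrho] := es_quad es eta'0.
(* The arcs then stay where the quadrature error is below eta', and the
   variation of |g|^2 accounts for the other half of eta. *)
pose h0 := Num.min 1 (Num.min (rho / (2 * K)) (eta / (4 * K ^+ 3))).
have h00 : 0 < h0 by rewrite !lt_min ltr01 !divr_gt0// mulr_gt0.
exists h0; first by rewrite h00 ge_min lexx.
move=> x zeta y h /andP[hp hh0] zx hy.
have h1 : h <= 1 by rewrite (le_trans hh0)// ge_min lexx.
have hK : 2 * K * h <= rho.
  rewrite mulrC -ler_pdivlMr ?mulr_gt0// (le_trans hh0)// !ge_min lexx.
  by rewrite orbT.
have he : 4 * K ^+ 3 * h <= eta.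
  by rewrite mulrC -ler_pdivlMr ?mulr_gt0// (le_trans hh0)// !ge_min lexx !orbT.
have epsE : 4 * K ^+ 2 * eta' = eta / 2.
  by rewrite /eta'; field; rewrite gt_eqF.
have /choice[Y hY] : forall r : R, exists y, 0 < r -> bwd_step U V r zeta y.
  move=> r; have [r0|_] := ltP 0 r; last by exists 0.
  by have [y' hy'] := bwd_step_exists es zeta r0; exists y'.
pose gam := dotp (g x) (g x).
have gam0 : 0 <= gam by exact: dotp_ge0.
have gamK : gam <= K ^+ 2 by rewrite /gam dotpxx expr2 ler_pM ?enorm_ge0 ?(es_gK es).
pose m r := U (Y r) + bwd_cost V r (Y r) zeta - r ^+ 3 * (gam / 24).
have rate r : 0 < r -> r <= h ->
  `|dotp (zeta - Y r) (zeta - Y r) / (2 * r ^+ 2) + bwd_potential (Y r) zeta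
    + r ^+ 2 / 8 * gam| <= r ^+ 2 * eta.
  move=> r0 rh.
  have Kr : 2 * K * r <= rho by rewrite (le_trans _ hK)// ler_pM2l// mulr_gt0.
  have := bwd_rate hrho (ltW eta'0) r0 rh h1 Kr zx (hY r r0).
  move=> /le_trans; apply; rewrite ler_pM2l ?exprn_gt0// epsE; lra.
have dist r : 0 < r -> r <= h ->
    dotp (zeta - Y r) (zeta - Y r) / (2 * r ^+ 2) <= 2 * K ^+ 2.
  move=> r0 rh; have r1 : 0 < r <= 1 by rewrite r0 (le_trans rh).
  have eK := bwd_step_dist es r1 (hY r r0).
  rewrite ler_pdivrMr ?mulr_gt0 ?exprn_gt0// dotpxx.
  have : enorm (zeta - Y r) * enorm (zeta - Y r) <= 2 * K * r * (2 * K * r).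
    by rewrite ler_pM ?enorm_ge0.
  by lra.
have key s0 : 0 < s0 -> s0 <= h -> `|m h - m s0| <= eta * h ^+ 3.
  move=> s00 s0h.
  have M0 : 0 <= 2 * K ^+ 2 / s0 by rewrite divr_ge0 ?mulr_ge0 ?ltW.
  have cub s r : 0 < s -> s <= r ->
    3 * s ^+ 2 * (r - s) <= r ^+ 3 - s ^+ 3 <= 3 * r ^+ 2 * (r - s).
    move=> sp sr; have -> : r ^+ 3 - s ^+ 3 = (r ^+ 2 + r * s + s ^+ 2) * (r - s).
      by ring.
    by apply/andP; split; apply: ler_wpM2r; rewrite ?subr_ge0//; nra.
  have sq s r : 0 < s -> s < r -> r <= h -> forall D : R, D <= 2 * K ^+ 2 ->
    s0 <= s -> D * (r - s) ^+ 2 / r <= 2 * K ^+ 2 / s0 * (r - s) ^+ 2 /\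
    D * (r - s) ^+ 2 / s <= 2 * K ^+ 2 / s0 * (r - s) ^+ 2.
    move=> sp sr rh D DK s0s.
    have rs0 : 0 <= (r - s) ^+ 2 by rewrite sqr_ge0.
    have DD : D * (r - s) ^+ 2 <= 2 * K ^+ 2 * (r - s) ^+ 2 by rewrite ler_wpM2r.
    have inv t : s0 <= t ->
        D * (r - s) ^+ 2 / t <= 2 * K ^+ 2 / s0 * (r - s) ^+ 2.
      move=> s0t; have t0 : 0 < t by rewrite (lt_le_trans s00).
      apply: (@le_trans _ _ (2 * K ^+ 2 * (r - s) ^+ 2 / t)).
        by rewrite ler_pM2r// invr_gt0.
      rewrite [leRHS]mulrAC ler_wpM2l//; last by rewrite lef_pV2.
      by rewrite mulr_ge0// mulr_ge0// ltW.
    by split; apply: inv => //; rewrite (le_trans s0s)// ltW.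
  have incr s r : s0 <= s -> s < r -> r <= h ->
    m r - m s <= eta * h ^+ 2 * (r - s) + 2 * K ^+ 2 / s0 * (r - s) ^+ 2 /\
    m s - m r <= eta * h ^+ 2 * (r - s) + 2 * K ^+ 2 / s0 * (r - s) ^+ 2.
    move=> s0s sr rh; have sp : 0 < s by rewrite (lt_le_trans s00).
    have rp : 0 < r by rewrite (lt_trans sp).
    have sh : s <= h by rewrite (le_trans (ltW sr)).
    have rs : 0 < r - s by rewrite subr_gt0.
    have h2 t : 0 < t -> t <= h -> t ^+ 2 * eta <= eta * h ^+ 2.
      by move=> t0 th; rewrite mulrC ler_pM2l// ler_pXn2r ?nnegrE// ltW.
    have /andP[c1 c2] := cub s r sp (ltW sr).
    have c1' : gam / 24 * (3 * s ^+ 2 * (r - s)) <= gam / 24 * (r ^+ 3 - s ^+ 3).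
      by rewrite ler_wpM2l// divr_ge0.
    have c2' : gam / 24 * (r ^+ 3 - s ^+ 3) <= gam / 24 * (3 * r ^+ 2 * (r - s)).
      by rewrite ler_wpM2l// divr_ge0.
    split.
      have := hY r rp (Y s); have := bwd_cost_increment (Y s) zeta rp sp.
      have [] := sq s r sp sr rh _ (dist s sp sh) s0s.
      have := rate s sp sh; rewrite ler_norml => /andP[ra _].
      set D := dotp _ _ / (2 * s ^+ 2); set A := D + bwd_potential _ _ in ra *.
      move=> q1 _ inc hm.
      have ra' : (r - s) * (- (s ^+ 2 * eta) - s ^+ 2 / 8 * gam) <= (r - s) * A.
        by rewrite ler_pM2l//; lra.
      have h2' : (r - s) * (s ^+ 2 * eta) <= (r - s) * (eta * h ^+ 2).
        by rewrite ler_pM2l// h2.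
      by rewrite /m; lra.
    have := hY s sp (Y r); have := bwd_cost_increment (Y r) zeta sp rp.
    have [] := sq s r sp sr rh _ (dist r rp rh) s0s.
    have := rate r rp rh; rewrite ler_norml => /andP[_ ra].
    set D := dotp _ _ / (2 * r ^+ 2); set A := D + bwd_potential _ _ in ra *.
    move=> _ q1 inc hm.
    have ra' : (r - s) * A <= (r - s) * (r ^+ 2 * eta - r ^+ 2 / 8 * gam).
      by rewrite ler_pM2l//; lra.
    have h2' : (r - s) * (r ^+ 2 * eta) <= (r - s) * (eta * h ^+ 2).
      by rewrite ler_pM2l// h2.
    have inc' : D * (s - r) ^+ 2 / s = D * (r - s) ^+ 2 / s.
      by congr (_ * _ / _); ring.
    by rewrite inc' in inc; rewrite /m; lra.
  have u1 := @increment_le _ m _ _ _ _ s0h (fun s r s0s sr rh => (incr s r s0s sr rh).1).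
  (* The value is expanded from both sides: at the minimizer for s in the first
     bound, for r in the second one. *)
  have u2 : - m h - (- m s0) <= eta * h ^+ 2 * (h - s0).
    apply: (@increment_le _ (fun t => - m t) _ _ _ _ s0h) => s r s0s sr rh.
    rewrite opprK addrC; exact: (incr s r s0s sr rh).2.
  have : eta * h ^+ 2 * s0 >= 0.
    by rewrite !mulr_ge0 ?sqr_ge0// ltW.
  by rewrite ler_norml; move: u1 u2; lra.
have small s0 : 0 < s0 -> s0 <= h -> `|m s0 - U zeta| <= 3 * K ^+ 2 * s0.
  move=> s00 s0h.
  have s01 : 0 < s0 <= 1 by rewrite s00 (le_trans s0h).
  have up := hY s0 s00 zeta.
  have eK := bwd_step_dist es s01 (hY s0 s00).
  have := U_lipschitz es zeta (Y s0); rewrite enorm_distC ler_norml => /andP[lo _].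
  have eK' : K * enorm (zeta - Y s0) <= K * (2 * K * s0) by rewrite ler_pM2l.
  have : 0 <= dotp (zeta - Y s0) (zeta - Y s0) / (2 * s0).
    by rewrite divr_ge0 ?dotp_ge0// mulr_ge0// ltW.
  have node0 : radau_node zeta zeta = zeta by rewrite /radau_node subrr scaler0 addr0.
  have V1 : s0 * (- (K ^+ 2 / 2)) <= s0 * V zeta by rewrite ler_pM2l// (es_VK es).
  have V2 : s0 * (3 / 4 * V (radau_node (Y s0) zeta) + 4^-1 * V zeta) <= 0.
    rewrite pmulr_rle0//.
    by have := es_V0 es zeta; have := es_V0 es (radau_node (Y s0) zeta); lra.
  have s03 : s0 ^+ 3 <= s0.
    rewrite -[leRHS]mulr1 exprS ler_pM2l//; case/andP: s01 => _ s01.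
    by rewrite exprn_ile1// ltW.
  have g1 : s0 ^+ 3 * (gam / 24) <= s0 * K ^+ 2.
    apply: ler_pM => //; [by rewrite exprn_ge0// ltW|by rewrite divr_ge0|lra].
  have g2 : 0 <= s0 ^+ 3 * (gam / 24).
    by apply: mulr_ge0; [rewrite exprn_ge0// ltW|rewrite divr_ge0].
  move: up; rewrite /m /bwd_cost subrr node0 dotp0l mul0r => up dd.
  have K2s : 0 < s0 * K ^+ 2 by rewrite mulr_gt0.
  by rewrite ler_norml; apply/andP; split; lra.
have -> : U y + bwd_cost V h y zeta - h ^+ 3 * (dotp (g x) (g x) / 24) = m h.
  rewrite /m -/gam; congr (_ - _); apply/eqP; rewrite eq_le hy /=.
  exact: (hY h hp y).
apply/ler_addgt0Pr => e e0.
pose s0 := Num.min h (e / (3 * K ^+ 2)).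
have s00 : 0 < s0 by rewrite lt_min hp divr_gt0// mulr_gt0.
have s0h : s0 <= h by rewrite ge_min lexx.
have s0e : 3 * K ^+ 2 * s0 <= e.
  by rewrite mulrC -ler_pdivlMr ?mulr_gt0// ge_min lexx orbT.
have -> : m h - U zeta = (m h - m s0) + (m s0 - U zeta) by rewrite addrA subrK.
rewrite (le_trans (ler_normD _ _))// lerD ?key// (le_trans (small s0 s00 s0h))//.
Qed.

End BackwardValue.

(** * Gain of a forward step *)

Section ForwardGain.
Context (R : realType) (d : nat) (U V : 'rV[R]_d -> R).
Context (g : 'rV[R]_d -> 'rV[R]_d) (C K B : R).
Context (es : eikonal_solution U V g C K B).
Local Notation E := 'rV[R]_d.

Let K1 := es_K1 es.
Let C0 := es_C0 es.
Let CK := es_CK es.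
Let K0 : 0 < K := K_gt0 es.

Context (x z y : E) (h t : R).
Context (h0 : 0 < h) (h1 : h <= 1) (t0 : 0 < t) (t1 : t <= 1).
Context (hz : fwd_step U V g h x z).
Let q := fwd_slope g h x z.
Let eps := t * h ^+ 2.
Let z' := z - eps *: q.
Context (hy : bwd_step U V h z' y).
Let p := bwd_slope g h z' y.
Let c := radau_node y z'.
Let P := p - h *: g x.
Context (dp : forall (zeta y : E), enorm (zeta - x) <= 4 * K * h ->
  bwd_step U V h zeta y ->
  `|U y + bwd_cost V h y zeta - h ^+ 3 * (dotp (g x) (g x) / 24) - U zeta|
    <= t ^+ 2 * h ^+ 3).

Let hh1 : 0 < h <= 1. Proof. by rewrite h0. Qed.
Let eps0 : 0 < eps. Proof. by rewrite mulr_gt0// exprn_gt0. Qed.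
Let epsh2 : eps <= h ^+ 2.
Proof. by rewrite /eps -[leRHS]mul1r ler_pM2r// exprn_gt0. Qed.
Let h2h : h ^+ 2 <= h. Proof. by rewrite expr2 -[leRHS]mulr1 ler_pM2l. Qed.
Let epsh : eps <= h. Proof. exact: le_trans epsh2 h2h. Qed.
Let K20 : 0 < K ^+ 2. Proof. by rewrite exprn_gt0. Qed.
Let K30 : 0 < K ^+ 3. Proof. by rewrite exprn_gt0. Qed.

Let jq : superjet C U q z. Proof. exact: (fwd_step_superjet es h0 hz). Qed.
Let qK : enorm q <= K. Proof. exact: (enorm_superjet es jq). Qed.
Let jp : superjet C U p y. Proof. by case: (bwd_step_superjet es h0 hy). Qed.
Let eik : 2^-1 * dotp p p + V y = 0. Proof. by case: (bwd_step_superjet es h0 hy). Qed.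
Let pK : enorm p <= K. Proof. exact: (enorm_superjet es jp). Qed.

Let qq : dotp q q <= K ^+ 2.
Proof. by rewrite dotpxx expr2 ler_pM ?enorm_ge0. Qed.

Let zx : enorm (z - x) <= 2 * K * h. Proof. exact: (fwd_step_dist es hh1 hz). Qed.
Let z'y : enorm (z' - y) <= 2 * K * h. Proof. exact: (bwd_step_dist es hh1 hy). Qed.
Let Kh : 0 < K * h. Proof. by rewrite mulr_gt0. Qed.

Let eq_ : enorm (eps *: q) <= K * h.
Proof. by rewrite enormZ gtr0_norm// mulrC ler_pM// ?enorm_ge0// ltW. Qed.

Let z'x : enorm (z' - x) <= 3 * K * h.
Proof.
have -> : z' - x = (z - x) - eps *: q by rewrite /z' addrAC.
by rewrite (le_trans (enormB _ _))//; have := zx; have := eq_; lra.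
Qed.

Let cx : enorm (c - x) <= 5 * K * h.
Proof.
have -> : c - x = (z' - x) - (2 / 3) *: (z' - y).
  by apply/rowP => i; rewrite !mxE; lra.
rewrite (le_trans (enormB _ _))// enormZ gtr0_norm ?divr_gt0//.
by have := z'x; have := z'y; have := Kh; lra.
Qed.

Let yx : enorm (x - y) <= 5 * K * h.
Proof.
have -> : x - y = (z' - y) - (z' - x) by apply/rowP => i; rewrite !mxE; lra.
by rewrite (le_trans (enormB _ _))//; have := z'x; have := z'y; lra.
Qed.

Let zy : enorm (z - y) <= 3 * K * h.
Proof.
have -> : z - y = (z' - y) + eps *: q by apply/rowP => i; rewrite !mxE; lra.
by rewrite (le_trans (enormD _ _))//; have := eq_; have := z'y; lra.
Qed.

Let glip (a : E) (M : R) : enorm (a - x) <= M * K * h ->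
  enorm (g a - g x) <= M * K ^+ 2 * h.
Proof.
move=> ha; rewrite (le_trans (es_glip es _ _))//.
by have : K * enorm (a - x) <= K * (M * K * h); [rewrite ler_pM2l|lra].
Qed.

Let Vshift (a : E) (M : R) : enorm (a - x) <= M * K * h ->
  V a + eps * dotp (g x) q - (M + 1) * (K ^+ 3 * h * eps) <= V (a + eps *: q).
Proof.
move=> /glip ga; have := es_Vtaylor es a (a + eps *: q).
rewrite (addrC a) addrK dotpZl !dotpZr ler_norml => /andP[lo _].
have := dotp_bound ga qK; rewrite ler_norml => /andP[+ _].
rewrite dotpDl dotpNl => lo2.
have lo2' : eps * (- (M * K ^+ 2 * h * K)) <= eps * (dotp (g a) q - dotp (g x) q).
  by rewrite ler_pM2l.
have : K * (eps * (eps * dotp q q)) <= K * (eps * (h * K ^+ 2)).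
  rewrite ler_pM2l// ler_pM2l// ler_pM// ?dotp_ge0//; exact: ltW.
by lra.
Qed.

(** D^+U(z) is the convex hull of the limits of gradients, so one of these has
    a scalar product with q at least |q|^2. To find it at the scale eps,
    observe that U drops by at least eps |q|^2 from z to z' (to first order),
    whereas the arc from y to z', translated by eps q, ends at z: by bwd_value
    the rise of U from z' to z is at most eps <P, q>, up to errors. *)
Lemma fwd_direction : dotp q q - dotp P q <= 2 * t * h + 7 * (K ^+ 3 * h ^+ 2).
Proof.
have [y1 hy1] := bwd_step_exists es z h0.
have zx4 : enorm (z - x) <= 4 * K * h by have := zx; have := Kh; lra.
have z'x4 : enorm (z' - x) <= 4 * K * h by have := z'x; have := Kh; lra.
have := dp zx4 hy1; have := dp z'x4 hy.
rewrite !ler_norml => /andP[_ dp1] /andP[dp2 _].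
have A1 := jp (y + eps *: q); rewrite (addrC y) addrK dotpZl !dotpZr in A1.
have A2 := jq z'.
have e2 : z' - z = - (eps *: q) by rewrite /z' addrAC subrr add0r.
rewrite e2 dotpNl !dotpNr opprK dotpZl !dotpZr in A2.
have A3 := hy1 (y + eps *: q).
have A4 : bwd_cost V h (y + eps *: q) z <=
    bwd_cost V h y z' - h * (eps * dotp (g x) q) + 6 * (K ^+ 3 * h ^+ 2 * eps).
  rewrite /bwd_cost.
  have -> : z - (y + eps *: q) = z' - y by apply/rowP => i; rewrite !mxE; ring.
  have -> : radau_node (y + eps *: q) z = c + eps *: q.
    by apply/rowP => i; rewrite !mxE; lra.
  have s1 := Vshift cx; have s2 := Vshift z'x.
  have e3 : z' + eps *: q = z by rewrite /z' subrK.
  rewrite e3 in s2.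
  have : h * (3 / 4 * (V c + eps * dotp (g x) q - (5 + 1) * (K ^+ 3 * h * eps)) +
      4^-1 * (V z' + eps * dotp (g x) q - (3 + 1) * (K ^+ 3 * h * eps))) <=
      h * (3 / 4 * V (c + eps *: q) + 4^-1 * V z).
    by rewrite ler_pM2l//; lra.
  have pos : 0 <= K ^+ 3 * h ^+ 2 * eps.
    by apply: mulr_ge0; [apply: mulr_ge0; [exact: ltW|exact: sqr_ge0]|exact: ltW].
  rewrite -/c; move: (dotp (z' - y) (z' - y) / (2 * h)) => D.
  by lra.
have A5 : C * (eps * (eps * dotp q q)) <= K * (eps * (h ^+ 2 * K ^+ 2)).
  have e0 := ltW eps0.
  apply: ler_pM; [exact: ltW| |exact: CK|].
    by apply: mulr_ge0 => //; apply: mulr_ge0 => //; exact: dotp_ge0.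
  by rewrite ler_pM2l//; apply: ler_pM => //; exact: dotp_ge0.
suff : eps * (dotp q q - dotp P q) <= eps * (2 * t * h + 7 * (K ^+ 3 * h ^+ 2)).
  by rewrite ler_pM2l.
have -> : dotp P q = dotp p q - h * dotp (g x) q by rewrite /P dotpDl dotpNl dotpZl.
have E1 : t ^+ 2 * h ^+ 3 = eps * (t * h) by rewrite /eps; ring.
rewrite E1 in dp1 dp2; move: A1; rewrite (addrC _ y) => A1.
by lra.
Qed.

Let dotp_le2 (a : E) (M : R) : enorm a <= M * K * h ->
  dotp a a <= M ^+ 2 * (K ^+ 2 * h ^+ 2).
Proof.
move=> ha; rewrite dotpxx.
have : enorm a * enorm a <= M * K * h * (M * K * h) by rewrite ler_pM ?enorm_ge0.
by lra.
Qed.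

Let epsqq : C * (eps * (eps * dotp q q)) <= K ^+ 3 * h ^+ 3.
Proof.
have e0 := ltW eps0.
have : C * (eps * (eps * dotp q q)) <= K * (h * (h ^+ 2 * K ^+ 2)); last by lra.
apply: ler_pM; [exact: ltW| |exact: CK|].
  by apply: mulr_ge0 => //; apply: mulr_ge0 => //; exact: dotp_ge0.
apply: ler_pM => //; first by apply: mulr_ge0 => //; exact: dotp_ge0.
by apply: ler_pM => //; exact: dotp_ge0.
Qed.

Let Sb_lower : dotp (z - y) (z - y) / (2 * h)
    - h * (V x + 2^-1 * dotp (g x) ((z - x) + (y - x)))
    - 4 * (K ^+ 2 * eps) - 25 * (K ^+ 3 * h ^+ 3) <= bwd_cost V h y z'.
Proof.
have S1 : dotp (z - y) (z - y) / (2 * h) - 3 * (K ^+ 2 * eps) <=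
    dotp (z' - y) (z' - y) / (2 * h).
  have -> : dotp (z - y) (z - y) / (2 * h) - 3 * (K ^+ 2 * eps) =
      (dotp (z - y) (z - y) - 2 * (eps * (K * (3 * K * h)))) / (2 * h).
    by field; rewrite gt_eqF.
  rewrite ler_pM2r ?invr_gt0 ?mulr_gt0//.
  have -> : z' - y = (z - y) - eps *: q by rewrite /z' addrAC.
  have := dotp_bound qK zy; rewrite ler_norml => /andP[_].
  move: (z - y) => a hq.
  have hq' : eps * dotp q a <= eps * (K * (3 * K * h)) by rewrite ler_pM2l.
  rewrite dotpDl !(dotpDr _ _ a) !(dotpDr _ _ (- _)) !dotpNl !dotpNr !dotpZl !dotpZr.
  have : 0 <= eps * (eps * dotp q q).
    by apply: mulr_ge0; [exact: ltW|apply: mulr_ge0; [exact: ltW|exact: dotp_ge0]].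
  by rewrite (dotpC a q); lra.
have tay (a : E) (M : R) : enorm (a - x) <= M * K * h ->
    V a <= V x + dotp (g x) (a - x) + M ^+ 2 * (K ^+ 3 * h ^+ 2).
  move=> ha; have := es_Vtaylor es x a; rewrite ler_norml => /andP[_ hi].
  have : K * dotp (a - x) (a - x) <= K * (M ^+ 2 * (K ^+ 2 * h ^+ 2)).
    by rewrite ler_pM2l// dotp_le2.
  by lra.
have V1 := tay _ _ cx; have V2 := tay _ _ z'x.
have gg : 3 / 4 * dotp (g x) (c - x) + 4^-1 * dotp (g x) (z' - x) =
    2^-1 * dotp (g x) ((z - x) + (y - x)) - 2^-1 * (eps * dotp (g x) q).
  rewrite -!dotpZr -dotpDr -dotpNr -dotpDr; congr dotp.
  by apply/rowP => i; rewrite !mxE; lra.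
have := dotp_bound (es_gK es x) qK; rewrite ler_norml => /andP[gq _].
have gq' : eps * - (K * K) <= eps * dotp (g x) q by rewrite ler_pM2l.
have pos : 0 <= K ^+ 2 * eps by apply: mulr_ge0; exact: ltW.
have pos2 : 0 <= K ^+ 3 * h ^+ 2 by apply: mulr_ge0; [exact: ltW|exact: sqr_ge0].
have hphi : h * (3 / 4 * V c + 4^-1 * V z') <=
    h * (V x + 2^-1 * dotp (g x) ((z - x) + (y - x)) + K ^+ 2 * eps
         + 25 * (K ^+ 3 * h ^+ 2)).
  by rewrite ler_pM2l//; lra.
have : h * (K ^+ 2 * eps) <= 1 * (K ^+ 2 * eps) by rewrite ler_wpM2r.
rewrite /bwd_cost -/c; lra.
Qed.

Let slope_mismatch :
  `|dotp (h^-1 *: (z - y) + (h / 2) *: g x - p) (x - y)| <=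
  5 * (K ^+ 2 * eps) + 25 / 2 * (K ^+ 3 * h ^+ 3).
Proof.
have -> : h^-1 *: (z - y) + (h / 2) *: g x - p =
    (eps / h) *: q - (h / 2) *: (g c - g x).
  by rewrite /p /bwd_slope -/c /z'; apply/rowP => i; rewrite !mxE; lra.
have eh : 0 < eps / h by rewrite divr_gt0.
have h20 : 0 < h / 2 by rewrite divr_gt0.
rewrite dotpDl dotpNl !dotpZl (le_trans (ler_normB _ _))//.
rewrite (normrM (eps / h)) (normrM (h / 2)) (gtr0_norm eh) (gtr0_norm h20).
have := dotp_bound qK yx; have := dotp_bound (glip cx) yx => b2 b1.
have -> : 5 * (K ^+ 2 * eps) + 25 / 2 * (K ^+ 3 * h ^+ 3) =
   eps / h * (K * (5 * K * h)) + h / 2 * (5 * K ^+ 2 * h * (5 * K * h)).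
  by field; rewrite gt_eqF.
by apply: lerD; rewrite ler_pM2l.
Qed.

(** Semiconcavity at y bounds U x, and bwd_value expresses U y through U z.
    Both costs nearly coincide and p is the derivative of the cost at y, so
    the linear terms cancel; there remains the Bregman divergence |x - y|^2 /
    (2 h) of the kinetic cost. *)
Lemma fwd_gain_square :
  - (((2 * h)^-1 + C / 2) * dotp (x - y) (x - y))
  - (9 * (K ^+ 2 * eps) + 41 * (K ^+ 3 * h ^+ 3)) <= U z - fwd_cost V g h x z - U x.
Proof.
have z'x4 : enorm (z' - x) <= 4 * K * h by have := z'x; have := Kh; lra.
have := dp z'x4 hy; rewrite ler_norml => /andP[_ dpz].
have J := jp x.
have A2 := jq z'.
have e2 : z' - z = - (eps *: q) by rewrite /z' addrAC subrr add0r.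
rewrite e2 dotpNl !dotpNr opprK dotpZl !dotpZr in A2.
have A5 := epsqq.
have qq0 : 0 <= eps * dotp q q by apply: mulr_ge0; [exact: ltW|exact: dotp_ge0].
have S := Sb_lower.
have := slope_mismatch; rewrite ler_norml => /andP[W _].
rewrite (dotpDl _ (- p)) dotpNl in W.
have X : dotp (z - y) (z - y) / (2 * h)
    - h * (V x + 2^-1 * dotp (g x) ((z - x) + (y - x)))
    - fwd_cost V g h x z - dotp (h^-1 *: (z - y) + (h / 2) *: g x) (x - y) =
    - (dotp (x - y) (x - y) / (2 * h)).
  have e3 : z - x = (z - y) - (x - y) by apply/rowP => i; rewrite !mxE; ring.
  rewrite /fwd_cost e3 -(opprB x y); move: (z - y) (x - y) => a b.
  rewrite !dotpE (dotpC b a); field; rewrite gt_eqF//.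
have kap : h ^+ 3 * (dotp (g x) (g x) / 24) <= h ^+ 3 * K ^+ 3.
  rewrite ler_pM2l ?exprn_gt0//.
  have : dotp (g x) (g x) <= K ^+ 2.
    by rewrite dotpxx expr2 ler_pM ?enorm_ge0 ?(es_gK es).
  have : 1 * K ^+ 2 <= K * K ^+ 2 by rewrite ler_pM2r.
  have := ltW K20; lra.
have tt : t ^+ 2 * h ^+ 3 <= K ^+ 3 * h ^+ 3.
  rewrite ler_pM2r ?exprn_gt0//.
  have : 1 <= K ^+ 3 by rewrite exprn_ege1.
  by apply: le_trans; rewrite exprn_ile1// ltW.
have pos2 : 0 <= K ^+ 3 * h ^+ 3 by rewrite mulr_ge0// ltW// exprn_gt0.
have e4 : dotp (x - y) (x - y) / (2 * h) = (2 * h)^-1 * dotp (x - y) (x - y).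
  by rewrite mulrC.
move: X; rewrite e4 => X.
rewrite mulrDl; move: J dpz S W X A2 A5; move: ((2 * h)^-1 * dotp (x - y) (x - y)).
by move=> b *; lra.
Qed.

(** The eikonal equation holds at y, and the energy is almost conserved along
    the arc from y to z'. *)
Let slope_square : dotp P P <= - (2 * V z) + 34 * (K ^+ 3 * h ^+ 2).
Proof.
have gK := es_gK es.
have b1 := dotp_bound (gK x) (gK c); have b2 := dotp_bound (gK x) qK.
have g2 : dotp (g x) (g x) <= K ^+ 2 by rewrite dotpxx expr2 ler_pM ?enorm_ge0.
have zxK : enorm (z - x) <= 2 * K * h := zx.
have b3 := dotp_bound (glip zxK) zy.
have tay := es_Vtaylor es z y.
have zy' : K * dotp (y - z) (y - z) <= K * (3 ^+ 2 * (K ^+ 2 * h ^+ 2)).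
  by rewrite ler_pM2l// dotp_le2// enorm_distC.
have e1 : dotp (g x) (z - y) =
    h * dotp (g x) p - h ^+ 2 / 2 * dotp (g x) (g c) + eps * dotp (g x) q.
  rewrite -!dotpZr -dotpNr -!dotpDr; congr dotp.
  rewrite /p /bwd_slope -/c /z'; apply/rowP => i; rewrite !mxE.
  by field; rewrite gt_eqF.
have e2 : dotp (g z) (y - z) = - dotp (g z - g x) (z - y) - dotp (g x) (z - y).
  by rewrite (dotpDl (g z)) dotpNl -(opprB z y) dotpNr; ring.
move: b1 b2 b3 tay; rewrite !ler_norml e2 e1.
move=> /andP[b1 _] /andP[_ b2] /andP[_ b3] /andP[tay _].
have h20 : 0 < h ^+ 2 by rewrite exprn_gt0.
have b1' : h ^+ 2 * - (K * K) <= h ^+ 2 * dotp (g x) (g c) by rewrite ler_pM2l.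
have b2' : eps * dotp (g x) q <= h ^+ 2 * (K * K).
  apply: (@le_trans _ _ (eps * (K * K))); first by rewrite ler_pM2l.
  by rewrite ler_wpM2r// mulr_ge0// ltW.
have g2' : h ^+ 2 * dotp (g x) (g x) <= h ^+ 2 * K ^+ 2 by rewrite ler_pM2l.
have K23 : h ^+ 2 * K ^+ 2 <= h ^+ 2 * K ^+ 3.
  by rewrite ler_pM2l// [leRHS]exprS -[leLHS]mul1r ler_pM2r.
have -> : dotp P P = dotp p p - 2 * (h * dotp (g x) p) + h ^+ 2 * dotp (g x) (g x).
  rewrite /P; move: p (g x) => a b; rewrite !dotpE (dotpC a b); ring.
by have := eik; lra.
Qed.

(** Here x - y is h (P - q) up to higher order, and |P - q|^2 = |P|^2 - |q|^2
    + 2 (|q|^2 - <P, q>) is at most -2 V z - |q|^2 by slope_square and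
    fwd_direction. *)
Let dist_square : dotp (x - y) (x - y) <=
  h ^+ 2 * (- (dotp q q + 2 * V z) + 4 * t * h + 48 * (K ^+ 3 * h ^+ 2)) +
  h * (25 * (K ^+ 4 * h ^+ 3) + 10 * (K ^+ 3 * eps)).
Proof.
have gK := es_gK es.
pose dl := eps *: q + (h ^+ 2 / 2) *: (g x - g c).
have xyE : x - y = h *: (P - q) + dl.
  rewrite /dl /P /p /bwd_slope -/c /z'; apply/rowP => i; rewrite !mxE.
  by field; rewrite gt_eqF.
have P2 : enorm P <= 2 * K.
  rewrite (le_trans (enormB _ _))// enormZ gtr0_norm//.
  have : h * enorm (g x) <= 1 * K.
    by apply: ler_pM => //; [exact: ltW|exact: enorm_ge0].
  by have := pK; lra.
have w3 : enorm (P - q) <= 3 * K.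
  by rewrite (le_trans (enormB _ _))//; have := qK; lra.
have h20 : 0 < h ^+ 2 by rewrite exprn_gt0.
pose D := K * eps + 5 / 2 * (K ^+ 2 * h ^+ 3).
have dlD : enorm dl <= D.
  rewrite (le_trans (enormD _ _))// !enormZ (gtr0_norm eps0) gtr0_norm ?divr_gt0//.
  have := glip cx; rewrite enorm_distC => hg.
  have : h ^+ 2 / 2 * enorm (g x - g c) <= h ^+ 2 / 2 * (5 * K ^+ 2 * h).
    by rewrite ler_pM2l// divr_gt0.
  have : eps * enorm q <= eps * K by rewrite ler_pM2l.
  by rewrite /D; lra.
have D0 : 0 <= D by rewrite (le_trans (enorm_ge0 dl)).
have Dh : D <= 7 / 2 * (K ^+ 2 * h).
  have : K * eps <= K ^+ 2 * h.
    by rewrite expr2 -mulrA ler_pM2l// -[leLHS]mul1r ler_pM// ltW.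
  have : K ^+ 2 * h ^+ 3 <= K ^+ 2 * h.
    rewrite ler_pM2l// -[leRHS]mul1r exprSr ler_pM2r//.
    by rewrite exprn_ile1// ltW.
  by rewrite /D; lra.
have := dotp_bound w3 dlD; rewrite ler_norml => /andP[_ wd].
have dd : dotp dl dl <= 7 / 2 * (K ^+ 2 * h) * D.
  by rewrite dotpxx ler_pM ?enorm_ge0// (le_trans dlD).
have ww : dotp (P - q) (P - q) <=
    - (dotp q q + 2 * V z) + 4 * t * h + 48 * (K ^+ 3 * h ^+ 2).
  have -> : dotp (P - q) (P - q) = dotp P P - dotp q q + 2 * (dotp q q - dotp P q).
    by move: P q => a b; rewrite !dotpE (dotpC b a); ring.
  by have := fwd_direction; have := slope_square; lra.
have ww' : h ^+ 2 * dotp (P - q) (P - q) <=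
    h ^+ 2 * (- (dotp q q + 2 * V z) + 4 * t * h + 48 * (K ^+ 3 * h ^+ 2)).
  by rewrite ler_pM2l.
have wd' : h * dotp (P - q) dl <= h * (3 * K * D) by rewrite ler_pM2l.
have KK : K * (h * D) <= K ^+ 2 * (h * D).
  rewrite ler_wpM2r ?mulr_ge0 ?(ltW h0)//.
  by rewrite expr2 -[leLHS]mulr1 ler_pM2l.
have -> : dotp (x - y) (x - y) = h ^+ 2 * dotp (P - q) (P - q) +
    2 * (h * dotp (P - q) dl) + dotp dl dl.
  have sq (a b : E) : dotp (h *: a + b) (h *: a + b) =
      h ^+ 2 * dotp a a + 2 * (h * dotp a b) + dotp b b.
    by rewrite !dotpE (dotpC b a); ring.
  by rewrite xyE sq.
have pos : 0 <= K ^+ 4 * h ^+ 4 by rewrite mulr_ge0// exprn_ge0// ltW.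
have pos2 : 0 <= K ^+ 3 * h * eps by rewrite !mulr_ge0// ltW.
have DE : K ^+ 2 * (h * D) = K ^+ 3 * h * eps + 5 / 2 * (K ^+ 4 * h ^+ 4).
  by rewrite /D; ring.
by move: dd ww' wd' KK DE; lra.
Qed.

Lemma fwd_gain_explicit :
  h * (2^-1 * dotp q q + V z) * (1 + C * h)
    - (23 * (K ^+ 4 * t * h ^+ 2) + 114 * (K ^+ 5 * h ^+ 3))
  <= U z - fwd_cost V g h x z - U x.
Proof.
apply: le_trans fwd_gain_square.
have Ch1 : 1 + C * h <= 2 * K.
  have : C * h <= K * 1 by rewrite ler_pM// ltW.
  by have := K1; lra.
have Ch0 : 0 < 1 + C * h by rewrite addr_gt0// mulr_gt0.
set A := - (dotp q q + 2 * V z).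
set e3 := 25 * (K ^+ 4 * h ^+ 3) + 10 * (K ^+ 3 * eps).
set e4 := 4 * t * h + 48 * (K ^+ 3 * h ^+ 2).
have e40 : 0 <= e4.
  by rewrite addr_ge0 ?mulr_ge0 ?exprn_ge0// ltW.
have e30 : 0 <= e3.
  by rewrite addr_ge0 ?mulr_ge0 ?exprn_ge0// ltW.
have b : ((2 * h)^-1 + C / 2) * dotp (x - y) (x - y) <=
    ((2 * h)^-1 + C / 2) * (h ^+ 2 * (A + e4) + h * e3).
  rewrite ler_pM2l; last by rewrite addr_gt0 ?invr_gt0 ?mulr_gt0 ?divr_gt0.
  by have := dist_square; rewrite /A /e4 /e3; lra.
have bE : ((2 * h)^-1 + C / 2) * (h ^+ 2 * (A + e4) + h * e3) =
   h / 2 * (1 + C * h) * A + 2^-1 * ((1 + C * h) * (h * e4 + e3)).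
  by field; rewrite gt_eqF.
have b2 : (1 + C * h) * (h * e4 + e3) <= 2 * K * (h * e4 + e3).
  by rewrite ler_wpM2r// addr_ge0// mulr_ge0// ltW.
have th0 : 0 <= t * h ^+ 2 by rewrite mulr_ge0 ?exprn_ge0// ltW.
have h30 : 0 <= h ^+ 3 by rewrite exprn_ge0// ltW.
have pw (m n : nat) (v : R) : (m <= n)%N -> 0 <= v -> K ^+ m * v <= K ^+ n * v.
  by move=> mn v0; rewrite ler_wpM2r// ler_weXn2l.
have c1 := pw 1%N 4%N _ isT th0; have c2 := pw 2%N 4%N _ isT th0.
have c3 := pw 3%N 5%N _ isT h30; have c4 := pw 4%N 5%N _ isT h30.
rewrite bE in b; rewrite /A /e3 /e4 /eps in b b2 *.
move: b b2 c1 c2 c3 c4.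
move: (dotp (x - y) (x - y)) ((2 * h)^-1) (dotp q q) (V z) => D ih qq' vz; lra.
Qed.

End ForwardGain.

(** * Decay of the energy along forward steps *)

Section Step.
Context (R : realType) (d : nat) (U V : 'rV[R]_d -> R).
Context (g : 'rV[R]_d -> 'rV[R]_d) (C K B : R).
Context (es : eikonal_solution U V g C K B).
Local Notation E := 'rV[R]_d.
Implicit Types (x y z p : E) (h r s : R).

Let K1 : 1 <= K := es_K1 es.
Let C0 : 0 < C := es_C0 es.
Let CK : C <= K := es_CK es.
Let K0 : 0 < K := K_gt0 es.

Lemma fwd_gain (eta : R) : 0 < eta -> exists2 h0, 0 < h0 <= 1 &
  forall x z h, 0 < h <= h0 -> fwd_step U V g h x z ->
  h * (2^-1 * dotp (fwd_slope g h x z) (fwd_slope g h x z) + V z) * (1 + C * h)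
    - eta * h ^+ 2 <= U z - fwd_cost V g h x z - U x.
Proof.
move=> eta0.
have K40 : 0 < K ^+ 4 by rewrite exprn_gt0.
have K50 : 0 < K ^+ 5 by rewrite exprn_gt0.
pose t := Num.min 1 (eta / (46 * K ^+ 4)).
have t0 : 0 < t by rewrite lt_min ltr01 divr_gt0// mulr_gt0.
have t1 : t <= 1 by rewrite ge_min lexx.
have tK : 46 * K ^+ 4 * t <= eta.
  by rewrite mulrC -ler_pdivlMr ?mulr_gt0// ge_min lexx orbT.
have t20 : 0 < t ^+ 2 by rewrite exprn_gt0.
have [hb /andP[hb0 hb1] hdp] := bwd_value es t20.
exists (Num.min hb (eta / (228 * K ^+ 5))).
  by rewrite lt_min hb0 divr_gt0 ?mulr_gt0//= ge_min hb1.
move=> x z h /andP[h0]; rewrite le_min ler_pdivlMr ?mulr_gt0// => /andP[hhb hK] hz.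
have h1 : h <= 1 by rewrite (le_trans hhb).
have [y hy] := bwd_step_exists es (z - (t * h ^+ 2) *: fwd_slope g h x z) h0.
have dp : forall (zeta y : E), enorm (zeta - x) <= 4 * K * h ->
  bwd_step U V h zeta y ->
  `|U y + bwd_cost V h y zeta - h ^+ 3 * (dotp (g x) (g x) / 24) - U zeta|
    <= t ^+ 2 * h ^+ 3.
  by move=> zeta y' zx hy'; apply: hdp => //; rewrite h0.
have := fwd_gain_explicit es h0 h1 t0 t1 hz hy dp; apply: le_trans.
rewrite lerD2l lerN2.
have h20 : 0 <= h ^+ 2 by rewrite sqr_ge0.
have a1 : h ^+ 2 * (46 * K ^+ 4 * t) <= h ^+ 2 * eta by rewrite ler_wpM2l.
have a2 : h ^+ 2 * (h * (228 * K ^+ 5)) <= h ^+ 2 * eta by rewrite ler_wpM2l.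
by lra.
Qed.

Lemma fwd_cost_decrement x z r s : 0 < r -> 0 < s ->
  fwd_cost V g s x z - fwd_cost V g r x z =
  (r - s) * (dotp (z - x) (z - x) / (2 * r ^+ 2) + V x
             + 2^-1 * dotp (g x) (z - x)) +
  dotp (z - x) (z - x) / (2 * r ^+ 2) * (r - s) ^+ 2 / s.
Proof. by move=> r0 s0; rewrite /fwd_cost; field; rewrite !gt_eqF. Qed.

(** The derivative in r of the maximum of U - fwd_cost r x is the energy of
    the maximizer, up to an error of order r^2 (the variational interpolation
    of De Giorgi). *)
Lemma fwd_rate x z r : 0 < r <= 1 -> fwd_step U V g r x z ->
  dotp (z - x) (z - x) / (2 * r ^+ 2) <= 2 * K ^+ 2 /\
  dotp (z - x) (z - x) / (2 * r ^+ 2) + V x + 2^-1 * dotp (g x) (z - x) <=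
  2^-1 * dotp (fwd_slope g r x z) (fwd_slope g r x z) + V z + 4 * K ^+ 3 * r ^+ 2.
Proof.
move=> r01 hz; have zx := fwd_step_dist es r01 hz; case/andP: r01 => r0 r1.
have D : dotp (z - x) (z - x) <= 4 * K ^+ 2 * r ^+ 2.
  rewrite dotpxx.
  have : enorm (z - x) * enorm (z - x) <= 2 * K * r * (2 * K * r).
    by rewrite ler_pM ?enorm_ge0.
  by lra.
split; first by rewrite ler_pdivrMr ?mulr_gt0 ?exprn_gt0//; lra.
have := es_Vtaylor es x z; rewrite ler_norml => /andP[lo _].
have KD : K * dotp (z - x) (z - x) <= K * (4 * K ^+ 2 * r ^+ 2) by rewrite ler_pM2l.
have gg : 0 <= r ^+ 2 * dotp (g x) (g x) by rewrite mulr_ge0 ?sqr_ge0 ?dotp_ge0.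
have -> : dotp (z - x) (z - x) / (2 * r ^+ 2) =
    2^-1 * dotp (fwd_slope g r x z) (fwd_slope g r x z) + 2^-1 * dotp (g x) (z - x)
    - r ^+ 2 / 8 * dotp (g x) (g x).
  rewrite /fwd_slope; move: (z - x) (g x) => a b.
  rewrite !dotpE (dotpC a b); field; rewrite gt_eqF//.
by lra.
Qed.

(** Young's inequality between the slope p and the kinetic cost: the mean
    energy of a short step starts from at most the energy of p. *)
Lemma fwd_value_le x p z s : superjet C U p x -> 0 < s <= 1 -> fwd_step U V g s x z ->
  U z - fwd_cost V g s x z - U x <= s * (2^-1 * dotp p p + V x) + 3 * K ^+ 3 * s ^+ 2.
Proof.
move=> jp s01 hz; have zx := fwd_step_dist es s01 hz; case/andP: s01 => s0 s1.
have := jp z; rewrite /fwd_cost.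
have D : dotp (z - x) (z - x) <= 4 * K ^+ 2 * s ^+ 2.
  rewrite dotpxx.
  have : enorm (z - x) * enorm (z - x) <= 2 * K * s * (2 * K * s).
    by rewrite ler_pM ?enorm_ge0.
  by lra.
have CD : C * dotp (z - x) (z - x) <= K * (4 * K ^+ 2 * s ^+ 2).
  by rewrite ler_pM// ?dotp_ge0 ?ltW.
have := dotp_bound (es_gK es x) zx; rewrite ler_norml => /andP[_ gz].
have gz' : s * dotp (g x) (z - x) <= s * (K * (2 * K * s)) by rewrite ler_pM2l.
have K23 : s ^+ 2 * K ^+ 2 <= s ^+ 2 * K ^+ 3.
  by rewrite ler_wpM2l ?sqr_ge0// ler_weXn2l.
have sq : dotp p (z - x) <= dotp (z - x) (z - x) / (2 * s) + s / 2 * dotp p p.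
  rewrite -subr_ge0.
  have -> : dotp (z - x) (z - x) / (2 * s) + s / 2 * dotp p p - dotp p (z - x) =
      dotp (z - x - s *: p) (z - x - s *: p) / (2 * s).
    move: (z - x) => a; rewrite !dotpE (dotpC a p); field; rewrite gt_eqF//.
  by rewrite divr_ge0 ?dotp_ge0 ?mulr_ge0 ?ltW.
by lra.
Qed.

(** Let N r be the value of the step of length r minus U x, a primitive of the
    energy al r by fwd_rate. As fwd_gain reads r al(r) (1 + C r) <= N r, the
    derivative of N r (1 / r + C) is at most o(1); its value at 0 is bounded
    by the energy of p, and its value at h bounds al(h) (1 + C h)^2 by
    fwd_gain once more. *)
Lemma energy_decay (eta : R) : 0 < eta -> exists2 h0, 0 < h0 <= 1 &
  forall x p z h, superjet C U p x -> 0 < h <= h0 -> fwd_step U V g h x z ->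
  (2^-1 * dotp (fwd_slope g h x z) (fwd_slope g h x z) + V z) * (1 + C * h) ^+ 2
  <= 2^-1 * dotp p p + V x + eta * h.
Proof.
move=> eta0.
have K40 : 0 < K ^+ 4 by rewrite exprn_gt0.
pose eta1 := eta / (6 * K).
have eta10 : 0 < eta1 by rewrite divr_gt0// mulr_gt0.
have [h1 /andP[h10 h11] gain] := fwd_gain eta10.
exists (Num.min h1 (eta / (16 * K ^+ 4))).
  by rewrite lt_min h10 divr_gt0 ?mulr_gt0//= ge_min h11.
move=> x p z h jp /andP[h0].
rewrite le_min ler_pdivlMr ?mulr_gt0// => /andP[hh1 hK] hz.
have hle1 : h <= 1 by rewrite (le_trans hh1).
have /choice[Z hZ] : forall r : R, exists z, 0 < r -> fwd_step U V g r x z.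
  move=> r; have [r0|_] := ltP 0 r; last by exists 0.
  by have [z' hz'] := fwd_step_exists es x r0; exists z'.
pose al r := 2^-1 * dotp (fwd_slope g r x (Z r)) (fwd_slope g r x (Z r)) + V (Z r).
pose N r := U (Z r) - fwd_cost V g r x (Z r) - U x.
pose F r := N r * (r^-1 + C).
have al0 r : 0 < r -> - (K ^+ 2 / 2) <= al r <= 0.
  move=> r0; rewrite (es_sub es (fwd_step_superjet es r0 (hZ r r0))) andbT.
  have := es_VK es (Z r); have := dotp_ge0 (fwd_slope g r x (Z r)); rewrite /al; lra.
have Nlow r : 0 < r -> r <= h -> r * al r * (1 + C * r) - eta1 * r ^+ 2 <= N r.
  by move=> r0 rh; apply: gain (hZ r r0); rewrite r0 (le_trans rh).
have Ninc s r : 0 < s -> s < r -> r <= h ->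
    N r - N s <= (r - s) * (al r + 4 * K ^+ 3 * r ^+ 2) + 2 * K ^+ 2 * (r - s) ^+ 2 / s.
  move=> s0 sr rh; have r0 : 0 < r by rewrite (lt_trans s0).
  have r01 : 0 < r <= 1 by rewrite r0 (le_trans rh).
  have := hZ s s0 (Z r); have := fwd_cost_decrement x (Z r) r0 s0.
  have [dK rate] := fwd_rate r01 (hZ r r0).
  have rs : 0 < r - s by rewrite subr_gt0.
  have q1 : (r - s) * (dotp (Z r - x) (Z r - x) / (2 * r ^+ 2) + V x +
      2^-1 * dotp (g x) (Z r - x)) <= (r - s) * (al r + 4 * K ^+ 3 * r ^+ 2).
    by rewrite ler_pM2l.
  have q2 : dotp (Z r - x) (Z r - x) / (2 * r ^+ 2) * (r - s) ^+ 2 / s <=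
      2 * K ^+ 2 * (r - s) ^+ 2 / s.
    by rewrite ler_pM2r ?invr_gt0// ler_pM2r// exprn_gt0.
  by move=> inc hm; move: inc q1 q2 hm; rewrite /N; lra.
have Finc s0 : 0 < s0 -> s0 <= h -> F h - F s0 <= (eta1 + 8 * K ^+ 4 * h) * (h - s0).
  move=> s00 s0h.
  (* The quadratic error blows up as s0 tends to 0, which is harmless in
     increment_le. *)
  pose M := (K ^+ 3 / 2 + eta1 + 4 * K ^+ 3 + 2 * K ^+ 2 * (s0^-1 + K)) / s0.
  apply: (@increment_le _ F _ _ _ M) => // s r s0s sr rh.
  have s_0 : 0 < s by rewrite (lt_le_trans s00).
  have r0 : 0 < r by rewrite (lt_trans s_0).
  have rs : 0 < r - s by rewrite subr_gt0.
  have inc := Ninc s r s_0 sr rh; have low := Nlow r r0 rh.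
  have sC : 0 < s^-1 + C by rewrite addr_gt0// invr_gt0.
  have /andP[alK al_0] := al0 r r0.
  have rs0 : 0 < (r - s) / (r * s) by rewrite divr_gt0// mulr_gt0.
  have r1 : r <= 1 by rewrite (le_trans rh).
  have e1 : F r - F s = (N r - N s) * (s^-1 + C) - N r * ((r - s) / (r * s)).
    by rewrite /F; field; rewrite !gt_eqF.
  have b1 : (N r - N s) * (s^-1 + C) <= ((r - s) * (al r + 4 * K ^+ 3 * r ^+ 2)
      + 2 * K ^+ 2 * (r - s) ^+ 2 / s) * (s^-1 + C) by rewrite ler_pM2r.
  have b2 : (r * al r * (1 + C * r) - eta1 * r ^+ 2) * ((r - s) / (r * s)) <=
      N r * ((r - s) / (r * s)) by rewrite ler_pM2r.
  have e2 : ((r - s) * (al r + 4 * K ^+ 3 * r ^+ 2)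
      + 2 * K ^+ 2 * (r - s) ^+ 2 / s) * (s^-1 + C) -
      (r * al r * (1 + C * r) - eta1 * r ^+ 2) * ((r - s) / (r * s)) =
    (r - s) * (eta1 + 4 * K ^+ 3 * r + 4 * K ^+ 3 * (C * r ^+ 2)) +
    (r - s) ^+ 2 * ((- al r * C + eta1 + 4 * K ^+ 3 * r
      + 2 * K ^+ 2 * (s^-1 + C)) / s).
    by field; rewrite !gt_eqF.
  have K30 : 0 < K ^+ 3 by rewrite exprn_gt0.
  have K34 : K ^+ 3 * r <= K ^+ 4 * h.
    apply: ler_pM => //; [exact: ltW|exact: ltW|by rewrite ler_weXn2l].
  have Cr2 : K ^+ 3 * (C * r ^+ 2) <= K ^+ 3 * (K * h).
    rewrite ler_pM2l//; apply: ler_pM; rewrite ?sqr_ge0 ?(ltW C0)//.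
    by rewrite expr2 -[leRHS]mul1r ler_pM ?(ltW r0).
  have b3 : (r - s) * (eta1 + 4 * K ^+ 3 * r + 4 * K ^+ 3 * (C * r ^+ 2)) <=
      (r - s) * (eta1 + 8 * K ^+ 4 * h) by rewrite ler_pM2l//; lra.
  have b4 : (- al r * C + eta1 + 4 * K ^+ 3 * r + 2 * K ^+ 2 * (s^-1 + C)) / s <= M.
    have si : s^-1 <= s0^-1 by rewrite lef_pV2.
    apply: ler_pM => //; last 1 first.
    - have a1 : - al r * C <= K ^+ 2 / 2 * K.
        by apply: ler_pM => //; [rewrite oppr_ge0|exact: ltW|lra].
      have a2 : K ^+ 3 * r <= K ^+ 3 * 1 by rewrite ler_pM2l.
      have a3 : K ^+ 2 * (s^-1 + C) <= K ^+ 2 * (s0^-1 + K).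
        by rewrite ler_wpM2l ?sqr_ge0// lerD.
      by lra.
    - have a1 : 0 <= - al r * C by rewrite mulr_ge0 ?oppr_ge0// ltW.
      have a2 : 0 < K ^+ 3 * r by rewrite mulr_gt0.
      have a3 : 0 <= K ^+ 2 * (s^-1 + C) by rewrite mulr_ge0 ?sqr_ge0// ltW.
      by lra.
    - by rewrite invr_ge0 ltW.
  have b5 : (r - s) ^+ 2 * ((- al r * C + eta1 + 4 * K ^+ 3 * r
      + 2 * K ^+ 2 * (s^-1 + C)) / s) <= (r - s) ^+ 2 * M.
    by rewrite ler_wpM2l ?sqr_ge0.
  by rewrite e1; move: b1 b2 e2 b3 b5; lra.
have Ch2 s : 0 < s -> s <= h -> 0 < 1 + C * s <= 2 * K.
  move=> s0 sh; apply/andP; split; first by rewrite addr_gt0// mulr_gt0.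
  have : C * s <= K * 1 by apply: ler_pM; rewrite ?(ltW C0) ?(ltW s0)// (le_trans sh).
  by have := K1; lra.
have inv s : 0 < s -> s^-1 + C = (1 + C * s) / s.
  by move=> s0; field; rewrite gt_eqF.
have sub0 := es_sub es jp.
(* The limit of F at 0, where 1 / r is singular, is replaced by a bound at
   small s. *)
have Fsmall s : 0 < s -> s <= h -> F s <= 2^-1 * dotp p p + V x + 6 * K ^+ 4 * s.
  move=> s0 sh; have s01 : 0 < s <= 1 by rewrite s0 (le_trans sh).
  have := fwd_value_le jp s01 (hZ s s0); rewrite -/(N s).
  move: sub0; set a := 2^-1 * dotp p p + V x => a0 hN.
  have /andP[c0 c2] := Ch2 s s0 sh.
  have b1 : F s <= (s * a + 3 * K ^+ 3 * s ^+ 2) * (s^-1 + C).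
    by rewrite /F ler_pM2r// inv// divr_gt0.
  have b2 : (s * a + 3 * K ^+ 3 * s ^+ 2) * (s^-1 + C) =
      a + a * (C * s) + 3 * K ^+ 3 * s * (1 + C * s) by field; rewrite gt_eqF.
  have b3 : a * (C * s) <= 0 by rewrite mulr_le0_ge0// mulr_ge0// ltW.
  have b4 : 3 * K ^+ 3 * s * (1 + C * s) <= 3 * K ^+ 3 * s * (2 * K).
    by rewrite ler_pM2l// !mulr_gt0// exprn_gt0.
  by lra.
have Fh : F h <= 2^-1 * dotp p p + V x + (eta1 + 8 * K ^+ 4 * h) * h.
  apply/ler_addgt0Pr => e e0.
  pose s0 := Num.min h (e / (6 * K ^+ 4)).
  have s00 : 0 < s0 by rewrite lt_min h0 divr_gt0// mulr_gt0.
  have s0h : s0 <= h by rewrite ge_min lexx.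
  have s0e : 6 * K ^+ 4 * s0 <= e.
    by rewrite mulrC -ler_pdivlMr ?mulr_gt0// ge_min lexx orbT.
  have f1 := Finc s0 s00 s0h; have f2 := Fsmall s0 s00 s0h.
  have : 0 <= (eta1 + 8 * K ^+ 4 * h) * s0.
    by rewrite mulr_ge0 ?(ltW s00)// addr_ge0 ?(ltW eta10)// !mulr_ge0 ?ltW.
  by lra.
have Nh : N h = U z - fwd_cost V g h x z - U x.
  by rewrite /N; congr (_ - _); apply/eqP; rewrite eq_le hz /=; exact: (hZ h h0).
have := gain x z h _ hz; rewrite h0 hh1 => /(_ isT).
rewrite -Nh; set a := 2^-1 * dotp (fwd_slope _ _ _ _) _ + V z => G.
have /andP[c0 c2] := Ch2 h h0 (lexx h).
have b1 : (h * a * (1 + C * h) - eta1 * h ^+ 2) * (h^-1 + C) <= F h.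
  by rewrite /F ler_pM2r// inv// divr_gt0.
have b2 : (h * a * (1 + C * h) - eta1 * h ^+ 2) * (h^-1 + C) =
    a * (1 + C * h) ^+ 2 - eta1 * h * (1 + C * h) by field; rewrite gt_eqF.
have b3 : eta1 * h * (1 + C * h) <= eta1 * h * (2 * K) by rewrite ler_pM2l// mulr_gt0.
have b4 : eta1 * h * 1 <= eta1 * h * K by rewrite ler_pM2l// mulr_gt0.
have b5 : h * (h * (16 * K ^+ 4)) <= h * eta by rewrite ler_pM2l.
have b6 : eta1 * K = eta / 6 by rewrite /eta1; field; rewrite gt_eqF.
have b7 : eta1 * h * K = eta / 6 * h by rewrite mulrAC b6.
by lra.
Qed.

End Step.

(** * Generalized gradient curves *)

Section Curves.
Context (R : realType) (d : nat) (U V : 'rV[R]_d -> R).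
Context (g : 'rV[R]_d -> 'rV[R]_d) (C K B : R).
Context (es : eikonal_solution U V g C K B).
Local Notation E := 'rV[R]_d.
Implicit Types (x y z p q : E) (h r s t : R).

Let K1 : 1 <= K := es_K1 es.
Let C0 : 0 < C := es_C0 es.
Let CK : C <= K := es_CK es.
Let K0 : 0 < K := K_gt0 es.

Definition left_velocity (X : R -> E) t p := forall e, 0 < e ->
  exists2 del, 0 < del & forall s, t - del < s -> s < t -> 0 <= s ->
    enorm (X t - X s - (t - s) *: p) <= e * (t - s).

(** Velocities are only needed from the left, where D^+U gives the sharp
    inequality. *)
Record gradient_curve (X : R -> E) : Prop := GradientCurve {
  gc_lip : forall t, 0 <= t -> exists M del, [/\ 0 <= M, 0 < del &
    forall s r, 0 <= s -> 0 <= r -> `|s - t| < del -> `|r - t| < del ->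
      enorm (X s - X r) <= M * `|s - r|];
  gc_vel : {ae @lebesgue_measure R, forall t, 0 < t ->
    exists2 p, superjet C U p (X t) & left_velocity X t p} }.

Context (X : R -> E) (gc : gradient_curve X).

(** The criterion ae_left_nondecreasing_le along a curve: only the times with
    a velocity in D^+U matter. *)
Lemma curve_nondecreasing (f : R -> R) a b : 0 <= a -> a <= b ->
  (forall t, a <= t <= b -> exists M del, [/\ 0 <= M, 0 < del &
    forall s r, a <= s <= b -> a <= r <= b ->
      `|s - t| < del -> `|r - t| < del -> `|f s - f r| <= M * `|s - r|]) ->
  (forall t p, a < t -> t <= b -> superjet C U p (X t) -> left_velocity X t p ->
    forall e, 0 < e -> exists2 del, 0 < del &
      forall s, t - del < s -> s < t -> a <= s -> f s <= f t + e * (t - s)) ->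
  f a <= f b.
Proof.
move=> a0 ab lip dini; apply: ae_left_nondecreasing_le => //.
apply: (@filterS _ _ (ae_filter_ringOfSetsType _) _ _ _ (gc_vel gc)).
move=> t ht at_ tb; have [|p jp vp] := ht; first exact: le_lt_trans at_.
exact: dini vp.
Qed.

(** Apply curve_nondecreasing to K |v| t - <v, X t> with v = X t - X s. *)
Lemma curve_lip s t : 0 <= s -> s <= t -> enorm (X t - X s) <= K * (t - s).
Proof.
move=> s0 st; set v := X t - X s.
have [v0|vn] := eqVneq (enorm v) 0.
  by rewrite v0 mulr_ge0 ?subr_ge0// ltW.
have vp : 0 < enorm v by rewrite lt_neqAle eq_sym vn enorm_ge0.
pose f r := K * enorm v * r - dotp v (X r).
have : f s <= f t.
  apply: curve_nondecreasing => // [r /andP[sr rt]|r p sr rt jp vel e e0].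
    have [M [del [M0 del0 hM]]] := gc_lip gc (le_trans s0 sr).
    exists (K * enorm v + enorm v * M), del; split=> //.
      by rewrite addr_ge0// mulr_ge0// ltW.
    move=> a b /andP[sa _] /andP[sb _] ar br.
    have := hM a b (le_trans s0 sa) (le_trans s0 sb) ar br => hX.
    have -> : f a - f b = K * enorm v * (a - b) - dotp v (X a - X b).
      by rewrite /f (dotpDr (X a)) dotpNr; ring.
    rewrite (le_trans (ler_normB _ _))// normrM ger0_norm ?mulr_ge0 ?(ltW K0) ?(ltW vp)//.
    rewrite mulrDl lerD2l (le_trans (norm_dotp_le _ _))// -mulrA.
    by rewrite ler_pM2l.
  have [del del0 hdel] := vel (e / enorm v) ltac:(by rewrite divr_gt0).
  exists del => // a ra ar sa.
  have := hdel a ra ar (le_trans s0 sa).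
  have ra0 : 0 < r - a by rewrite subr_gt0.
  have pK := enorm_superjet es jp.
  set err := _ - _ *: p => herr.
  have h1 := dotp_le v err.
  have h2 : enorm v * enorm err <= e * (r - a).
    have -> : e * (r - a) = enorm v * (e / enorm v * (r - a)).
      by field; rewrite gt_eqF.
    by rewrite ler_pM2l.
  have h3 : (r - a) * dotp v p <= (r - a) * (enorm v * K).
    by rewrite ler_pM2l// (le_trans (dotp_le _ _))// ler_pM2l.
  have h4 : dotp v err = dotp v (X r) - dotp v (X a) - (r - a) * dotp v p.
    by rewrite /err (dotpDr (X r - X a)) (dotpDr (X r)) !dotpNr dotpZr.
  by rewrite /f; lra.
have e1 : dotp v (X t) - dotp v (X s) = enorm v * enorm v.
  by rewrite -dotpNr -dotpDr -/v dotpxx.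
rewrite /f => h; have : enorm v * enorm v <= enorm v * (K * (t - s)) by lra.
by rewrite ler_pM2l.
Qed.

Lemma curve_dist s t : 0 <= s -> 0 <= t -> enorm (X t - X s) <= K * `|t - s|.
Proof.
move=> s0 t0; have [st|ts] := leP s t.
  by rewrite ger0_norm ?subr_ge0// curve_lip.
by rewrite enorm_distC distrC gtr0_norm ?subr_gt0// curve_lip// ltW.
Qed.

(** Error of one step of the implicit Euler scheme, from the one-sided
    Lipschitz property superjet_monotone. The bound on the derivative of |X s
    - z|^2 is made constant over the step, at the expense of terms of order
    h^2. *)
Lemma fwd_step_curve_dist t h x z : 0 <= t -> 0 < h <= 1 -> fwd_step U V g h x z ->
  dotp (z - X (t + h)) (z - X (t + h)) <=
  (1 + 5 * K * h) * dotp (x - X t) (x - X t) + 41 * K ^+ 3 * h ^+ 2.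
Proof.
move=> t0 h01 hz; have zx := fwd_step_dist es h01 hz; case/andP: h01 => h0 h1.
have jq := fwd_step_superjet es h0 hz; have qK := enorm_superjet es jq.
set q := fwd_slope g h x z in jq qK.
set del := enorm (x - X t).
have del0 : 0 <= del by exact: enorm_ge0.
pose rad := del + 3 * K * h.
have Kh : 0 < K * h by rewrite mulr_gt0.
have rad0 : 0 <= rad by rewrite /rad; lra.
have Xz s : t <= s <= t + h -> enorm (X s - z) <= rad.
  move=> /andP[ts sh].
  have := curve_lip t0 ts.
  have : K * (s - t) <= K * h by rewrite ler_pM2l//; lra.
  have := enormD (X s - X t) (X t - x); rewrite addrA subrK (enorm_distC (X t)) -/del.
  have := enormB (X s - x) (z - x); rewrite opprB addrA subrK.
  by rewrite /rad; lra.
pose phi s := dotp (X s - z) (X s - z).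
pose c := 2 * K * (2 * del ^+ 2 + 18 * K ^+ 2 * h ^+ 2) + 2 * dotp q (X t - z)
          + 2 * K ^+ 2 * h.
pose f s := c * s - phi s.
have phiD a b : phi a - phi b = 2 * dotp (X a - z) (X a - X b)
    - dotp (X a - X b) (X a - X b).
  rewrite /phi; have -> : X b - z = (X a - z) - (X a - X b).
    by apply/rowP => i; rewrite !mxE; ring.
  by move: (X a - z) (X a - X b) => u v; rewrite !dotpE (dotpC v u); ring.
have tth : t <= t + h by rewrite lerDl ltW.
have : f t <= f (t + h).
  apply: curve_nondecreasing => // [r _|r p tr rt jp vel e e0].
    exists (`|c| + 2 * rad * K + K * K * h), 1; split=> //.
      by rewrite !addr_ge0// !mulr_ge0// ltW.
    move=> a b /andP[ta ah] /andP[tb bh] _ _.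
    have -> : f a - f b = c * (a - b) - (phi a - phi b) by rewrite /f; ring.
    have XX := curve_dist (le_trans t0 tb) (le_trans t0 ta).
    have XX2 : enorm (X a - X b) <= K * h.
      by rewrite (le_trans XX)// ler_pM2l// ler_norml; lra.
    have := dotp_bound (Xz a _) XX; rewrite ta ah => /(_ isT) b1.
    have := dotp_bound XX2 XX => b2.
    rewrite phiD (le_trans (ler_normB _ _))// normrM.
    have : `|2 * dotp (X a - z) (X a - X b) - dotp (X a - X b) (X a - X b)| <=
      2 * (rad * (K * `|a - b|)) + K * h * (K * `|a - b|).
      by rewrite (le_trans (ler_normB _ _))// lerD// normrM ger0_norm// ler_pM2l.
    by lra.
  have r0 : 0 <= r by rewrite (le_trans t0)// ltW.
  have trh : t <= r <= t + h by rewrite (ltW tr).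
  have rad1 : 0 < 2 * rad + 1 by rewrite ltr_wpDl// mulr_ge0.
  have [eta eta0 heta] := vel (e / (2 * rad + 1)) ltac:(by rewrite divr_gt0).
  exists eta => // a ra ar ta.
  have := heta a ra ar (le_trans t0 ta).
  set err := _ - _ *: p => herr.
  have ra0 : 0 < r - a by rewrite subr_gt0.
  have XE : dotp (X r - z) (X r - X a) =
      (r - a) * dotp (X r - z) p + dotp (X r - z) err.
    by rewrite -dotpZr -dotpDr /err; congr dotp; apply/rowP => i; rewrite !mxE; ring.
  have b1 : dotp (X r - z) err <= rad * (e / (2 * rad + 1) * (r - a)).
    rewrite (le_trans (dotp_le _ _))// ler_pM ?enorm_ge0//; exact: Xz.
  have b2 : 2 * (rad * (e / (2 * rad + 1) * (r - a))) <= e * (r - a).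
    have -> : e * (r - a) = (2 * rad + 1) * (e / (2 * rad + 1) * (r - a)).
      by field; rewrite gt_eqF.
    have : 0 <= e / (2 * rad + 1) * (r - a) by rewrite mulr_ge0 ?divr_ge0 ?ltW.
    by lra.
  have mono := superjet_monotone jp jq.
  have b3 : dotp (X r - z) p <= C * dotp (X r - z) (X r - z) + dotp q (X r - z).
    by move: mono; rewrite dotpDl dotpNl (dotpC p); lra.
  have b4 : C * dotp (X r - z) (X r - z) <= K * (rad * rad).
    apply: ler_pM; rewrite ?dotp_ge0 ?(ltW C0)//.
    by rewrite dotpxx ler_pM ?enorm_ge0 ?Xz.
  have b5 : dotp q (X r - z) <= dotp q (X t - z) + K * (K * h).
    have -> : X r - z = (X t - z) + (X r - X t).
      by apply/rowP => i; rewrite !mxE; ring.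
    rewrite dotpDr lerD2l (le_trans (dotp_le _ _))// ler_pM ?enorm_ge0//.
    by rewrite (le_trans (curve_lip t0 (ltW tr)))// ler_pM2l//; lra.
  have b6 : rad * rad <= 2 * del ^+ 2 + 18 * K ^+ 2 * h ^+ 2.
    have := sqr_ge0 (del - 3 * K * h); rewrite /rad; lra.
  have b6' : K * (rad * rad) <= K * (2 * del ^+ 2 + 18 * K ^+ 2 * h ^+ 2).
    by rewrite ler_pM2l.
  have b7 : 2 * dotp (X r - z) p <= c by rewrite /c; lra.
  have b8 : (r - a) * (2 * dotp (X r - z) p) <= (r - a) * c by rewrite ler_pM2l.
  have := phiD r a; have := dotp_ge0 (X r - X a); rewrite XE /f; lra.
rewrite /f => hf.
have gz := dotp_bound (es_gK es x) zx.
have gX : `|dotp (g x) (X t - x)| <= K * del.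
  by rewrite (le_trans (norm_dotp_le _ _))// enorm_distC ler_pM ?enorm_ge0 ?(es_gK es).
have hphi : phi t + 2 * h * dotp q (X t - z) = del ^+ 2 - dotp (z - x) (z - x)
    - h ^+ 2 * dotp (g x) (X t - x) + h ^+ 2 * dotp (g x) (z - x).
  rewrite /phi /del enorm_distC enorm_sqr.
  have -> : X t - z = (X t - x) - (z - x) by apply/rowP => i; rewrite !mxE; ring.
  rewrite /q /fwd_slope; move: (X t - x) (z - x) (g x) => u v w.
  by rewrite !dotpE (dotpC v u); field; rewrite gt_eqF.
have ->: dotp (z - X (t + h)) (z - X (t + h)) = phi (t + h).
  by rewrite /phi -(opprB (X _) z) dotpNl dotpNr opprK.
have -> : dotp (x - X t) (x - X t) = del ^+ 2 by rewrite /del enorm_sqr.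
move: gz gX; rewrite !ler_norml => /andP[_ gz] /andP[gX _].
have h20 : 0 <= h ^+ 2 by rewrite sqr_ge0.
have gz' : h ^+ 2 * dotp (g x) (z - x) <= h ^+ 2 * (K * (2 * K * h)).
  by rewrite ler_wpM2l.
have gX' : h ^+ 2 * - (K * del) <= h ^+ 2 * dotp (g x) (X t - x) by rewrite ler_wpM2l.
have kd : h ^+ 2 * (K * del) <= h ^+ 2 * (K ^+ 2 + del ^+ 2).
  rewrite ler_wpM2l//; have := sqr_ge0 (K - del); have := sqr_ge0 K.
  have := sqr_ge0 del; lra.
have zz := dotp_ge0 (z - x).
have h2h : h ^+ 2 * del ^+ 2 <= K * h * del ^+ 2.
  rewrite ler_wpM2r ?sqr_ge0// expr2 ler_pM2r//.
  by rewrite (le_trans h1).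
have K23 : h ^+ 2 * K ^+ 2 <= h ^+ 2 * K ^+ 3 by rewrite ler_wpM2l// ler_weXn2l.
have h32 : h ^+ 2 * K ^+ 3 * h <= h ^+ 2 * K ^+ 3 * 1.
  by rewrite ler_wpM2l// mulr_ge0// exprn_ge0// ltW.
have h33 : h ^+ 2 * K ^+ 2 * h <= h ^+ 2 * K ^+ 2 * 1.
  by rewrite ler_wpM2l// mulr_ge0// exprn_ge0// ltW.
by move: hf hphi; rewrite /c; lra.
Qed.

End Curves.

(** * Vanishing energy before a regular time *)

Section Regular.
Context (R : realType) (d : nat) (U V : 'rV[R]_d -> R).
Context (g : 'rV[R]_d -> 'rV[R]_d) (C K B : R).
Context (es : eikonal_solution U V g C K B).
Local Notation E := 'rV[R]_d.
Implicit Types (x y z p q : E) (h r s t : R).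

Let K1 : 1 <= K := es_K1 es.
Let C0 : 0 < C := es_C0 es.
Let CK : C <= K := es_CK es.
Let K0 : 0 < K := K_gt0 es.

(** D^+U is upper semicontinuous, and reduces to p where U is differentiable
    with gradient p. *)
Lemma slope_close y p (e : R) : lower_slope U p y -> 0 < e ->
  exists2 rho, 0 < rho & forall x q, enorm (x - y) <= rho ->
    superjet C U q x -> enorm (q - p) <= e.
Proof.
move=> lo e0; have [r r0 hr] := lo (e / 4) ltac:(by rewrite divr_gt0).
pose k := e / (8 * K); have k0 : 0 < k by rewrite divr_gt0// mulr_gt0.
have kE : K * k = e / 8 by rewrite /k; field; rewrite gt_eqF.
pose rho1 := Num.min r k; have rho10 : 0 < rho1 by rewrite lt_min r0.
exists (Num.min rho1 (rho1 * k)); first by rewrite lt_min rho10 mulr_gt0.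
move=> x q; rewrite le_min => /andP[xy1 xy2] jq.
rewrite enorm_distC; set u := p - q.
have [->|un] := eqVneq (enorm u) 0; first exact: ltW.
have up : 0 < enorm u by rewrite lt_neqAle eq_sym un enorm_ge0.
pose w := (rho1 / enorm u) *: u.
have wr : enorm w = rho1.
  by rewrite enormZ gtr0_norm ?divr_gt0// divfK.
have rr : rho1 <= r by rewrite ge_min lexx.
have := hr w; rewrite wr => /(_ rr).
have := jq (y + w).
have qK := enorm_superjet es jq.
set v := y - x; have -> : y + w - x = v + w by apply/rowP => i; rewrite !mxE; ring.
have vxy : enorm v = enorm (x - y) by rewrite enorm_distC.
have := U_lipschitz es y x; rewrite ler_norml => /andP[_ Ul].
have uw : dotp p w - dotp q w = rho1 * enorm u.
  by rewrite -dotpNl -dotpDl -/u dotpZr dotpxx; field.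
have b1 : dotp q v <= K * enorm (x - y).
  by rewrite (le_trans (dotp_le _ _))// -vxy ler_pM ?enorm_ge0.
have b2 : dotp (v + w) (v + w) <= (2 * rho1) * (2 * rho1).
  have : enorm (v + w) <= 2 * rho1.
    by rewrite (le_trans (enormD _ _))// wr vxy; lra.
  by move=> vw; rewrite dotpxx ler_pM ?enorm_ge0.
have b3 : C * dotp (v + w) (v + w) <= K * ((2 * rho1) * (2 * rho1)).
  by rewrite ler_pM ?dotp_ge0// ltW.
have b4 : K * enorm (x - y) <= K * (rho1 * k) by rewrite ler_pM2l.
have rk : rho1 <= k by rewrite ge_min lexx orbT.
have b5 : K * rho1 * rho1 <= K * rho1 * k by rewrite ler_pM2l// mulr_gt0.
rewrite (dotpDr v) => hx hy.
have b6 : rho1 * (K * k) = rho1 * (e / 8) by rewrite kE.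
have b7 : 0 < rho1 * e by rewrite mulr_gt0.
have : rho1 * enorm u <= rho1 * e by lra.
by rewrite ler_pM2l.
Qed.

Context (X : R -> E) (gc : gradient_curve U C X).

(** Run the scheme from X s with N steps. If the energy a of p were negative,
    energy_decay would keep the energies below -gap, independently of N. But
    the scheme reaches a point close to X T, where slopes are close to pT, and
    pT has energy 0. *)
Lemma regular_past s T p pT : 0 <= s -> s < T ->
  lower_slope U pT (X T) -> superjet C U p (X s) -> 2^-1 * dotp p p + V (X s) = 0.
Proof.
move=> s0 sT lo jp; have [jT eikT] := superjet_eikonal es lo.
apply/eqP; rewrite eq_le (es_sub es jp) /= leNgt; apply/negP.
set a := 2^-1 * dotp p p + V (X s) => a0.
pose tau := T - s; have tau0 : 0 < tau by rewrite subr_gt0.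
pose kap := expR (- (2 * C * tau)).
have kap0 : 0 < kap by exact: expR_gt0.
(* kap is a lower bound for (1 + C h)^(- 2 N); the errors of the N = tau / h
   steps add up to at most gap. *)
pose eta := - a * kap / (2 * tau).
have eta0 : 0 < eta by rewrite divr_gt0// ?mulr_gt0// oppr_gt0.
pose gap := - a * kap / 2.
have gap0 : 0 < gap by rewrite divr_gt0// mulr_gt0// oppr_gt0.
have [h0 /andP[h00 h01] hdecay] := energy_decay es eta0.
pose e := gap / (4 * K).
have e0 : 0 < e by rewrite divr_gt0// mulr_gt0.
have [rho1 rho10 hslope] := slope_close lo e0.
pose rho := Num.min rho1 e.
have rho0 : 0 < rho by rewrite lt_min rho10.
pose W := 41 * K ^+ 3 * tau * expR (5 * K * tau).
have K30 : 0 < K ^+ 3 by rewrite exprn_gt0.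
have W0 : 0 < W by rewrite !mulr_gt0// expR_gt0.
have [N [N0 Nh Nr]] : exists N : nat,
    [/\ (0 < N)%N, tau / N%:R <= h0 & W * (tau / N%:R) <= rho ^+ 2].
  exists (Num.bound (tau / h0 + W * tau / rho ^+ 2)).
  have r20 : 0 < rho ^+ 2 by rewrite exprn_gt0.
  have A0 : 0 < tau / h0 by rewrite divr_gt0.
  have B0 : 0 < W * tau / rho ^+ 2 by rewrite divr_gt0// mulr_gt0.
  have := archi_boundP (addr_ge0 (ltW A0) (ltW B0)).
  set n := Num.bound _ => hn.
  have n0 : 0 < n%:R :> R by rewrite (lt_trans _ hn)// addr_gt0.
  split; first by rewrite -(ltr0n R).
    rewrite ler_pdivrMr// mulrC -ler_pdivrMr// (le_trans _ (ltW hn))//.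
    by rewrite lerDl ltW.
  rewrite mulrA ler_pdivrMr// [leRHS]mulrC -ler_pdivrMr// (le_trans _ (ltW hn))//.
  by rewrite lerDr ltW.
have NR : 0 < N%:R :> R by rewrite ltr0n.
pose h := tau / N%:R.
have hp : 0 < h by rewrite divr_gt0.
have hh : 0 < h <= h0 by rewrite hp.
have hh1 : 0 < h <= 1 by rewrite hp (le_trans Nh).
have /choice[F hF] : forall x, exists z, fwd_step U V g h x z.
  by move=> x; exact: (fwd_step_exists es x hp).
pose Y n := iter n F (X s).
have YS n : Y n.+1 = F (Y n) by [].
pose al n := if n is m.+1 then
  2^-1 * dotp (fwd_slope g h (Y m) (Y n)) (fwd_slope g h (Y m) (Y n)) + V (Y n) else a.
have jY n : exists2 q, superjet C U q (Y n) & al n = 2^-1 * dotp q q + V (Y n).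
  case: n => [|n]; first by exists p.
  exists (fwd_slope g h (Y n) (Y n.+1)) => //.
  exact: (fwd_step_superjet es hp (hF _)).
have alS n : al n.+1 * (1 + C * h) ^+ 2 <= al n + eta * h.
  by have [q jq ->] := jY n; apply: hdecay (hF _).
have Ch : 1 <= 1 + C * h by rewrite lerDl mulr_ge0// ltW.
have Ch0 n : 0 < (1 + C * h) ^+ (2 * n) by rewrite exprn_gt0// (lt_le_trans _ Ch).
have alN n : al n * (1 + C * h) ^+ (2 * n) <=
    a + eta * h * n%:R * (1 + C * h) ^+ (2 * n).
  elim: n => [|n IH]; first by rewrite muln0 expr0 !mulr1 mulr0 addr0.
  rewrite mulnS exprD -natr1.
  have b1 : al n.+1 * (1 + C * h) ^+ 2 * (1 + C * h) ^+ (2 * n) <=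
      (al n + eta * h) * (1 + C * h) ^+ (2 * n) by rewrite ler_pM2r.
  have b2 : 1 * (eta * h * (n%:R + 1) * (1 + C * h) ^+ (2 * n)) <=
      (1 + C * h) ^+ 2 * (eta * h * (n%:R + 1) * (1 + C * h) ^+ (2 * n)).
    rewrite ler_wpM2r ?exprn_ege1//.
    apply: mulr_ge0; last exact: ltW (Ch0 n).
    by apply: mulr_ge0; [apply: mulr_ge0; exact: ltW|rewrite addr_ge0].
  by lra.
pose D n := dotp (Y n - X (s + n%:R * h)) (Y n - X (s + n%:R * h)).
pose k := 1 + 5 * K * h.
have k1 : 1 <= k by rewrite lerDl !mulr_ge0// ltW.
have DS n : D n.+1 <= k * D n + 41 * K ^+ 3 * h ^+ 2.
  have t0 : 0 <= s + n%:R * h by rewrite addr_ge0// mulr_ge0// ltW.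
  have sE : s + n.+1%:R * h = s + n%:R * h + h by rewrite -natr1; ring.
  by rewrite /D sE YS; exact: (fwd_step_curve_dist es gc t0 hh1 (hF (Y n))).
have DN n : D n <= 41 * K ^+ 3 * h ^+ 2 * n%:R * k ^+ n.
  elim: n => [|n IH].
    by rewrite /D mul0r addr0 subrr dotp0l mulr0 mul0r.
  rewrite (le_trans (DS n))// (exprS k) -(natr1 n).
  have k0 : 0 < k by rewrite (lt_le_trans _ k1).
  have b1 : k * D n <= k * (41 * K ^+ 3 * h ^+ 2 * n%:R * k ^+ n) by rewrite ler_pM2l.
  have b2 : 41 * K ^+ 3 * h ^+ 2 * 1 <= 41 * K ^+ 3 * h ^+ 2 * (k * k ^+ n).
    have kk : 1 <= k * k ^+ n by rewrite -exprS exprn_ege1.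
    apply: ler_wpM2l => //; apply: mulr_ge0; last exact: sqr_ge0.
    by apply: mulr_ge0 => //; exact: ltW.
  by lra.
have hN : h * N%:R = tau by rewrite divfK// gt_eqF.
have sN : s + N%:R * h = T by rewrite mulrC hN /tau subrKC.
have DD : D N <= rho ^+ 2.
  apply: le_trans (DN N) _; apply: le_trans Nr.
  have -> : 41 * K ^+ 3 * h ^+ 2 * N%:R * k ^+ N =
      41 * K ^+ 3 * (h * N%:R) * k ^+ N * h.
    by ring.
  rewrite hN ler_pM2r// /W ler_pM2l ?mulr_gt0//.
  have -> : 5 * K * tau = 5 * K * h * N%:R by rewrite -hN; ring.
  rewrite expRM_natr lerXn2r ?nnegrE ?expR_ge0 ?(le_trans ler01 k1)//.
  exact: expR_ge1Dx.
have YN : enorm (Y N - X T) <= rho.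
  by apply: enorm_le; [exact: ltW|rewrite -sN].
have chN : (1 + C * h) ^+ (2 * N) * kap <= 1.
  rewrite /kap expRN ler_pdivrMr ?expR_gt0// mul1r.
  have -> : 2 * C * tau = C * h * (2 * N)%:R by rewrite natrM -hN; ring.
  rewrite expRM_natr lerXn2r ?nnegrE ?expR_ge0 ?(le_trans ler01 Ch)//.
  exact: expR_ge1Dx.
have alNb : al N <= - gap.
  have aN := alN N; have c0 := Ch0 N.
  set c := (1 + C * h) ^+ (2 * N) in aN c0 chN.
  have b0 : eta * h * N%:R = gap.
    by rewrite -mulrA hN /eta /gap; field; rewrite gt_eqF.
  rewrite b0 in aN.
  have b1 : - a * (c * kap) <= - a * 1 by rewrite ler_pM2l// oppr_gt0.
  rewrite -(ler_pM2r c0); move: b1 aN; rewrite /gap; lra.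
have [q jq alE] := jY N.
have qe : enorm (q - pT) <= e.
  by apply: hslope jq; rewrite (le_trans YN)// ge_min lexx.
have qK := enorm_superjet es jq; have pK := enorm_superjet es jT.
have q2 : - (e * (2 * K)) <= dotp q q - dotp pT pT.
  have -> : dotp q q - dotp pT pT = dotp (q - pT) (q + pT).
    by rewrite !dotpE (dotpC pT q); ring.
  have qp : enorm (q + pT) <= 2 * K by rewrite (le_trans (enormD _ _))//; lra.
  by have := dotp_bound qe qp; rewrite ler_norml => /andP[].
have rhoe : rho <= e by rewrite ge_min lexx orbT.
have := V_lip es (X T) (Y N); rewrite ler_norml => /andP[VV _].
have y1 : K * enorm (Y N - X T) <= K * e by rewrite ler_pM2l// (le_trans YN).
have eK : K * e = gap / 4 by rewrite /e; field; rewrite gt_eqF.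
by move: alNb; rewrite alE; lra.
Qed.

End Regular.

(** * Integral of the potential along a curve *)

Section LipschitzIntegral.
Context (R : realType) (phi : R -> R) (L : R).
Context (phiL : forall a b, `|phi a - phi b| <= L * `|a - b|).
Local Notation mu := (@lebesgue_measure R).

Lemma lipschitz_continuous : continuous phi.
Proof.
have L0 : 0 <= L.
  by have := phiL 1 0; rewrite subr0 normr1 mulr1; apply: le_trans.
move=> t; suff : phi s @[s --> t] --> phi t by [].
apply/cvgrPdist_le => e e0.
have L1 : 0 < L + 1 by rewrite ltr_wpDl.
near=> s; apply: (le_trans (phiL t s)).
apply: (@le_trans _ _ ((L + 1) * `|t - s|)).
  by rewrite ler_wpM2r// lerDl.
rewrite -ler_pdivlMl// mulrC.
near: s; apply/nbhs_ballP; exists (e / (L + 1)); first by rewrite /= divr_gt0.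
by move=> y /ltW.
Unshelve. all: by end_near. Qed.

Lemma lipschitz_integrable a b : mu.-integrable `[a, b] (EFin \o phi).
Proof.
apply: continuous_compact_integrable; first exact: segment_compact.
by apply: continuous_subspaceT; exact: lipschitz_continuous.
Qed.

(** A quantitative form of the fundamental theorem of calculus, including the
    endpoint 0. *)
Lemma Rintegral_increment s t : 0 <= s -> s <= t ->
  `|\int[mu]_(r in `[0, t]) phi r - \int[mu]_(r in `[0, s]) phi r - (t - s) * phi t|
  <= L * (t - s) ^+ 2.
Proof.
move=> s0 st.
have mst : measurable (`]s, t] : set (measurableTypeR R)) by exact: measurable_itv.
have ist : mu.-integrable `]s, t] (EFin \o phi).
  by apply: integrableS (lipschitz_integrable s t) => //; exact: subset_itv_oc_cc.
rewrite (@Rintegral_itvB _ _ (BLeft 0) (BRight t) s) ?bnd_simp//; last first.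
  exact: lipschitz_integrable.
have cst (c : R) : \int[mu]_(r in `]s, t]) c = c * (t - s).
  rewrite Rintegral_cst//; congr (_ * _).
  have := lebesgue_measure_itv `]s, t]; rewrite /= lte_fin.
  have [<-|sn] := eqVneq s t; first by rewrite ltxx subrr => ->.
  by rewrite lt_neqAle sn st /= => ->.
have icst (c : R) : mu.-integrable `]s, t] (EFin \o (fun=> c)).
  apply: integrableS (_ : mu.-integrable `[s, t] _) => //.
    exact: subset_itv_oc_cc.
  apply: continuous_compact_integrable; first exact: segment_compact.
  by apply: continuous_subspaceT => ?; exact: cst_continuous.
have bd r : `]s, t]%classic r -> `|phi r - phi t| <= L * (t - s).
  rewrite /= in_itv/= => /andP[sr rt]; rewrite (le_trans (phiL r t))//.
  have L0 : 0 <= L.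
    by have := phiL 1 0; rewrite subr0 normr1 mulr1; apply: le_trans.
  rewrite ler_wpM2l// ler0_norm ?subr_le0//; lra.
have up : \int[mu]_(r in `]s, t]) phi r <= (phi t + L * (t - s)) * (t - s).
  rewrite -cst; apply: le_Rintegral => // r /bd; rewrite ler_norml; lra.
have lo : (phi t - L * (t - s)) * (t - s) <= \int[mu]_(r in `]s, t]) phi r.
  rewrite -cst; apply: le_Rintegral => // r /bd; rewrite ler_norml; lra.
move: up lo; move: (Rintegral _ _ _) (phi t) => I ph {mst ist cst icst bd} up lo.
by rewrite ler_norml; apply/andP; split; lra.
Qed.

End LipschitzIntegral.

Section Energy.
Context (R : realType) (d : nat) (U V : 'rV[R]_d -> R).
Context (g : 'rV[R]_d -> 'rV[R]_d) (C K B : R).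
Context (es : eikonal_solution U V g C K B).
Local Notation E := 'rV[R]_d.
Implicit Types (x y z p q : E) (h r s t : R).
Local Notation mu := (@lebesgue_measure R).

Let K1 : 1 <= K := es_K1 es.
Let C0 : 0 < C := es_C0 es.
Let CK : C <= K := es_CK es.
Let K0 : 0 < K := K_gt0 es.

Context (X : R -> E) (gc : gradient_curve U C X).

(** By regular_past all slopes along the curve satisfy |p|^2 = -2 V, so that U
    (X t) + 2 int_0^t V (X r) dr has nonnegative left derivatives; and U is
    bounded by B. *)
Lemma energy_bound T T' p : 0 <= T -> T < T' -> lower_slope U p (X T') ->
  - B <= \int[mu]_(t in `[0, T]) V (X t).
Proof.
move=> T0 TT' lo.
(* The absolute value makes the integrand Lipschitz on the whole line. *)
pose phi t := V (X `|t|).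
have phiL a b : `|phi a - phi b| <= K ^+ 2 * `|a - b|.
  rewrite /phi (le_trans (V_lip es _ _))// expr2 -mulrA ler_pM2l//.
  rewrite (le_trans (curve_dist es gc _ _))// ler_pM2l//.
  exact: ler_dist_dist.
have -> : \int[mu]_(t in `[0, T]) V (X t) = \int[mu]_(t in `[0, T]) phi t.
  apply: eq_Rintegral => t; rewrite inE/= in_itv/= => /andP[t0 _].
  by rewrite /phi ger0_norm.
pose W t := \int[mu]_(r in `[0, t]) phi r.
have W0 : W 0 = 0 by rewrite /W set_itv1 Rintegral_set1.
have incW s t : 0 <= s -> s <= t ->
    `|W t - W s - (t - s) * phi t| <= K ^+ 2 * (t - s) ^+ 2.
  exact: Rintegral_increment.
pose f t := U (X t) + 2 * W t.
have K20 : 0 < K ^+ 2 by rewrite exprn_gt0.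
have : f 0 <= f T.
  apply: (curve_nondecreasing gc) => // [r _|t q t0 tT jq vel e e0].
    exists (K ^+ 2 + 2 * (K ^+ 2 / 2 + K ^+ 2 * T)), 1; split=> //.
      have : 0 <= K ^+ 2 * T by rewrite mulr_ge0// ltW.
      by have := ltW K20; lra.
    suff h a b : 0 <= a -> a <= b -> b <= T -> `|f b - f a| <=
        (K ^+ 2 + 2 * (K ^+ 2 / 2 + K ^+ 2 * T)) * (b - a).
      move=> a b /andP[a0 aT] /andP[b0 bT] _ _; have [ab|ba] := leP a b.
        by rewrite distrC (distrC a b) (@ger0_norm _ (b - a)) ?subr_ge0// h.
      by rewrite (@gtr0_norm _ (a - b)) ?subr_gt0// h// ltW.
    move=> a0 ab bT; have b0 := le_trans a0 ab.
    have := incW a b a0 ab.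
    have := U_lipschitz es (X a) (X b).
    have := curve_lip es gc a0 ab.
    rewrite /f /phi (ger0_norm b0) => XX.
    have : K * enorm (X b - X a) <= K * (K * (b - a)) by rewrite ler_pM2l.
    have bV : (b - a) * - (K ^+ 2 / 2) <= (b - a) * V (X b).
      by rewrite ler_wpM2l ?subr_ge0// (es_VK es).
    have bV' : (b - a) * V (X b) <= 0.
      by rewrite mulr_ge0_le0 ?subr_ge0// (es_V0 es).
    have bT2 : K ^+ 2 * (b - a) ^+ 2 <= K ^+ 2 * (T * (b - a)).
      by rewrite ler_pM2l// expr2 ler_wpM2r ?subr_ge0//; lra.
    rewrite !ler_norml => XX2 /andP[U1 U2] /andP[W1 W2].
    by apply/andP; split; lra.
  have tT' : t < T' by exact: le_lt_trans TT'.
  have eik := regular_past es gc (ltW t0) tT' lo jq.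
  have qK := enorm_superjet es jq.
  have [del del0 hdel] := vel (e / (2 * K)) ltac:(by rewrite divr_gt0// mulr_gt0).
  pose A := C / 2 * K ^+ 2 + 2 * K ^+ 2.
  have A0 : 0 < A by rewrite addr_gt0// !mulr_gt0// invr_gt0.
  exists (Num.min del (e / (2 * A))).
    by rewrite lt_min del0 divr_gt0// mulr_gt0.
  move=> s; rewrite ltrBlDr -ltrBlDl lt_min => /andP[sd1 sd2] st s0.
  have ts0 : 0 < t - s by rewrite subr_gt0.
  have := hdel s _ st s0; set err := _ - _ *: q => /(_ _) herr.
  have {}herr : enorm err <= e / (2 * K) * (t - s) by apply: herr; lra.
  have := incW s t s0 (ltW st); rewrite ler_norml => /andP[W1 _].
  have := jq (X s).
  have eX : X s - X t = - ((t - s) *: q + err).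
    by rewrite /err; apply/rowP => i; rewrite !mxE; ring.
  have b0 : dotp q (X s - X t) = - ((t - s) * dotp q q + dotp q err).
    by rewrite eX dotpNr dotpDr dotpZr.
  have b1 : dotp (X s - X t) (X s - X t) <= (K * (t - s)) * (K * (t - s)).
    have := curve_lip es gc s0 (ltW st); rewrite enorm_distC => hh.
    by rewrite dotpxx ler_pM ?enorm_ge0.
  have b1' : C * dotp (X s - X t) (X s - X t) <= C * ((K * (t - s)) * (K * (t - s))).
    by rewrite ler_pM2l.
  have b2 : - (K * (e / (2 * K) * (t - s))) <= dotp q err.
    by have := dotp_bound qK herr; rewrite ler_norml => /andP[].
  have b3 : K * (e / (2 * K) * (t - s)) = e / 2 * (t - s) by field; rewrite gt_eqF.
  have b4 : A * (t - s) * (t - s) <= e / 2 * (t - s).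
    rewrite ler_pM2r// mulrC -ler_pdivlMr//.
    by rewrite -mulrA -invfM ltW.
  have phit : phi t = V (X t) by rewrite /phi gtr0_norm.
  have b5 : (t - s) * dotp q q = - 2 * ((t - s) * V (X t)).
    have -> : V (X t) = - (2^-1 * dotp q q) by lra.
    by field.
  rewrite b0 /f; move: W1 b4; rewrite /A phit; lra.
rewrite /f W0 mulr0 addr0 -/(W T).
have := es_UB es (X 0); have := es_UB es (X T); rewrite !ler_norml; lra.
Qed.

End Energy.

(** * Lattice-periodic functions and line derivatives *)

Section Periodic.
Context (R : realType) (d : nat).
Local Notation E := 'rV[R]_d.
Implicit Types (y z k : E).

Definition integral_vector k := forall i, k 0 i \is a Num.int.

Definition lattice_periodic (T : Type) (f : E -> T) :=
  forall y k, integral_vector k -> f (y + k) = f y.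

Let box := [set y : E | forall i, y ord0 i \in `[-1, 1]].

Let box_compact : compact box.
Proof.
by apply: (@rV_compact R d (fun=> `[-1, 1]%classic)) => _; exact: segment_compact.
Qed.

Let to_box y : exists2 k, integral_vector k & box (y + k).
Proof.
exists (\row_i - (Num.floor (y 0 i))%:~R).
  by move=> i; rewrite mxE rpredN intr_int.
move=> i; rewrite !mxE in_itv/=.
have := floor_le (y 0 i); have := floorD1_gt (y 0 i); rewrite intrD; lra.
Qed.

Let box0 : box !=set0.
Proof. by exists 0 => i; rewrite mxE in_itv/=; apply/andP; split; lra. Qed.

Lemma periodic_bounded (f : E -> R) : continuous f -> lattice_periodic f ->
  exists M, forall y, `|f y| <= M.
Proof.
move=> fc fp.
have [a _ ha] := EVT_max_rV box0 box_compact (continuous_subspaceT fc).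
have [b _ hb] := EVT_min_rV box0 box_compact (continuous_subspaceT fc).
exists (`|f a| + `|f b|) => y; have [k ik yk] := to_box y.
rewrite -(fp y k ik).
have := ha (y + k) (mem_set yk); have := hb (y + k) (mem_set yk).
have := ler_norm (f a); have := normr_ge0 (f a).
have := ler_norm (- f b); have := normr_ge0 (f b); rewrite normrN.
by rewrite ler_norml; lra.
Qed.

Lemma periodic_unif_continuous (f : E -> R) (e : R) :
  continuous f -> lattice_periodic f -> 0 < e -> exists2 rho, 0 < rho &
    forall y z, enorm (z - y) <= rho -> `|f z - f y| <= e.
Proof.
move=> fc fp e0.
pose P (r : R) y := forall z, enorm (z - y) <= r -> `|f z - f y| <= e.
have : \forall r \near (0 : R), box `<=` P r.
  apply: ((compact_near_coveringP box).1 box_compact R (nbhs (0 : R)) P _ _) => y _.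
  have [r r0 hr] := (cvg_enormP f y).1 (fc y) (e / 2) ltac:(by rewrite divr_gt0).
  exists ([set y' | enorm (y' - y) <= r / 2], ball (0 : R) (r / 2)).
    split; last by apply: nbhsx_ballx; rewrite divr_gt0.
    by apply/nbhs_enormP; exists (r / 2); [rewrite divr_gt0|].
  move=> [y' s] /= [y'y]; rewrite -ball_normE/= sub0r normrN => sr z zy'.
  have zy : enorm (z - y) <= r.
    have := enormD (z - y') (y' - y); rewrite addrA subrK.
    by have := ler_norm s; lra.
  have := hr z zy; have := hr y' (le_trans y'y (_ : r / 2 <= r)).
  by rewrite !ler_norml => /(_ ltac:(lra)); lra.
move=> /nbhs_ballP[r /= r0 hr].
exists (r / 2); first by rewrite divr_gt0.
have {hr}hr : box `<=` P (r / 2).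
  by apply: hr; rewrite -ball_normE/= sub0r normrN gtr0_norm; lra.
move=> y z zy; have [k ik yk] := to_box y.
rewrite -(fp y k ik) -(fp z k ik); apply: hr => //.
by rewrite opprD addrACA subrr addr0.
Qed.

Lemma derive_periodic (f : E -> R) v : lattice_periodic f -> lattice_periodic ('D_v f).
Proof.
move=> fp y k ik.
suff e : (fun h : R => h^-1 *: ((f \o shift (y + k)) (h *: v) - f (y + k))) =
    (fun h : R => h^-1 *: ((f \o shift y) (h *: v) - f y)) by rewrite /derive e.
by apply/funext => h /=; rewrite addrA !(fp _ k ik).
Qed.

End Periodic.

Section LineDerivative.
Context (R : realType) (d : nat).
Local Notation E := 'rV[R]_d.

Lemma is_derive_line (F : E -> R) (y e : E) (t : R) :
  differentiable F (y + t *: e) ->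
  is_derive t 1 (fun s => F (y + s *: e)) ('D_e F (y + t *: e)).
Proof.
move=> dF.
have eqf : (fun h : R => h^-1 *: (((fun s => F (y + s *: e)) \o shift t) (h *: 1)
      - F (y + t *: e))) =
    (fun h : R => h^-1 *: ((F \o shift (y + t *: e)) (h *: e) - F (y + t *: e))).
  apply/funext => h /=; congr (_ *: (F _ - _)).
  by rewrite [h *: 1]mulr1 scalerDl addrCA addrC.
split; last by rewrite /derive eqf.
by rewrite /derivable eqf; exact: diff_derivable.
Qed.

Lemma derive_coord (F : E -> R) (y e : E) : differentiable F y ->
  'D_e F y = \sum_i e 0 i * 'D_(delta_mx 0 i) F y.
Proof.
move=> dF; rewrite deriveE// {1}(row_sum_delta e) linear_sum/=.
by apply: eq_bigr => i _; rewrite linearZ/= deriveE.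
Qed.

Lemma mean_value (f df : R -> R) (a b : R) :
  (forall t : R, is_derive t 1 f (df t)) ->
  exists2 c, Num.min a b <= c <= Num.max a b & f b - f a = df c * (b - a).
Proof.
move=> h.
have fc : continuous f.
  by move=> t; apply/differentiable_continuous/derivable1_diffP; case: (h t).
have [ab|ba] := leP a b.
  have [c cab e] := MVT_segment ab (fun t _ => h t) (continuous_subspaceT fc).
  by exists c.
have [c cab e] := MVT_segment (ltW ba) (fun t _ => h t) (continuous_subspaceT fc).
exists c => //; lra.
Qed.

(** The left-hand side vanishes for polynomials of degree 2, so f may be
    replaced by the remainder psi of its second-order expansion at 1/3. *)
Lemma radau_quadrature (f f1 f2 : R -> R) (w : R) :
  (forall t : R, is_derive t 1 f (f1 t)) -> (forall t : R, is_derive t 1 f1 (f2 t)) ->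
  (forall t s, 0 <= t <= 1 -> 0 <= s <= 1 -> `|f2 t - f2 s| <= w) ->
  `|f 0 - 3 / 4 * f 3^-1 - 4^-1 * f 1 + 2^-1 * f1 3^-1| <= 2 * w.
Proof.
move=> h1 h2 hw; set a : R := 3^-1; pose k := f2 a.
have a01 : 0 <= a <= 1 by rewrite /a; apply/andP; split; lra.
have w0 : 0 <= w by have := hw a a a01 a01; rewrite subrr normr0.
pose psi t := f t - f a - f1 a * (t - a) - k / 2 * (t - a) ^+ 2.
pose psi1 t := f1 t - f1 a - k * (t - a).
have dpsi (t : R) : is_derive t 1 psi (psi1 t).
  have -> : psi = f - cst (f a) - f1 a *: (id - cst a)
                  - (k / 2) *: ((id - cst a) ^+ 2 : R -> R).
    by apply/funext => s; rewrite /psi !fctE.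
  have dI := is_deriveB (is_derive_id t (1 : R)) (is_derive_cst a t (1 : R)).
  apply: is_derive_eq.
  by rewrite /psi1 !fctE /GRing.scale /=; field.
have b1 t : 0 <= t <= 1 -> `|psi1 t| <= w.
  move=> /andP[t0 t1].
  have [c /andP[ca ct] e] := mean_value a t h2.
  have c01 : 0 <= c <= 1.
    rewrite (le_trans _ ca) ?le_min ?t0; last by case/andP: a01 => ->.
    by rewrite (le_trans ct)// ge_max t1; case/andP: a01 => _ ->.
  have -> : psi1 t = (f2 c - k) * (t - a) by rewrite /psi1; move: e; lra.
  rewrite normrM -[leRHS]mulr1 ler_pM ?hw//.
  by case/andP: a01 => ? ?; rewrite ler_norml; lra.
have b2 t : 0 <= t <= 1 -> `|psi t| <= w.
  move=> /andP[t0 t1].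
  have [c /andP[ca ct] e] := mean_value a t dpsi.
  have c01 : 0 <= c <= 1.
    rewrite (le_trans _ ca) ?le_min ?t0; last by case/andP: a01 => ->.
    by rewrite (le_trans ct)// ge_max t1; case/andP: a01 => _ ->.
  have pa : psi a = 0 by rewrite /psi !subrr expr0n /= !mulr0 !subr0.
  rewrite pa subr0 in e; rewrite e normrM -[leRHS]mulr1 ler_pM ?b1//.
  by case/andP: a01 => ? ?; rewrite ler_norml; lra.
have -> : f 0 - 3 / 4 * f a - 4^-1 * f 1 + 2^-1 * f1 a = psi 0 - 4^-1 * psi 1.
  by rewrite /psi /a; field.
have := b2 0 ltac:(lra); have := b2 1 ltac:(lra).
by rewrite !ler_norml; lra.
Qed.

End LineDerivative.

(** * Uniform second-order estimates for the potential *)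

Section SecondOrder.
Context (R : realType) (d : nat).
Local Notation E := 'rV[R]_d.
Implicit Types (y z e : E).

Lemma enorm_le_coord (x : E) (a : R) : 0 <= a -> (forall i, `|x 0 i| <= a) ->
  enorm x <= d.+1%:R * a.
Proof.
move=> a0 h; rewrite (le_trans (enorm_le_norm _))// ler_wpM2l//.
rewrite /Num.norm/= mx_normrE bigmax_le// => -[i j] _ /=.
by rewrite (ord1 i).
Qed.

Lemma sum_const_le (F : 'I_d -> R) (a : R) : (forall i, F i <= a) ->
  \sum_i F i <= d%:R * a.
Proof.
move=> h; rewrite (le_trans (ler_sum _ (fun i _ => h i)))//.
by rewrite sumr_const card_ord mulr_natl.
Qed.

Lemma finite_bound (T : finType) (F : T -> E -> R) :
  (forall i, exists M, forall y, `|F i y| <= M) ->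
  exists2 M, 0 <= M & forall i y, `|F i y| <= M.
Proof.
move=> /choice[M hM]; exists (\sum_i `|M i|); first by rewrite sumr_ge0.
move=> i y; rewrite (le_trans (hM i y))// (le_trans (ler_norm _))//.
by rewrite (bigD1 i)//= lerDl sumr_ge0.
Qed.

Lemma finite_pos (T : finType) (r : T -> R) : (forall i, 0 < r i) ->
  exists2 r0, 0 < r0 & forall i, r0 <= r i.
Proof.
move=> r0; exists (\sum_i (r i)^-1 + 1)^-1.
  rewrite invr_gt0 ltr_wpDl// sumr_ge0// => i _; by rewrite invr_ge0 ltW.
move=> i; rewrite -[leRHS]invrK lef_pV2 ?posrE ?invr_gt0//.
  rewrite (bigD1 i)//= -addrA lerDl addr_ge0// sumr_ge0// => j _.
  by rewrite invr_ge0 ltW.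
rewrite ltr_wpDl// sumr_ge0// => j _; by rewrite invr_ge0 ltW.
Qed.

Context (f : E -> R).
Context (f0 : forall y, differentiable f y)
  (f1 : forall v y, differentiable ('D_v f) y)
  (f2 : forall v w, continuous ('D_w ('D_v f))).
Context (fp : lattice_periodic f).

Definition gradient y : E := \row_i 'D_(delta_mx 0 i) f y.

Let D i := 'D_(delta_mx 0 i) f.
Let H i j := 'D_(delta_mx 0 j) (D i).

Lemma derive_gradient e y : 'D_e f y = dotp (gradient y) e.
Proof.
by rewrite derive_coord//; apply: eq_bigr => i _; rewrite mxE mulrC.
Qed.

Let derive2 e y : 'D_e ('D_e f) y = \sum_j e 0 j * \sum_i e 0 i * H i j y.
Proof.
rewrite derive_coord//; apply: eq_bigr => j _; congr (_ * _).
have -> : 'D_e f = \sum_i (e 0 i \*: D i).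
  apply/funext => z; rewrite derive_coord// fct_sumE.
  by apply: eq_bigr.
have h i : is_derive y (delta_mx 0 j) (e 0 i \*: D i) (e 0 i *: H i j y).
  by apply: is_deriveZ; apply: DeriveDef => //; exact/diff_derivable/f1.
by have := is_derive_sum h; case=> _ ->.
Qed.

Let Dbound : exists2 M, 0 <= M & forall i y, `|D i y| <= M.
Proof.
apply: finite_bound => i; apply: periodic_bounded.
  by move=> y; apply: differentiable_continuous; exact: f1.
exact: derive_periodic.
Qed.

Let Hbound : exists2 M, 0 <= M & forall i j y, `|H i j y| <= M.
Proof.
have [|M M0 hM] := @finite_bound ('I_d * 'I_d)%type (fun p => H p.1 p.2).
  move=> [i j]; apply: periodic_bounded; first exact: f2.
  by apply: derive_periodic; exact: derive_periodic.
by exists M => // i j y; exact: (hM (i, j)).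
Qed.

Let Hunif (eta : R) : 0 < eta -> exists2 rho, 0 < rho & forall i j y z,
  enorm (z - y) <= rho -> `|H i j z - H i j y| <= eta.
Proof.
move=> eta0.
have /choice[r hr] : forall p : 'I_d * 'I_d, exists r, 0 < r /\ forall y z,
    enorm (z - y) <= r -> `|H p.1 p.2 z - H p.1 p.2 y| <= eta.
  move=> [i j].
  have Hp : lattice_periodic (H i j) by do 2 apply: derive_periodic.
  have Hc : continuous (H i j) by exact: f2.
  have [r r0 h] := periodic_unif_continuous Hc Hp eta0.
  by exists r.
have [r0 r00 hr0] := @finite_pos _ r (fun p => (hr p).1).
exists r0 => // i j y z yz; apply: (hr (i, j)).2.
exact: le_trans (hr0 (i, j)).
Qed.

Lemma gradient_bounded : exists2 M, 0 <= M & forall y, enorm (gradient y) <= M.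
Proof.
have [M M0 hM] := Dbound; exists (d.+1%:R * M); first by rewrite mulr_ge0.
by move=> y; apply: enorm_le_coord => // i; rewrite mxE hM.
Qed.

Lemma gradient_lipschitz : exists2 M, 0 <= M &
  forall y z, enorm (gradient y - gradient z) <= M * enorm (y - z).
Proof.
have [M M0 hM] := Hbound; exists (d.+1%:R * (d%:R * M)); first by rewrite !mulr_ge0.
move=> y z; rewrite -mulrA; apply: enorm_le_coord.
  by rewrite !mulr_ge0// enorm_ge0.
move=> i; rewrite !mxE; set w := y - z.
have h t := is_derive_line (y := z) (e := w) (t := t) (f1 (delta_mx 0 i) _).
have [c _] := mean_value 0 1 h.
rewrite scale1r scale0r addr0 /w subrKC subr0 mulr1 => ->.
rewrite -/w -/(D i) derive_coord; last exact: f1.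
rewrite (le_trans (ler_norm_sum _ _ _))// -mulrA; apply: sum_const_le => j.
by rewrite normrM mulrC ler_pM ?coord_le_enorm// hM.
Qed.

Lemma gradient_taylor (M : R) y z :
  (forall y z, enorm (gradient y - gradient z) <= M * enorm (y - z)) -> 0 <= M ->
  `|f z - f y - dotp (gradient y) (z - y)| <= M * dotp (z - y) (z - y).
Proof.
move=> lip M0; set w := z - y.
have h t := is_derive_line (y := y) (e := w) (t := t) (f0 _).
have [c c01] := mean_value 0 1 h.
rewrite scale1r scale0r addr0 /w subrKC subr0 mulr1 => ->.
rewrite -/w derive_gradient -dotpNl -dotpDl (le_trans (norm_dotp_le _ _))//.
rewrite dotpxx mulrA ler_wpM2r ?enorm_ge0//.
rewrite (le_trans (lip _ _))// addrAC subrr add0r enormZ ler_wpM2l//.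
rewrite -[leRHS]mul1r ler_wpM2r ?enorm_ge0//.
by move: c01; rewrite (min_idPl _)// (max_idPr _)// ler_norml; lra.
Qed.

(** Apply radau_quadrature on the segment from y to y + e; the second
    derivatives of f are uniformly continuous by periodicity. *)
Lemma gradient_quadrature (eta : R) : 0 < eta -> exists2 rho, 0 < rho &
  forall y e, enorm e <= rho ->
    `|f y - 3 / 4 * f (y + 3^-1 *: e) - 4^-1 * f (y + e)
      + 2^-1 * dotp (gradient (y + 3^-1 *: e)) e| <= eta * dotp e e.
Proof.
move=> eta0; pose w := eta / (2 * (d%:R * d%:R + 1)).
have dd : 0 < d%:R * d%:R + 1 :> R by rewrite ltr_wpDl// mulr_ge0.
have w0 : 0 < w by rewrite divr_gt0// mulr_gt0.
have [rho rho0 hrho] := Hunif w0; exists rho => // y e erho.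
have h1 t := is_derive_line (y := y) (e := e) (t := t) (f0 _).
have h2 t := is_derive_line (y := y) (e := e) (t := t) (f1 e _).
have D0 := dotp_ge0 e.
have := @radau_quadrature R _ _ _ (d%:R * (d%:R * (w * dotp e e))) h1 h2.
rewrite scale0r addr0 scale1r derive_gradient.
have bd : 2 * (d%:R * (d%:R * (w * dotp e e))) <= eta * dotp e e.
  have -> : eta * dotp e e = 2 * ((d%:R * d%:R + 1) * (w * dotp e e)).
    by rewrite /w; field; rewrite gt_eqF.
  have : 0 <= w * dotp e e by rewrite mulr_ge0// ltW.
  by lra.
move=> h; apply: le_trans bd; apply: h => t s /andP[t0 t1] /andP[s0 s1].
rewrite !derive2 -sumrB (le_trans (ler_norm_sum _ _ _))//.
apply: sum_const_le => j; rewrite -mulrBr -sumrB normrM.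
rewrite (le_trans (ler_wpM2l (normr_ge0 _) (ler_norm_sum _ _ _)))// mulr_sumr.
apply: sum_const_le => i; rewrite -mulrBr normrM mulrA mulrC dotpxx.
have He : `|H i j (y + t *: e) - H i j (y + s *: e)| <= w.
  apply: hrho.
  have -> : y + t *: e - (y + s *: e) = (t - s) *: e.
    by apply/rowP => k; rewrite !mxE; ring.
  rewrite enormZ (le_trans _ erho)// -[leRHS]mul1r ler_wpM2r ?enorm_ge0//.
  by rewrite ler_norml; lra.
apply: ler_pM => //.
by apply: ler_pM; rewrite ?coord_le_enorm.
Qed.

End SecondOrder.

(** * Lifting from the torus *)

Local Open Scope quotient_scope.

Section TorusLift.
Context (R : realType) (d : nat).
Local Notation E := 'rV[R]_d.
Implicit Types (y z k p w : E) (u : torus R d -> R).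

Lemma pi_shift y k : integral_vector k ->
  \pi_(torus R d) (y + k) = \pi_(torus R d) y.
Proof.
move=> ik; apply/(@eqquotP _ (lattice_eq_rel R d)); apply/forallP => i.
by rewrite mxE addrAC subrr add0r.
Qed.

Lemma plift_periodic u : lattice_periodic (plift u).
Proof. by move=> y k ik; rewrite /plift /= pi_shift. Qed.

Lemma repr_pi y : exists2 k, integral_vector k & repr (\pi_(torus R d) y) = y + k.
Proof.
exists (repr (\pi_(torus R d) y) - y); last by rewrite subrKC.
have /(@eqquotP _ (lattice_eq_rel R d))/forallP h :
    repr (\pi_(torus R d) y) = y %[mod torus R d] by rewrite reprK.
by move=> i; rewrite !mxE; exact: h.
Qed.

Lemma plift_continuous u : continuous u -> continuous (plift u).
Proof.
move=> cu y; apply: continuous_comp; last exact: cu.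
exact: pi_continuous.
Qed.

Lemma dnbhs_enormP (A : set E) y : y^' A <->
  exists2 r, 0 < r & forall w, 0 < enorm w <= r -> A (y + w).
Proof.
split=> [|[r r0 h]].
  move=> /nbhs_enormP[r r0 h]; exists r => // w /andP[w0 wr].
  apply: h; first by rewrite addrAC subrr add0r.
  apply/eqP => /(congr1 (fun v => v - y)); rewrite addrAC subrr add0r => w00.
  by move: w0; rewrite w00 enorm0 ltxx.
apply/nbhs_enormP; exists r => // z zr zy.
have -> : z = y + (z - y) by rewrite subrKC.
apply: h; rewrite zr andbT lt_neqAle enorm_ge0 andbT eq_sym.
apply/eqP => /enorm0_eq0/eqP; rewrite subr_eq0; exact/negP.
Qed.

Lemma limf_esup_le0 (h : E -> \bar R) y : (forall e : R, 0 < e ->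
    y^' [set z | (h z <= e%:E)%E]) -> (limf_esup h y^' <= 0)%E.
Proof.
move=> H; apply/lee_addgt0Pr => e e0; rewrite add0e.
apply: (@le_trans _ _ (ereal_sup (h @` [set z | (h z <= e%:E)%E]))).
  by apply: ereal_inf_lbound; exists [set z | (h z <= e%:E)%E] => //; exact: H.
by apply: ge_ereal_sup => _ [z zh <-]; exact: zh.
Qed.

Lemma limf_esup_le0_near (h : E -> \bar R) y (e : R) :
  (limf_esup h y^' <= 0)%E -> 0 < e -> y^' [set z | (h z <= e%:E)%E].
Proof.
move=> H e0.
have : (limf_esup h y^' < e%:E)%E by rewrite (le_lt_trans H)// lte_fin.
move=> /ereal_inf_lt[_ [A yA <-] sA]; apply: filterS yA => z Az /=.
by apply: le_trans (ltW sA); apply: ereal_sup_ubound; exists z.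
Qed.

(** By periodicity the representative of the class of y may be replaced by y. *)
Lemma upper_slope_superdiff u p y :
  upper_slope (plift u) p y <-> superdiff u (\pi_(torus R d) y) p.
Proof.
have [k ik yk] := repr_pi y; rewrite /superdiff /= yk.
have tr w : plift u (y + k + w) = plift u (y + w).
  by rewrite addrAC (@plift_periodic u (y + w) k ik).
have t0 : plift u (y + k) = plift u y by exact: (@plift_periodic u y k ik).
have sd (w : E) (e : R) : 0 < enorm w ->
    (slope_defect (plift u) p (y + k) (y + k + w)%R <= e%:E)%E =
    (plift u (y + w) <= plift u y + dotp p w + e * enorm w).
  move=> w0; rewrite /slope_defect lee_fin (addrC (y + k)) addrK (addrC w) tr t0.
  by rewrite ler_pdivrMr// lerBlDr lerBlDl addrA addrAC; congr (_ <= _); ring.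
split=> [up|sup e e0].
  apply: limf_esup_le0 => e e0; apply/dnbhs_enormP.
  have [r r0 hr] := up e e0; exists r => // w /andP[w0 wr] /=.
  by rewrite sd// hr.
have /dnbhs_enormP[r r0 hr] := limf_esup_le0_near sup e0; exists r => // w wr.
have [w0|wn] := eqVneq (enorm w) 0.
  by rewrite (enorm0_eq0 w0) addr0 dotp0r enorm0 mulr0 !addr0.
by rewrite -sd ?hr// ?wr ?andbT lt_neqAle eq_sym wn enorm_ge0.
Qed.

Lemma lower_slope_subdiff u p y :
  lower_slope (plift u) p y -> subdiff u (\pi_(torus R d) y) p.
Proof.
move=> lo; have [k ik yk] := repr_pi y; rewrite /subdiff /= yk.
rewrite /limf_einf oppe_ge0; apply: limf_esup_le0 => e e0.
apply/dnbhs_enormP; have [r r0 hr] := lo e e0; exists r => // w /andP[w0 wr] /=.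
rewrite /slope_defect /= lee_fin (addrC (y + k)) addrK (addrC w).
rewrite (addrAC y k w) (@plift_periodic u (y + w) k ik) (@plift_periodic u y k ik).
rewrite -mulNr ler_pdivrMr//.
by have := hr w wr; lra.
Qed.

(** Only the lower half of the first-order expansion is retained: for a
    semiconcave function it implies the other half. *)
Lemma differentiable_lower_slope u y :
  differentiable (plift u) (repr (\pi_(torus R d) y)) ->
  exists p, lower_slope (plift u) p y.
Proof.
have [k ik ->] := repr_pi y => df.
set F := plift u in df *.
exists (\row_i 'd F (y + k) (delta_mx 0 i)) => e e0.
have [r r0 hr] : exists2 r, 0 < r & forall w, enorm w <= r ->
    `|F (y + k + w) - F (y + k) - 'd F (y + k) w| <= e * enorm w.
  have /eqaddoP/(_ e e0)/nbhs_enormP[r r0 h] := diff_locally df.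
  exists r => // w wr; have /h : enorm (w - 0) <= r by rewrite subr0.
  rewrite !fctE /= (addrC w) opprD addrA => /le_trans; apply.
  by rewrite ler_pM2l// norm_le_enorm.
exists r => // w wr; have := hr w wr.
rewrite (addrAC y k w) /F (@plift_periodic u (y + w) k ik).
rewrite (@plift_periodic u y k ik) -/F.
have -> : dotp (\row_i 'd F (y + k) (delta_mx 0 i)) w = 'd F (y + k) w.
  rewrite [in RHS](row_sum_delta w) linear_sum/=; apply: eq_bigr => i _.
  by rewrite mxE linearZ/= mulrC.
by rewrite ler_norml => /andP[lo _]; lra.
Qed.

End TorusLift.

(** * Eventual singularity *)

Section TorusEikonal.
Context (R : realType) (d : nat).
Local Notation E := 'rV[R]_d.
Implicit Types (u V : torus R d -> R).

Lemma torus_eikonal_solution V u : C2 V -> is_max V 0 -> semiconcave u ->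
  viscosity_solution V u ->
  exists g C K B, eikonal_solution (plift u) (plift V) g C K B.
Proof.
move=> [V0 V1 V2] [Vle0 _] [uc [C C0 sc]] [vsub vsuper].
have Vper := plift_periodic V.
have Uc := plift_continuous uc.
have [B UB] := periodic_bounded Uc (plift_periodic u).
have Vc : continuous (plift V).
  by move=> y; exact: differentiable_continuous.
have [M0 VM] := periodic_bounded Vc Vper.
have [M1 M10 gM] := gradient_bounded V1 Vper.
have [M2 M20 glip] := gradient_lipschitz V1 V2 Vper.
pose K := 1 + C + 2 * `|M0| + M1 + M2.
have M00 := normr_ge0 M0.
have K0 : 0 < K by rewrite /K; lra.
exists (gradient (plift V)), C, K, B; split => //.
- by rewrite /K; lra.
- by rewrite /K; lra.
- by move=> y z l hl; have := sc y z l hl; rewrite enorm_sqr.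
- move=> p y jet; rewrite -enorm_sqr.
  have : upper_slope (plift u) p y.
    move=> e e0; have C10 : 0 < C / 2 + 1 by rewrite ltr_wpDl// divr_ge0// ltW.
    exists (e / (C / 2 + 1)); first by rewrite divr_gt0.
    move=> w; rewrite ler_pdivlMr// => hw.
    have := jet (y + w); rewrite (addrC y w) addrK => /le_trans; apply.
    rewrite lerD2l dotpxx mulrA ler_wpM2r ?enorm_ge0//.
    by have := enorm_ge0 w; lra.
  by move/upper_slope_superdiff/vsub.
- by move=> p y /lower_slope_subdiff/vsuper; rewrite enorm_sqr.
- by move=> y; exact: Vle0.
- move=> y; have := VM y; rewrite ler_norml => /andP[lo _].
  apply: le_trans lo; rewrite lerN2.
  have M0K : 2 * M0 <= K by have := ler_norm M0; rewrite /K; lra.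
  have : K * 1 <= K ^+ 2 by rewrite expr2 ler_pM2l// /K; lra.
  by lra.
- by move=> y; rewrite (le_trans (gM y))// /K; lra.
- move=> y z; rewrite (le_trans (glip y z))// ler_wpM2r ?enorm_ge0// /K; lra.
- move=> y z; rewrite (le_trans (gradient_taylor V0 _ _ glip M20))//.
  by rewrite ler_wpM2r ?dotp_ge0// /K; lra.
- exact: gradient_quadrature.
Qed.

Lemma derivable_left_velocity (X : R -> E) t : derivable X t 1 ->
  left_velocity X t ('D_1 X t).
Proof.
move=> dX e e0; have d0 : 0 < e / d.+1%:R by rewrite divr_gt0.
have df : differentiable X t by apply/derivable1_diffP.
have /eqaddoP/(_ _ d0)/nbhs_ballP[r /= r0 h] := diff_locally df.
exists r => // s rs st _.
have /h : ball (0 : R) r (s - t).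
  by rewrite -ball_normE/= sub0r normrN ltr0_norm ?subr_lt0//; lra.
rewrite !fctE /= subrK opprD addrA => hX.
have -> : X t - X s - (t - s) *: 'D_1 X t = - (X s - X t - 'd X t (s - t)).
  have -> : 'd X t (s - t) = (s - t) *: 'D_1 X t.
    by rewrite deriveE// -linearZ/= [(s - t) *: 1]mulr1.
  by apply/rowP => i; rewrite !mxE; ring.
rewrite enormN (le_trans (enorm_le_norm _))//.
rewrite -ler_pdivlMl// mulrCA mulrA [e / _ * _]mulrC (le_trans hX)//.
by rewrite ltr0_norm ?subr_lt0// opprB mulrC.
Qed.

Lemma flow_gradient_curve V u g (C K B : R) x xi :
  eikonal_solution (plift u) (plift V) g C K B -> gradient_flow_from u x xi ->
  exists2 X, gradient_curve (plift u) C X &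
    forall t : R, 0 <= t -> xi t = \pi_(torus R d) (X t).
Proof.
move=> es [_ [X [xiX lipX velX]]]; exists X => //; split.
  move=> t t0; have [A /nbhs_ballP[r /= r0 hr] lip] := lipX t t0.
  have [M [M0 hM]] := pinfty_ex_gt0 lip.
  exists (d.+1%:R * M), r; split => //; first by rewrite mulr_ge0// ltW.
  move=> s s' s0 s'0 st s't.
  rewrite (le_trans (enorm_le_norm _))// -mulrA ler_pM2l//.
  have As v : 0 <= v -> `|v - t| < r -> (A `&` [set w | 0 <= w]) v.
    by move=> v0 vt; split=> //; apply: hr; rewrite -ball_normE/= distrC.
  by apply: (hM (s, s')); split; exact: As.
apply: (@filterS _ _ (ae_filter_ringOfSetsType _) _ _ _ velX).
move=> t ht t0; have [dX sX] := ht (ltW t0).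
exists ('D_1 X t); last exact: derivable_left_velocity.
apply: upper_slope_superjet; [exact: ltW (es_C0 es)|exact: es_sc es|].
by apply/upper_slope_superdiff; rewrite -xiX// ltW.
Qed.

End TorusEikonal.

Theorem corollary24 (R : realType) (d : nat) (V u : torus R d -> R)
    (hV : C2 V) (hmax : is_max V 0)
    (hu : semiconcave u) (hvisc : viscosity_solution V u)
    (x : torus R d) (xi : R -> torus R d) (hxi : gradient_flow_from u x xi)
    (hneg : exists2 mu : probability (borel_torus R d) R,
       occupational_measure xi mu & \int[mu]_y V y < 0) :
  exists2 t0 : R, 0 <= t0 & forall t : R, t0 <= t -> Sing u (xi t).
Proof.
have [g [C [K [B es]]]] := torus_eikonal_solution hV hmax hu hvisc.
have [X gc xiX] := flow_gradient_curve es hxi.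
apply: contrapT => H.
have bound T : 0 <= T -> - B <= \int[@lebesgue_measure R]_(t in `[0, T]) V (xi t).
  move=> T0.
  (* Otherwise the curve would be singular at all times from T + 1 on. *)
  have [T' [TT' reg]] : exists T', T < T' /\ ~ Sing u (xi T').
    apply: contrapT => H'; apply: H; exists (T + 1); first by rewrite addr_ge0.
    move=> t Tt; apply: contrapT => nS; apply: H'; exists t; split=> //.
    by rewrite (lt_le_trans _ Tt)// ltrDl.
  have T'0 : 0 <= T' by rewrite (le_trans T0)// ltW.
  move: reg; rewrite /Sing /= => /contrapT; rewrite xiX//.
  move=> /differentiable_lower_slope[p lo].
  have := energy_bound es gc T0 TT' lo.
  congr (_ <= _); apply: eq_Rintegral => t; rewrite inE /= in_itv /= => /andP[t0 _].
  by rewrite xiX.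
case: hneg => mu [T [m [T0 _ Ty avg cvgm]]] mu0.
have Vc : continuous V.
  apply/quotient_continuous => y; case: hV => dV _ _.
  exact: differentiable_continuous (dV y).
have B0 : 0 <= B by rewrite (le_trans _ (es_UB es 0)).
set c := - \int[mu]_y V y; have c0 : 0 < c by rewrite oppr_gt0.
have c20 : 0 < c / 2 by rewrite divr_gt0.
have : \forall k \near \oo, False.
  (* Along the averages defining mu, the mean of V tends to - c < 0, but it is
     at least - B / T k. *)
  have n1 : \forall k \near \oo, `|\int[mu]_y V y - \int[m k]_y V y| < c / 2.
    by have /cvgrPdist_lt/(_ _ c20) := cvgm V Vc.
  have n2 : \forall k \near \oo, 2 * B / c < T k.
    by move/cvgryPgt : Ty; apply.
  near=> k.
  have h1 : `|\int[mu]_y V y - \int[m k]_y V y| < c / 2 by near: k.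
  have h2 : 2 * B / c < T k by near: k.
  move: h1; rewrite (avg k V Vc) ltr_norml => /andP[h1 _].
  have h3 : - B / T k <=
      (T k)^-1 * \int[@lebesgue_measure R]_(t in `[0, (T k)]) V (xi t).
    by rewrite mulrC ler_pM2l ?invr_gt0// bound// ltW.
  have h4 : B / T k < c / 2.
    by move: h2; rewrite !ltr_pdivrMr//; lra.
  move: h1 h3 h4; rewrite /c mulNr; lra.
by case=> N _ /(_ N (leqnn N)).
Unshelve. all: by end_near. Qed.
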